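(* Let $\lambda,\mu\in\mathbb{C}$, $\nu\in(-1/2,\infty)\setminus\{0\}$, $\rho\in\{z\in\mathbb{C}:|z|<1\}$, $x\in[-1,1]$, and put $R:=\sqrt{1+\rho^2-2\rho x}$. Then $$(1-x^2)^{1/4-\mu/2}\,P_{\lambda+\mu-1/2}^{1/2-\mu}(R+\rho)\,\mathrm{P}_{\lambda+\mu-1/2}^{1/2-\mu}(R-\rho)=\frac{(\rho/2)^{\mu-1/2}}{\nu\,\Gamma(\mu+1/2)^2}\sum_{n=0}^\infty\frac{(\nu+n)(-\lambda)_n(2\mu+\lambda)_n(\mu)_n}{(2\mu)_n(\mu+1/2)_n(\nu+1)_n}$$ $$\times\,{}_6F_5\!\left(\begin{array}{c}\frac{-\lambda+n}{2},\ \frac{-\lambda+n+1}{2},\ \frac{2\mu+\lambda+n}{2},\ \frac{2\mu+\lambda+n+1}{2},\ \mu+n,\ \mu-\nu\\ \frac{2\mu+n}{2},\ \frac{2\mu+n+1}{2},\ \frac{\mu+n+\frac12}{2},\ \frac{\mu+n+\frac32}{2},\ \nu+1+n\end{array};\rho^2\right)\rho^nC_n^\nu(x).$$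
   Context: Square roots and complex powers are principal. $(z)_n:=\prod_{i=1}^n(z+i-1)$ is the Pochhammer symbol. ${}_pF_q(a_1,\dots,a_p;b_1,\dots,b_q;z):=\sum_{n=0}^\infty\frac{(a_1)_n\cdots(a_p)_n}{(b_1)_n\cdots(b_q)_n}\frac{z^n}{n!}$ (${}_2F_1$ being continued analytically to $\mathbb{C}\setminus[1,\infty)$). The Gegenbauer polynomials are $C_n^\nu(z):=\frac{(2\nu)_n}{n!}\,{}_2F_1\left(-n,n+2\nu;\nu+\frac12;\frac{1-z}{2}\right)$, $n\in\mathbb{N}_0=\{0,1,2,\dots\}$. The associated Legendre function of the first kind (italic $P$) on $\mathbb{C}\setminus(-\infty,1]$ is $$P_\nu^\mu(z):=\frac{1}{\Gamma(1-\mu)}\left(\frac{z+1}{z-1}\right)^{\mu/2}{}_2F_1\!\left(-\nu,\nu+1;1-\mu;\frac{1-z}{2}\right),$$ and the Ferrers function of the first kind (upright $\mathrm{P}$) on $(-1,1)$ is $$\mathrm{P}_\nu^\mu(t):=\frac{1}{\Gamma(1-\mu)}\left(\frac{1+t}{1-t}\right)^{\mu/2}{}_2F_1\!\left(-\nu,\nu+1;1-\mu;\frac{1-t}{2}\right),$$ where for $1-\mu\in\{0,-1,-2,\dots\}$ the product $\frac{1}{\Gamma(1-\mu)}{}_2F_1$ is understood by continuity in $\mu$. Interpretation: for $\rho\in(0,1)$ and $x\in(-1,1)$ one has $R+\rho>1$ and $R-\rho\in(-1,1)$, so that the left-hand side is literally defined. At $x=\pm1$ it is defined by continuity in $x$.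 For other $\rho$ in the unit disc the identity is understood after dividing both sides by $(\rho/2)^{\mu-1/2}$, the quotient of the left-hand side being the analytic continuation in $\rho$, from $(0,1)$ to the unit disc. For exceptional values of $\mu$ at which factors on the right are not individually defined ($2\mu\in\{0,-1,-2,\dots\}$), each term of the right-hand side, including the prefactor $1/\Gamma(\mu+1/2)^2$, is understood by analytic continuation in $\mu$. *)

(* Defs.v *)
From Stdlib Require Export Reals Factorial List ClassicalEpsilon.
From Coquelicot Require Export Coquelicot.
Export ListNotations.
Open Scope C_scope.

(* The complex number satisfying [P], when there is exactly one. *)
Definition Ciota (P : C -> Prop) : C := @iota C_CompleteNormedModule P.

Definition CSeries (a : nat -> C) : C := Ciota (fun s : C => is_series a s).

Definition holomorphic_on (U : C -> Prop) (f : C -> C) : Prop :=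
  forall z : C, U z -> ex_derive f z.

(* Principal argument, in (-PI, PI]; the value at 0 is irrelevant. *)
Definition Carg (z : C) : R :=
  if Rle_dec 0 (Im z) then acos (Re z / Cmod z) else (- acos (Re z / Cmod z))%R.

Definition Cexp (z : C) : C := (exp (Re z) * cos (Im z), exp (Re z) * sin (Im z))%R.

Definition Clog (z : C) : C := (ln (Cmod z), Carg z).

(* Principal power, meaningful for [z <> 0]. *)
Definition Cpower (z a : C) : C := Cexp (a * Clog z).

Fixpoint poch (z : C) (n : nat) : C :=
  match n with
  | O => 1
  | S m => poch z m * (z + INR m)
  end.

(* Euler's limit  n! n^z / (z (z+1) ... (z+n)),  meaningful off {0,-1,-2,...}. *)
Definition Gamma (z : C) : C :=
  Ciota (fun g : C =>
    filterlim (fun n : nat => INR (fact n) * Cpower (INR n) z / poch z (S n))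
      eventually (locally g)).

Definition nonpos_int (z : C) : Prop := exists k : nat, z = - INR k.

Definition Cprod (l : list C) : C := fold_right Cmult 1 l.

Definition pFq (a b : list C) (z : C) : C :=
  CSeries (fun n : nat =>
    Cprod (map (fun u => poch u n) a) / Cprod (map (fun u => poch u n) b)
      * (z ^ n / INR (fact n))).

Definition off_cut (z : C) : Prop := ~ (Im z = 0%R /\ (1 <= Re z)%R).

(* 2F1 on C \ [1, oo): the series in the unit disc, its analytic continuation
   elsewhere. *)
Definition hyp2F1 (a b c z : C) : C :=
  if Rlt_dec (Cmod z) 1 then pFq [a; b] [c] z
  else Ciota (fun w : C => exists f : C -> C,
    holomorphic_on off_cut f /\
    (forall u : C, (Cmod u < 1)%R -> f u = pFq [a; b] [c] u) /\
    f z = w).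

(* The product 2F1(a,b;c;z) / Gamma(c), by continuity in c at its poles. *)
Definition reg2F1 (a b c z : C) : C :=
  if excluded_middle_informative (nonpos_int c)
  then Ciota (fun w : C =>
    filterlim (fun c' : C => / Gamma c' * hyp2F1 a b c' z) (locally' c) (locally w))
  else / Gamma c * hyp2F1 a b c z.

(* Terminating series, so evaluated directly even where (1-z)/2 is on the cut. *)
Definition Gegenbauer (n : nat) (nu z : C) : C :=
  poch (2 * nu) n / INR (fact n)
    * pFq [- INR n; INR n + 2 * nu] [nu + 1 / 2] ((1 - z) / 2).

Definition LegendreP (nu mu z : C) : C :=
  Cpower ((z + 1) / (z - 1)) (mu / 2) * reg2F1 (- nu) (nu + 1) (1 - mu) ((1 - z) / 2).

Definition FerrersP (nu mu : C) (t : R) : C :=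
  Cpower ((1 + t) / (1 - t)) (mu / 2) * reg2F1 (- nu) (nu + 1) (1 - mu) ((1 - t) / 2).

(* Literal left-hand side, meaningful for 0 < r < 1 and -1 < x < 1. *)
Definition lhs (lambda mu : C) (r x : R) : C :=
  let rt := sqrt (1 + r ^ 2 - 2 * r * x) in
  Cpower (1 - x ^ 2) (1 / 4 - mu / 2)
    * LegendreP (lambda + mu - 1 / 2) (1 / 2 - mu) (rt + r)%R
    * FerrersP (lambda + mu - 1 / 2) (1 / 2 - mu) (rt - r)%R.

Definition is_lhs (lambda mu : C) (r x : R) (w : C) : Prop :=
  ((-1 < x < 1)%R /\ lhs lambda mu r x = w) \/
  ((x = -1 \/ x = 1)%R /\
   filterlim (lhs lambda mu r) (within (fun y : R => (-1 < y < 1)%R) (locally x))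
     (locally w)).

(* [Q] is the analytic continuation to the unit disc of the quotient of the
   left-hand side by (rho/2)^(mu-1/2); it is unique there by the identity theorem. *)
Definition is_lhs_quotient (lambda mu : C) (x : R) (Q : C -> C) : Prop :=
  holomorphic_on (fun z : C => (Cmod z < 1)%R) Q /\
  forall r : R, (0 < r < 1)%R ->
    exists w : C, is_lhs lambda mu r x w /\ Q r = w / Cpower (r / 2) (mu - 1 / 2).

(* n-th term of the right-hand series, including the prefactor 1/Gamma(mu+1/2)^2
   but not (rho/2)^(mu-1/2)/nu; meaningful for 2 mu not in {0,-1,-2,...}. *)
Definition rhs_term_generic (lambda : C) (nu : R) (rho : C) (x : R) (n : nat) (mu : C) : C :=
  / Gamma (mu + 1 / 2) ^ 2
  * ((nu + INR n) * poch (- lambda) n * poch (2 * mu + lambda) n * poch mu n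
     / (poch (2 * mu) n * poch (mu + 1 / 2) n * poch (nu + 1) n))
  * pFq [ (- lambda + INR n) / 2; (- lambda + INR n + 1) / 2;
          (2 * mu + lambda + INR n) / 2; (2 * mu + lambda + INR n + 1) / 2;
          mu + INR n; mu - nu ]
        [ (2 * mu + INR n) / 2; (2 * mu + INR n + 1) / 2;
          (mu + INR n + 1 / 2) / 2; (mu + INR n + 3 / 2) / 2;
          nu + 1 + INR n ]
        (rho ^ 2)
  * rho ^ n * Gegenbauer n nu x.

(* [w] is the value at [z] of the analytic continuation of [g] from a punctured
   neighbourhood of [z]. *)
Definition is_continuation_at (g : C -> C) (z w : C) : Prop :=
  exists f : C -> C,
    locally z (fun u : C => ex_derive f u) /\
    locally' z (fun u : C => f u = g u) /\
    f z = w.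

Definition rhs_term (lambda mu : C) (nu : R) (rho : C) (x : R) (n : nat) : C :=
  if excluded_middle_informative (nonpos_int (2 * mu))
  then Ciota (fun w : C => is_continuation_at (rhs_term_generic lambda nu rho x n) mu w)
  else rhs_term_generic lambda nu rho x n mu.

(* Main.v *)
Require Import Defs.
From Stdlib Require Import Lra Lia Psatz.

(** The product on the left is a product of two Gauss series, and the right-hand
    side is one power series in [rho] whose coefficients are expanded in Gegenbauer
    polynomials.  Put [a = -lambda], [b = 2 mu + lambda], [c = mu + 1/2],
    [X = (1 - R - rho)/2] and [Y = (1 - R + rho)/2], so that
    [X (1 - Y) = rho (x - 1)/2], [Y (1 - X) = rho (x + 1)/2] and [Y - X = rho].
    Three facts then give the result.

    Euler's transformation turns both Legendre functions into Gauss series with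
    parameters [a, b; c], and the powers that it produces cancel against the
    prefactors: the quotient of the left-hand side by [(rho/2)^(mu-1/2)] is
    [F(X) F(Y)], where [F] is [2F1(a, b; c; .) / Gamma(c)] ([lhs_gegenbauer_sum]).

    Bailey's factorisation of Appell's function [F4] reads
    [F(X) F(Y) = Sum_N (a)_N (b)_N H_N], where [H_N] is the part of degree [N] in
    [u = X (1 - Y)] and [v = Y (1 - X)] of the product of two series [0F1(c; .)];
    up to a constant it is [rho^N] times the Gegenbauer polynomial [C_N^mu(x)].  The
    double series in [u, v] does not converge absolutely for all [rho < 1], but the
    series over [N] does.  For real [a, b >= 1] and fixed [Y], both sides solve the
    hypergeometric equation in [X] and are regular at the singular point [X = 0];
    since [2c - 1 = a + b] is positive, an energy estimate applied to the partial sums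
    forces them to agree ([energy_bound], [product_formula_real]).  Both sides are
    entire in [a] and in [b], so the identity theorem removes the restriction
    ([product_formula]).

    The connection formula expands [C_N^mu] in the polynomials [C_(N-2k)^nu]
    ([geg_connection]).  After the substitution the terms are dominated by
    [K (N+1)^B |rho|^N], uniformly for bounded parameters ([dcoef_bound]): the
    factorials combine to a central binomial probability.  Hence the series may be
    summed by powers of [rho], which gives holomorphy in [rho] and continuity in [x] up
    to [1] and [-1], or by the degree [n] of the Gegenbauer polynomial, which gives the
    series of [6F5] functions.

    With the factor [1/Gamma(mu+1/2)^2] absorbed by the duplication formula, every
    coefficient is entire in [mu]; this settles the exceptional values of [mu].

    Complex analysis enters only through functions that are uniform limits of
    polynomials on discs.  Cauchy's estimate for the coefficients of a polynomial, an
    average over roots of unity, makes such a limit a power series; differentiability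
    and the identity theorem follow without contour integrals. *)

(** * Finite sums and geometrically dominated series of complex numbers *)

(** [sum_n] at the two carriers in use; the result type is fixed so that [ring]
    recognises it. *)
Definition Csum (f : nat -> C) (n : nat) : C := sum_n f n.
Definition Rsum (f : nat -> R) (n : nat) : R := sum_n f n.

Lemma Csum_plus (f g : nat -> C) n :
  Csum (fun k => f k + g k) n = Csum f n + Csum g n.
Proof. exact (sum_n_plus f g n). Qed.

Lemma Csum_scal (c : C) (f : nat -> C) n :
  Csum (fun k => c * f k) n = c * Csum f n.
Proof. exact (sum_n_mult_l c f n). Qed.

Lemma Csum_S (f : nat -> C) n : Csum f (S n) = Csum f n + f (S n).
Proof. exact (sum_Sn f n). Qed.

Lemma Rsum_S (f : nat -> R) n : Rsum f (S n) = (Rsum f n + f (S n))%R.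
Proof. exact (sum_Sn f n). Qed.

Lemma Rsum_0 (f : nat -> R) : Rsum f 0 = f O.
Proof. exact (sum_O f). Qed.

Lemma Csum_0 (f : nat -> C) : Csum f 0 = f O.
Proof. exact (sum_O f). Qed.

Lemma Rsum_ext (f g : nat -> R) n :
  (forall k, (k <= n)%nat -> f k = g k) -> Rsum f n = Rsum g n.
Proof. intros H. apply sum_n_ext_loc. exact H. Qed.

Lemma Csum_ext (f g : nat -> C) n :
  (forall k, (k <= n)%nat -> f k = g k) -> Csum f n = Csum g n.
Proof. intros H. apply sum_n_ext_loc. exact H. Qed.

Lemma Rsum_plus (f g : nat -> R) n :
  Rsum (fun k => f k + g k)%R n = (Rsum f n + Rsum g n)%R.
Proof. exact (sum_n_plus f g n). Qed.

Lemma Rsum_scal (c : R) (f : nat -> R) n :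
  Rsum (fun k => c * f k)%R n = (c * Rsum f n)%R.
Proof. exact (sum_n_mult_l c f n). Qed.

Lemma Rsum_Sl (f : nat -> R) n :
  Rsum f (S n) = (f O + Rsum (fun k => f (S k)) n)%R.
Proof.
  unfold Rsum, sum_n. rewrite sum_Sn_m by lia. rewrite sum_n_m_S. reflexivity.
Qed.

Lemma Csum_Sl (f : nat -> C) n : Csum f (S n) = f O + Csum (fun k => f (S k)) n.
Proof.
  unfold Csum, sum_n. rewrite sum_Sn_m by lia. rewrite sum_n_m_S. reflexivity.
Qed.

Lemma Cmod_Csum_le (f : nat -> C) (M : R) n :
  (forall k, (k <= n)%nat -> (Cmod (f k) <= M)%R) ->
  (Cmod (Csum f n) <= INR (S n) * M)%R.
Proof.
  induction n as [|n IH]; intros H.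
  - rewrite Csum_0. simpl. rewrite Rmult_1_l. apply H; lia.
  - rewrite Csum_S. eapply Rle_trans; [apply Cmod_triangle|].
    rewrite (S_INR (S n)), Rmult_plus_distr_r, Rmult_1_l.
    apply Rplus_le_compat; [apply IH; intros; apply H; lia|apply H; lia].
Qed.

Lemma Cminus_eq_0 (a b : C) : a - b = 0 -> a = b.
Proof. intros H. replace a with (a - b + b) by ring. rewrite H. ring. Qed.

Lemma Cmult_cancel_l (c a b : C) : c <> 0 -> c * a = c * b -> a = b.
Proof.
  intros Hc H. replace a with (/ c * (c * a)) by (field; exact Hc).
  rewrite H. field. exact Hc.
Qed.

Lemma Cmod_minus_sym (a b : C) : Cmod (a - b) = Cmod (b - a).
Proof. rewrite <- Cmod_opp. f_equal. ring. Qed.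

Lemma Cmod_triangle_minus (a b : C) : (Cmod (a - b) <= Cmod a + Cmod b)%R.
Proof.
  unfold Cminus. eapply Rle_trans; [apply Cmod_triangle|]. rewrite Cmod_opp. lra.
Qed.

Lemma Cmod_triangle_3 (a b c : C) : (Cmod (a - c) <= Cmod (a - b) + Cmod (b - c))%R.
Proof. replace (a - c) with ((a - b) + (b - c)) by ring. apply Cmod_triangle. Qed.

Lemma Cmod_small_eq (a b : C) : (forall eps, 0 < eps -> Cmod (a - b) <= eps)%R -> a = b.
Proof.
  intros H. apply Cminus_eq_0, Cmod_eq_0.
  destruct (Rle_lt_dec (Cmod (a - b)) 0) as [h|h].
  - apply Rle_antisym; [exact h|apply Cmod_ge_0].
  - specialize (H (Cmod (a - b) / 2)%R ltac:(lra)). lra.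
Qed.

Lemma Cmod_INR n : Cmod (INR n) = INR n.
Proof. rewrite Cmod_R. apply Rabs_pos_eq, pos_INR. Qed.

(** The neighbourhoods of [C] are those of the product [R * R]; the estimates are all
    in terms of the modulus. *)
Lemma locally_C (z : C) (P : C -> Prop) :
  locally z P <-> exists eps, (0 < eps)%R /\ forall w, (Cmod (w - z) < eps)%R -> P w.
Proof.
  split.
  - intros [e H]. exists e. split; [apply cond_pos|]. intros w Hw.
    apply H. apply (C_NormedModule_mixin_compat1 z w e Hw).
  - intros [e [He H]].
    assert (He2 : (0 < e / 2)%R) by lra.
    exists (mkposreal _ He2). intros w Hw. apply H.
    pose proof (C_NormedModule_mixin_compat2 z w (mkposreal _ He2) Hw) as h.
    simpl in h. eapply Rlt_le_trans; [exact h|].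
    assert (sqrt 2 <= 2)%R.
    { rewrite <- (sqrt_square 2) at 2 by lra. apply sqrt_le_1_alt. lra. }
    nra.
Qed.

Lemma is_series_C (a : nat -> C) (s : C) :
  is_series a s <->
  forall eps, (0 < eps)%R ->
    exists N, forall n, (N <= n)%nat -> (Cmod (Csum a n - s) < eps)%R.
Proof.
  split.
  - intros H eps He.
    assert (L : locally s (fun w : C => (Cmod (w - s) < eps)%R)).
    { apply locally_C. exists eps. split; auto. }
    destruct (H _ L) as [N HN]. exists N. exact HN.
  - intros H P HP. apply locally_C in HP. destruct HP as [e [He HP]].
    destruct (H e He) as [N HN]. exists N. intros n Hn. apply HP, HN, Hn.
Qed.

Lemma is_series_C_unique (a : nat -> C) (s t : C) :
  is_series a s -> is_series a t -> s = t.
Proof.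
  intros Hs Ht. exact (filterlim_locally_unique _ s t Hs Ht).
Qed.

Lemma is_series_Cplus (a b : nat -> C) s t :
  is_series a s -> is_series b t -> is_series (fun n => a n + b n) (s + t).
Proof. exact (is_series_plus a b s t). Qed.

Lemma is_series_Cmult (c : C) (a : nat -> C) s :
  is_series a s -> is_series (fun n => c * a n) (c * s).
Proof. exact (is_series_scal c a s). Qed.

Lemma is_series_C_ext (a b : nat -> C) s :
  (forall n, a n = b n) -> is_series a s -> is_series b s.
Proof. exact (is_series_ext a b s). Qed.

(** Multiplication of a power series by its variable, on the level of terms. *)
Definition shift_seq (a : nat -> C) (n : nat) : C :=
  match n with O => 0 | S m => a m end.

Lemma is_series_shift (a : nat -> C) s :
  is_series a s -> is_series (shift_seq a) s.
Proof.
  rewrite !is_series_C. intros H eps He. destruct (H eps He) as [N HN].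
  exists (S N). intros [|n] Hn; [lia|].
  rewrite Csum_Sl. simpl. rewrite Cplus_0_l. apply HN. lia.
Qed.

Lemma is_series_finite (a : nat -> C) N :
  (forall k, (N < k)%nat -> a k = 0) -> is_series a (Csum a N).
Proof.
  intros H. apply is_series_C. intros eps He. exists N. intros n Hn.
  replace (Csum a n) with (Csum a N).
  - unfold Cminus. rewrite Cplus_opp_r, Cmod_0. exact He.
  - induction Hn as [|n Hn IH]; [reflexivity|].
    rewrite Csum_S, <- IH, H by lia. ring.
Qed.

Lemma Csum_geom_bound (a : nat -> C) (M q : R) n K :
  (0 <= q < 1)%R -> (forall n, Cmod (a n) <= M * q ^ n)%R ->
  (Cmod (Csum a (K + n) - Csum a K) <= M * (q ^ S K - q ^ S (K + n)) / (1 - q))%R.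
Proof.
  intros Hq Ha. induction n as [|n IH].
  - rewrite Nat.add_0_r. unfold Cminus. rewrite Cplus_opp_r, Cmod_0. unfold Rminus.
    rewrite Rplus_opp_r, Rmult_0_r. unfold Rdiv. lra.
  - rewrite <- plus_n_Sm, Csum_S.
    replace (Csum a (K + n) + a (S (K + n)) - Csum a K)
      with ((Csum a (K + n) - Csum a K) + a (S (K + n))) by ring.
    eapply Rle_trans; [apply Cmod_triangle|].
    eapply Rle_trans; [apply Rplus_le_compat; [exact IH|apply Ha]|].
    apply Req_le. simpl. field. lra.
Qed.

(** The Weierstrass test. The explicit tail makes the convergence uniform in every
    parameter on which [M] and [q] do not depend. *)
Lemma geom_series (a : nat -> C) (M q : R) :
  (0 <= q < 1)%R -> (forall n, Cmod (a n) <= M * q ^ n)%R ->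
  exists s : C, is_series a s /\
    forall K, (Cmod (Csum a K - s) <= M * q ^ S K / (1 - q))%R.
Proof.
  intros Hq Ha.
  assert (HM : (0 <= M)%R).
  { pose proof (Ha O). simpl in H. pose proof (Cmod_ge_0 (a O)). lra. }
  assert (Hex : ex_series a).
  { apply (ex_series_le (K := C_AbsRing) (V := C_CompleteNormedModule) a
             (fun n => M * q ^ n)%R); [exact Ha|].
    apply (ex_series_scal_l (V := R_NormedModule)), ex_series_geom.
    rewrite Rabs_pos_eq; lra. }
  destruct Hex as [s Hs]. exists s. split; [exact Hs|].
  intros K. apply Rnot_lt_le. intros Hlt.
  set (d := (Cmod (Csum a K - s) - M * q ^ S K / (1 - q))%R).
  destruct (proj1 (is_series_C a s) Hs d ltac:(unfold d; lra)) as [N HN].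
  specialize (HN (K + N)%nat ltac:(lia)).
  pose proof (Csum_geom_bound a M q N K Hq Ha) as HB.
  pose proof (Cmod_triangle_3 (Csum a K) (Csum a (K + N)) s) as HT.
  rewrite (Cmod_minus_sym (Csum a K) (Csum a (K + N))) in HT.
  assert (M * (q ^ S K - q ^ S (K + N)) / (1 - q) <= M * q ^ S K / (1 - q))%R.
  { unfold Rdiv. apply Rmult_le_compat_r.
    - apply Rlt_le, Rinv_0_lt_compat. lra.
    - apply Rmult_le_compat_l; [exact HM|].
      pose proof (pow_le q (S (K + N)) ltac:(lra)). lra. }
  unfold d in HN. lra.
Qed.

Lemma geom_series_bound (a : nat -> C) (M q : R) (s : C) :
  (0 <= q < 1)%R -> (forall n, Cmod (a n) <= M * q ^ n)%R -> is_series a s ->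
  (Cmod s <= M / (1 - q))%R.
Proof.
  intros Hq Ha Hs. destruct (geom_series a M q Hq Ha) as [s' [Hs' Ht]].
  rewrite <- (is_series_C_unique _ _ _ Hs Hs') in Ht.
  specialize (Ht O). rewrite Csum_0, Cmod_minus_sym in Ht. specialize (Ha O).
  replace s with ((s - a O) + a O) by ring.
  eapply Rle_trans; [apply Cmod_triangle|]. simpl pow in *.
  replace (M / (1 - q))%R with (M * (q * 1) / (1 - q) + M * 1)%R by (field; lra). lra.
Qed.

Lemma pow_small (M q : R) (eps : R) :
  (0 <= q < 1)%R -> (0 < eps)%R ->
  exists K0, forall K, (K0 <= K)%nat -> (M * q ^ K < eps)%R.
Proof.
  intros Hq He.
  assert (H : is_lim_seq (fun K => M * q ^ K)%R (M * 0)%R).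
  { apply is_lim_seq_mult'; [apply is_lim_seq_const|]. apply is_lim_seq_geom.
    rewrite Rabs_pos_eq; lra. }
  rewrite Rmult_0_r in H. apply is_lim_seq_spec in H.
  destruct (H (mkposreal eps He)) as [K0 HK]. exists K0. intros K HKK.
  specialize (HK K HKK). simpl in HK. rewrite Rminus_0_r in HK. apply Rabs_def2 in HK.
  apply HK.
Qed.

Lemma geom_tail_lim (M q : R) (eps : R) :
  (0 <= q < 1)%R -> (0 < eps)%R ->
  exists K0, forall K, (K0 <= K)%nat -> (M * q ^ S K / (1 - q) < eps)%R.
Proof.
  intros Hq He. destruct (pow_small (M * q / (1 - q)) q eps Hq He) as [K0 HK].
  exists K0. intros K HKK.
  replace (M * q ^ S K / (1 - q))%R with (M * q / (1 - q) * q ^ K)%R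
    by (simpl; field; lra).
  apply HK, HKK.
Qed.

Lemma bernoulli_le (h : R) n : (0 <= h)%R -> (1 + INR n * h <= (1 + h) ^ n)%R.
Proof.
  intros Hh. induction n as [|n IH]; [simpl; lra|].
  rewrite S_INR. simpl.
  assert (0 <= INR n * h * h)%R.
  { apply Rmult_le_pos; [apply Rmult_le_pos; [apply pos_INR|exact Hh]|exact Hh]. }
  nra.
Qed.

(** Coefficients are only ever controlled up to polynomial growth; this turns such a
    bound into the hypothesis of [geom_series]. *)
Lemma poly_geom (B : nat) (q : R) :
  (0 <= q < 1)%R ->
  exists M p, (0 <= p < 1)%R /\ (0 < M)%R /\ (q <= p)%R /\
    forall n, (INR (S n) ^ B * q ^ n <= M * p ^ n)%R.
Proof.
  intros Hq.
  assert (H1 : forall q, (0 <= q < 1)%R ->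
            exists M p, (0 <= p < 1)%R /\ (0 < M)%R /\ (q <= p)%R /\
              forall n, (INR (S n) * q ^ n <= M * p ^ n)%R).
  { clear q Hq. intros q Hq. exists (2 / (1 - q))%R, ((1 + q) / 2)%R.
    split; [lra|]. split; [apply Rdiv_lt_0_compat; lra|]. split; [lra|].
    intros n.
    (* ((1+q)/2)/q >= 1 + (1-q)/2, so Bernoulli's inequality applies *)
    assert (Hp : (q * (1 + (1 - q) / 2) <= (1 + q) / 2)%R) by nra.
    assert (Hpn : ((q * (1 + (1 - q) / 2)) ^ n <= ((1 + q) / 2) ^ n)%R).
    { apply pow_incr. split; [apply Rmult_le_pos; lra|exact Hp]. }
    rewrite Rpow_mult_distr in Hpn.
    pose proof (bernoulli_le ((1 - q) / 2) n ltac:(lra)) as HB.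
    pose proof (pow_le q n ltac:(lra)) as Hqn.
    assert (Hn : (INR (S n) <= 2 / (1 - q) * (1 + (1 - q) / 2) ^ n)%R).
    { rewrite S_INR.
      apply Rle_trans with (2 / (1 - q) * (1 + INR n * ((1 - q) / 2)))%R.
      - replace (2 / (1 - q) * (1 + INR n * ((1 - q) / 2)))%R
          with (INR n + 2 / (1 - q))%R by (field; lra).
        apply Rplus_le_compat_l. apply Rle_div_r; lra.
      - apply Rmult_le_compat_l; [apply Rlt_le, Rdiv_lt_0_compat; lra|exact HB]. }
    assert (0 < 2 / (1 - q))%R by (apply Rdiv_lt_0_compat; lra).
    apply Rle_trans with (2 / (1 - q) * (1 + (1 - q) / 2) ^ n * q ^ n)%R.
    - apply Rmult_le_compat_r; assumption.
    - rewrite Rmult_assoc. apply Rmult_le_compat_l; lra. }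
  induction B as [|B [M [p [Hp [HM [Hqp IH]]]]]].
  - exists 1%R, q. repeat split; try lra. intros n. simpl. lra.
  - destruct (H1 p Hp) as [M1 [p1 [Hp1 [HM1 [Hpp1 H]]]]].
    exists (M * M1)%R, p1. split; [exact Hp1|]. split; [apply Rmult_lt_0_compat; lra|].
    split; [lra|]. intros n.
    change (INR (S n) ^ S B)%R with (INR (S n) * INR (S n) ^ B)%R.
    replace (INR (S n) * INR (S n) ^ B * q ^ n)%R
      with (INR (S n) * (INR (S n) ^ B * q ^ n))%R by ring.
    apply Rle_trans with (INR (S n) * (M * p ^ n))%R.
    + apply Rmult_le_compat_l; [apply pos_INR|apply IH].
    + replace (INR (S n) * (M * p ^ n))%R with (M * (INR (S n) * p ^ n))%R by ring.
      rewrite Rmult_assoc. apply Rmult_le_compat_l; [lra|apply H].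
Qed.

(** * Complex exponentials and roots of unity *)

Lemma Cexp_plus (z w : C) : Cexp (z + w) = Cexp z * Cexp w.
Proof.
  unfold Cexp. destruct z as [a b], w as [c d]. simpl.
  unfold Cmult. simpl. rewrite exp_plus, cos_plus, sin_plus.
  apply injective_projections; simpl; ring.
Qed.

Lemma Cexp_0 : Cexp 0 = 1.
Proof.
  unfold Cexp. simpl. rewrite exp_0, cos_0, sin_0.
  apply injective_projections; simpl; ring.
Qed.

Lemma Cmod_Cexp (z : C) : Cmod (Cexp z) = exp (Re z).
Proof.
  unfold Cmod, Cexp. simpl.
  replace (exp (Re z) * cos (Im z) * (exp (Re z) * cos (Im z) * 1)
      + exp (Re z) * sin (Im z) * (exp (Re z) * sin (Im z) * 1))%R
    with (exp (Re z) * exp (Re z) * (Rsqr (sin (Im z)) + Rsqr (cos (Im z))))%R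
    by (unfold Rsqr; ring).
  rewrite sin2_cos2, Rmult_1_r. apply sqrt_square, Rlt_le, exp_pos.
Qed.

Lemma Cexp_neq_0 (z : C) : Cexp z <> 0.
Proof.
  apply Cmod_gt_0. rewrite Cmod_Cexp. apply exp_pos.
Qed.

Lemma Cexp_opp (z : C) : Cexp (- z) = / Cexp z.
Proof.
  assert (H : Cexp z * Cexp (- z) = 1).
  { rewrite <- Cexp_plus, <- Cexp_0. f_equal. ring. }
  assert (Hz := Cexp_neq_0 z).
  replace (Cexp (- z)) with (/ Cexp z * (Cexp z * Cexp (- z))) by (field; exact Hz).
  rewrite H. ring.
Qed.

Lemma Cexp_R (x : R) : Cexp x = exp x.
Proof.
  unfold Cexp. simpl. rewrite cos_0, sin_0. apply injective_projections; simpl; ring.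
Qed.

Lemma Cexp_pow (z : C) n : Cexp z ^ n = Cexp (INR n * z).
Proof.
  induction n as [|n IH].
  - change (Cexp z ^ 0) with (RtoC 1). rewrite <- Cexp_0. f_equal. simpl. ring.
  - rewrite S_INR, RtoC_plus. change (Cexp z ^ S n) with (Cexp z * Cexp z ^ n).
    rewrite IH, <- Cexp_plus. f_equal. ring.
Qed.

(** A primitive [M]-th root of unity. *)
Definition root_unity (M : nat) : C := Cexp (0, (2 * PI / INR M)%R).

Lemma root_unity_pow M n :
  root_unity M ^ n = Cexp (0, (2 * PI * INR n / INR M)%R).
Proof.
  unfold root_unity. rewrite Cexp_pow. f_equal.
  unfold Cmult, RtoC; simpl. apply injective_projections; simpl; unfold Rdiv; ring.
Qed.

Lemma Cmod_root_unity_pow M n : Cmod (root_unity M ^ n) = 1%R.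
Proof. rewrite root_unity_pow, Cmod_Cexp. simpl. apply exp_0. Qed.

Lemma root_unity_pow_M M : (0 < M)%nat -> root_unity M ^ M = 1.
Proof.
  intros H. rewrite root_unity_pow. unfold Cexp. simpl.
  assert (0 < INR M)%R by (apply lt_0_INR; lia).
  replace (2 * PI * INR M / INR M)%R with (2 * PI)%R by (field; lra).
  rewrite exp_0, cos_2PI, sin_2PI. apply injective_projections; simpl; ring.
Qed.

Lemma root_unity_pow_neq_1 M e :
  (0 < e < 2 * M)%nat -> e <> M -> root_unity M ^ e <> 1.
Proof.
  intros He HeM H. rewrite root_unity_pow in H. unfold Cexp in H. simpl in H.
  apply (f_equal Re) in H. simpl in H. rewrite exp_0, Rmult_1_l in H.
  assert (HM : (0 < INR M)%R) by (apply lt_0_INR; lia).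
  assert (He0 : (0 < INR e)%R) by (apply lt_0_INR; lia).
  assert (He2 : (INR e < 2 * INR M)%R).
  { change 2%R with (INR 2). rewrite <- mult_INR. apply lt_INR. lia. }
  pose proof PI_RGT_0 as HPI.
  set (t := (PI * INR e / INR M)%R).
  replace (2 * PI * INR e / INR M)%R with (2 * t)%R in H by (unfold t; field; lra).
  rewrite cos_2a_sin in H.
  assert (Hs : sin t <> 0%R).
  { assert (Ht : (t * INR M = PI * INR e)%R) by (unfold t; field; lra).
    destruct (Nat.lt_total e M) as [h|[h|h]]; [|contradiction|].
    - apply lt_INR in h. apply Rgt_not_eq, sin_gt_0; nra.
    - apply lt_INR in h. apply Rlt_not_eq, sin_lt_0; nra. }
  apply Hs. assert (sin t * sin t = 0)%R by lra.
  destruct (Rmult_integral _ _ H0); assumption.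
Qed.

Lemma geometric_sum (z : C) n : (z - 1) * Csum (fun j => z ^ j) n = z ^ S n - 1.
Proof.
  induction n as [|n IH].
  - rewrite Csum_0. simpl. ring.
  - rewrite Csum_S, Cmult_plus_distr_l, IH. simpl. ring.
Qed.

Lemma root_unity_sum M e :
  (0 < e < 2 * M)%nat ->
  Csum (fun j => root_unity M ^ (e * j)) (pred M) = if Nat.eqb e M then INR M else 0.
Proof.
  intros He.
  assert (HE : Csum (fun j => root_unity M ^ (e * j)) (pred M)
               = Csum (fun j => (root_unity M ^ e) ^ j) (pred M)).
  { apply Csum_ext. intros k _. rewrite Cpow_mult_r. reflexivity. }
  rewrite HE. destruct (Nat.eqb_spec e M) as [->|Hne].
  - rewrite root_unity_pow_M by lia.
    assert (Hs : forall n, Csum (fun j => (1 : C) ^ j) n = INR (S n)).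
    { induction n as [|n IH]; [rewrite Csum_0; simpl; ring|].
      rewrite Csum_S, IH, Cpow_1_l, (S_INR (S n)), RtoC_plus. ring. }
    rewrite Hs. do 2 f_equal. lia.
  - pose proof (geometric_sum (root_unity M ^ e) (pred M)) as HG.
    replace (S (pred M)) with M in HG by lia.
    rewrite <- Cpow_mult_r, Nat.mul_comm, Cpow_mult_r, root_unity_pow_M, Cpow_1_l in HG by lia.
    assert (Hne1 : root_unity M ^ e - 1 <> 0).
    { intros h. apply (root_unity_pow_neq_1 M e He Hne), Cminus_eq_0, h. }
    replace (1 - 1) with (RtoC 0) in HG by ring.
    destruct (Ceq_dec (Csum (fun j : nat => (root_unity M ^ e) ^ j) (pred M)) 0) as [h|h];
      [exact h|].
    exfalso. exact (Cmult_neq_0 _ _ Hne1 h HG).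
Qed.

(** * Entire functions as locally uniform limits of polynomials *)

(** Lists of coefficients rather than functions: the limit arguments need the
    coefficients of sums, products and translates. *)
Definition peval (l : list C) (z : C) : C := fold_right (fun c acc => c + z * acc) 0 l.

Lemma peval_cons c l z : peval (c :: l) z = c + z * peval l z.
Proof. reflexivity. Qed.

Lemma peval_nil z : peval [] z = 0.
Proof. reflexivity. Qed.

Fixpoint padd (l m : list C) : list C :=
  match l, m with
  | [], _ => m
  | _, [] => l
  | a :: l', b :: m' => (a + b) :: padd l' m'
  end.

Lemma peval_add l m z : peval (padd l m) z = peval l z + peval m z.
Proof.
  revert m. induction l as [|a l IH]; intros [|b m]; simpl padd;
    rewrite ?peval_cons, ?peval_nil; try ring.
  rewrite IH. ring.
Qed.

Lemma peval_scal c l z : peval (map (Cmult c) l) z = c * peval l z.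
Proof.
  induction l as [|a l IH]; simpl map; rewrite ?peval_cons, ?peval_nil; [ring|].
  rewrite IH. ring.
Qed.

Fixpoint pmul (l m : list C) : list C :=
  match l with
  | [] => []
  | a :: l' => padd (map (Cmult a) m) (RtoC 0 :: pmul l' m)
  end.

Lemma peval_mul l m z : peval (pmul l m) z = peval l z * peval m z.
Proof.
  induction l as [|a l IH]; simpl pmul; rewrite ?peval_cons, ?peval_nil; [ring|].
  rewrite peval_add, peval_scal, peval_cons, IH. ring.
Qed.

Fixpoint pshift (z0 : C) (l : list C) : list C :=
  match l with
  | [] => []
  | a :: l' => padd [a] (pmul [z0; RtoC 1] (pshift z0 l'))
  end.

Lemma peval_shift z0 l w : peval (pshift z0 l) w = peval l (z0 + w).
Proof.
  induction l as [|a l IH]; [reflexivity|].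
  change (pshift z0 (a :: l)) with (padd [a] (pmul [z0; RtoC 1] (pshift z0 l))).
  rewrite peval_add, peval_mul, IH, !peval_cons, peval_nil. ring.
Qed.

Lemma peval_Csum l z n :
  (length l <= S n)%nat -> peval l z = Csum (fun k => nth k l 0 * z ^ k) n.
Proof.
  revert n. induction l as [|a l IH]; intros n Hn.
  - simpl peval. symmetry. induction n as [|n IHn].
    + rewrite Csum_0. simpl. ring.
    + rewrite Csum_S, IHn by (simpl; lia). simpl. ring.
  - destruct n as [|n].
    + destruct l; [|simpl in Hn; lia]. rewrite Csum_0. simpl. ring.
    + rewrite Csum_Sl, peval_cons. f_equal; [simpl; ring|].
      rewrite (IH n) by (simpl in Hn; lia). rewrite <- Csum_scal.
      apply Csum_ext. intros k _. simpl. ring.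
Qed.

(** Cauchy's estimate for the coefficients: averaging [p (r w) w^-k] over the
    [M]-th roots of unity [w] isolates the coefficient of degree [k] as soon as
    [M] exceeds the degree. *)
Lemma peval_cauchy l (r B : R) k :
  (0 <= r)%R -> (forall w, Cmod w <= r -> Cmod (peval l w) <= B)%R ->
  (Cmod (nth k l 0) * r ^ k <= B)%R.
Proof.
  intros Hr HB.
  set (M := S (length l + k)). set (om := root_unity M).
  assert (Hsum : Csum (fun j => peval l (r * om ^ j) * om ^ ((M - k) * j)) (pred M)
                 = INR M * (nth k l 0 * r ^ k)).
  { transitivity (Csum (fun j => Csum (fun i => nth i l 0 * r ^ i
                      * om ^ ((i + (M - k)) * j)) (pred M)) (pred M)).
    { apply Csum_ext. intros j _. rewrite (peval_Csum l _ (pred M)) by (unfold M; simpl; lia).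
      rewrite Cmult_comm, <- Csum_scal. apply Csum_ext. intros i _.
      rewrite Cpow_mult_l, <- (Cpow_mult_r om), Nat.mul_add_distr_r, Cpow_add_r.
      rewrite (Nat.mul_comm j i). ring. }
    unfold Csum at 1 2. rewrite sum_n_switch. fold (Csum).
    transitivity (Csum (fun i => if Nat.eqb i k then INR M * (nth k l 0 * r ^ k) else 0)
                    (pred M)).
    { apply Csum_ext. intros i Hi.
      change (sum_n (fun j => nth i l 0 * r ^ i * om ^ ((i + (M - k)) * j)) (pred M))
        with (Csum (fun j => nth i l 0 * r ^ i * om ^ ((i + (M - k)) * j)) (pred M)).
      rewrite Csum_scal. unfold om. rewrite root_unity_sum by (unfold M in *; lia).
      destruct (Nat.eqb_spec (i + (M - k)) M); destruct (Nat.eqb_spec i k);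
        unfold M in *; try lia; [subst|]; ring. }
    assert (Hk : (k <= pred M)%nat) by (unfold M; simpl; lia).
    generalize (INR M * (nth k l 0 * r ^ k)). intros v.
    assert (Hlt : forall n, (n < k)%nat -> Csum (fun i => if Nat.eqb i k then v else 0) n = 0).
    { induction n as [|n IH]; intros Hn.
      - rewrite Csum_0. destruct (Nat.eqb_spec 0 k); [lia|reflexivity].
      - rewrite Csum_S, IH by lia. destruct (Nat.eqb_spec (S n) k); [lia|ring]. }
    induction Hk as [|n Hn IH].
    - destruct k; [rewrite Csum_0; reflexivity|].
      rewrite Csum_S, Hlt, Nat.eqb_refl by lia. ring.
    - rewrite Csum_S, IH. destruct (Nat.eqb_spec (S n) k); [lia|ring]. }
  assert (HMp : (0 < INR M)%R) by (apply lt_0_INR; unfold M; lia).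
  assert (Hle : (Cmod (INR M * (nth k l 0 * r ^ k)) <= INR (S (pred M)) * B)%R).
  { rewrite <- Hsum. apply Cmod_Csum_le. intros j _.
    rewrite Cmod_mult. unfold om. rewrite Cmod_root_unity_pow, Rmult_1_r.
    apply HB. rewrite Cmod_mult, Cmod_root_unity_pow, Rmult_1_r, Cmod_R, Rabs_pos_eq; lra. }
  rewrite !Cmod_mult, Cmod_INR, Cmod_pow, Cmod_R, Rabs_pos_eq in Hle by exact Hr.
  change (S (pred M)) with M in Hle. nra.
Qed.

(** The disc algebra of [|z - z0| <= r]. *)
Definition approx_on (z0 : C) (r : R) (f : C -> C) : Prop :=
  forall eps, (0 < eps)%R ->
    exists l, forall z, (Cmod (z - z0) <= r)%R -> (Cmod (f z - peval l z) <= eps)%R.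

Lemma peval_bounded l z0 r :
  exists B, (0 <= B)%R /\ forall z, (Cmod (z - z0) <= r)%R -> (Cmod (peval l z) <= B)%R.
Proof.
  induction l as [|a l [B [HB IH]]].
  - exists 0%R. split; [lra|]. intros z _. simpl. rewrite Cmod_0. lra.
  - exists (Cmod a + (Rabs r + Cmod z0) * B)%R. split.
    { pose proof (Cmod_ge_0 a). pose proof (Cmod_ge_0 z0). pose proof (Rabs_pos r). nra. }
    intros z Hz. simpl. eapply Rle_trans; [apply Cmod_triangle|].
    apply Rplus_le_compat_l. rewrite Cmod_mult.
    apply Rmult_le_compat; [apply Cmod_ge_0|apply Cmod_ge_0| |apply IH, Hz].
    replace z with ((z - z0) + z0) by ring. eapply Rle_trans; [apply Cmod_triangle|].
    apply Rplus_le_compat_r. eapply Rle_trans; [exact Hz|apply Rle_abs].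
Qed.

Lemma approx_bounded z0 r f :
  approx_on z0 r f ->
  exists B, (0 <= B)%R /\ forall z, (Cmod (z - z0) <= r)%R -> (Cmod (f z) <= B)%R.
Proof.
  intros H. destruct (H 1%R Rlt_0_1) as [l Hl].
  destruct (peval_bounded l z0 r) as [B [HB Hb]].
  exists (1 + B)%R. split; [lra|]. intros z Hz.
  replace (f z) with ((f z - peval l z) + peval l z) by ring.
  eapply Rle_trans; [apply Cmod_triangle|]. apply Rplus_le_compat; auto.
Qed.

Lemma approx_limit z0 r f :
  (forall eps, (0 < eps)%R -> exists g, approx_on z0 r g /\
     forall z, (Cmod (z - z0) <= r)%R -> (Cmod (f z - g z) <= eps)%R) ->
  approx_on z0 r f.
Proof.
  intros H eps He. destruct (H (eps / 2)%R ltac:(lra)) as [g [Hg Hfg]].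
  destruct (Hg (eps / 2)%R ltac:(lra)) as [l Hl]. exists l. intros z Hz.
  eapply Rle_trans; [apply (Cmod_triangle_3 _ (g z))|].
  specialize (Hfg z Hz). specialize (Hl z Hz). lra.
Qed.

Lemma approx_ext z0 r f g :
  (forall z, (Cmod (z - z0) <= r)%R -> f z = g z) -> approx_on z0 r f -> approx_on z0 r g.
Proof.
  intros H Hf eps He. destruct (Hf eps He) as [l Hl]. exists l. intros z Hz.
  rewrite <- H by exact Hz. auto.
Qed.

Lemma approx_peval z0 r l : approx_on z0 r (peval l).
Proof.
  intros eps He. exists l. intros z _. unfold Cminus. rewrite Cplus_opp_r, Cmod_0. lra.
Qed.

Lemma approx_plus z0 r f g :
  approx_on z0 r f -> approx_on z0 r g -> approx_on z0 r (fun z => f z + g z).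
Proof.
  intros Hf Hg eps He.
  destruct (Hf (eps / 2)%R ltac:(lra)) as [l Hl].
  destruct (Hg (eps / 2)%R ltac:(lra)) as [m Hm].
  exists (padd l m). intros z Hz. rewrite peval_add.
  replace (f z + g z - (peval l z + peval m z))
    with ((f z - peval l z) + (g z - peval m z)) by ring.
  eapply Rle_trans; [apply Cmod_triangle|].
  specialize (Hl z Hz). specialize (Hm z Hz). lra.
Qed.

Lemma approx_mult z0 r f g :
  approx_on z0 r f -> approx_on z0 r g -> approx_on z0 r (fun z => f z * g z).
Proof.
  intros Hf Hg eps He.
  destruct (approx_bounded _ _ _ Hg) as [B [HB Hb]].
  destruct (Hf (eps / (2 * (B + 1)))%R) as [l Hl].
  { apply Rdiv_lt_0_compat; lra. }
  destruct (peval_bounded l z0 r) as [D [HD Hd]].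
  destruct (Hg (eps / (2 * (D + 1)))%R) as [m Hm].
  { apply Rdiv_lt_0_compat; lra. }
  exists (pmul l m). intros z Hz. rewrite peval_mul.
  replace (f z * g z - peval l z * peval m z)
    with ((f z - peval l z) * g z + peval l z * (g z - peval m z)) by ring.
  eapply Rle_trans; [apply Cmod_triangle|]. rewrite !Cmod_mult.
  replace eps with (eps / (2 * (B + 1)) * (B + 1) + (D + 1) * (eps / (2 * (D + 1))))%R
    by (field; lra).
  specialize (Hl z Hz). specialize (Hm z Hz). specialize (Hb z Hz). specialize (Hd z Hz).
  apply Rplus_le_compat; apply Rmult_le_compat; try apply Cmod_ge_0; lra.
Qed.

(** Equivalent to the usual notion, by Taylor expansion. In this form stability under
    products and locally uniform limits is immediate, and holomorphy is the
    theorem. *)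
Definition entire (f : C -> C) : Prop := forall z0 r, approx_on z0 r f.

Lemma entire_ext f g : (forall z, f z = g z) -> entire f -> entire g.
Proof. intros H Hf z0 r. apply (approx_ext z0 r f); auto. Qed.

Lemma entire_const c : entire (fun _ => c).
Proof. intros z0 r. apply (approx_ext z0 r (peval [c])); [intros; simpl; ring|]. apply approx_peval. Qed.

Lemma entire_id : entire (fun z => z).
Proof.
  intros z0 r. apply (approx_ext z0 r (peval [RtoC 0; RtoC 1])); [intros; simpl; ring|].
  apply approx_peval.
Qed.

Lemma entire_plus f g : entire f -> entire g -> entire (fun z => f z + g z).
Proof. intros Hf Hg z0 r. apply approx_plus; auto. Qed.

Lemma entire_mult f g : entire f -> entire g -> entire (fun z => f z * g z).
Proof. intros Hf Hg z0 r. apply approx_mult; auto. Qed.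

Lemma entire_affine f (al be : C) : entire f -> entire (fun z => f (al * z + be)).
Proof.
  intros Hf z0 r eps He.
  destruct (Hf (al * z0 + be) (Cmod al * r)%R eps He) as [l Hl].
  (* substitute the affine map into the approximating polynomial *)
  exists (fold_right (fun c acc => padd [c] (pmul [be; al] acc)) [] l).
  assert (E : forall z, peval (fold_right (fun c acc => padd [c] (pmul [be; al] acc)) [] l) z
                 = peval l (al * z + be)).
  { intros z. clear Hl. induction l as [|a l IH]; [reflexivity|].
    cbn [fold_right]. rewrite peval_add, peval_mul, IH, !peval_cons, peval_nil. ring. }
  intros z Hz. rewrite E. apply Hl.
  replace (al * z + be - (al * z0 + be)) with (al * (z - z0)) by ring.
  rewrite Cmod_mult. apply Rmult_le_compat_l; [apply Cmod_ge_0|exact Hz].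
Qed.

Lemma entire_Csum (f : nat -> C -> C) n :
  (forall k, entire (f k)) -> entire (fun z => Csum (fun k => f k z) n).
Proof.
  intros H. induction n as [|n IH].
  - apply (entire_ext (f O)); [|apply H]. intros z. rewrite Csum_0. reflexivity.
  - apply (entire_ext (fun z => Csum (fun k => f k z) n + f (S n) z)).
    { intros z. rewrite Csum_S. reflexivity. }
    apply entire_plus; auto.
Qed.

Lemma entire_limit f :
  (forall A eps, (0 < eps)%R -> exists g, entire g /\
     forall z, (Cmod z <= A)%R -> (Cmod (f z - g z) <= eps)%R) ->
  entire f.
Proof.
  intros H z0 r. apply approx_limit. intros eps He.
  destruct (H (Cmod z0 + r)%R eps He) as [g [Hg Hfg]]. exists g. split; [apply Hg|].
  intros z Hz. apply Hfg. replace z with (z0 + (z - z0)) by ring.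
  eapply Rle_trans; [apply Cmod_triangle|]. lra.
Qed.

Lemma approx_series z0 r (f : nat -> C -> C) (F : C -> C) M q :
  (0 <= q < 1)%R ->
  (forall n, approx_on z0 r (f n)) ->
  (forall z, (Cmod (z - z0) <= r)%R -> is_series (fun n => f n z) (F z)) ->
  (forall n z, Cmod (z - z0) <= r -> Cmod (f n z) <= M * q ^ n)%R ->
  approx_on z0 r F.
Proof.
  intros Hq Hf HF HB. apply approx_limit. intros eps He.
  destruct (geom_tail_lim M q eps Hq He) as [K0 HK].
  exists (fun z => Csum (fun n => f n z) K0). split.
  - clear - Hf. induction K0 as [|K IH].
    + apply (approx_ext z0 r (f O)); [intros; rewrite Csum_0; reflexivity|apply Hf].
    + apply (approx_ext z0 r (fun z => Csum (fun n => f n z) K + f (S K) z)).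
      * intros; rewrite Csum_S; reflexivity.
      * apply approx_plus; auto.
  - intros z Hz.
    destruct (geom_series (fun n => f n z) M q Hq (fun n => HB n z Hz)) as [s [Hs Ht]].
    rewrite (is_series_C_unique _ _ _ (HF z Hz) Hs), Cmod_minus_sym.
    eapply Rle_trans; [apply Ht|]. apply Rlt_le, HK. lia.
Qed.

Lemma entire_series (f : nat -> C -> C) (F : C -> C) :
  (forall n, entire (f n)) ->
  (forall z, is_series (fun n => f n z) (F z)) ->
  (forall A, exists M q, (0 <= q < 1)%R /\
     forall n z, (Cmod z <= A)%R -> (Cmod (f n z) <= M * q ^ n)%R) ->
  entire F.
Proof.
  intros Hf HF HB z0 r. destruct (HB (Cmod z0 + r)%R) as [M [q [Hq Hb]]].
  apply (approx_series z0 r f F M q Hq); auto.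
  - intros n. apply Hf.
  - intros n z Hz. apply Hb. replace z with (z0 + (z - z0)) by ring.
    eapply Rle_trans; [apply Cmod_triangle|]. lra.
Qed.

Lemma C_cauchy_lim (u : nat -> C) (e : nat -> R) :
  (forall eps, 0 < eps -> exists N, forall n, (N <= n)%nat -> e n < eps)%R ->
  (forall i j, (i <= j)%nat -> (Cmod (u i - u j) <= e i)%R) ->
  exists l, forall i, (Cmod (u i - l) <= e i)%R.
Proof.
  intros He Hu.
  assert (HL : forall p : C -> R, (forall z w, Rabs (p z - p w) <= Cmod (z - w))%R ->
            ex_finite_lim_seq (fun n => p (u n))).
  { intros p Hp. apply ex_lim_seq_cauchy_corr. intros eps.
    destruct (He (eps / 2)%R) as [N HN]; [pose proof (cond_pos eps); lra|].
    exists N. intros n m Hn Hm.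
    assert (Hn1 := Hu N n Hn). assert (Hm1 := Hu N m Hm).
    specialize (HN N (Nat.le_refl _)).
    eapply Rle_lt_trans; [apply Hp|]. eapply Rle_lt_trans; [apply (Cmod_triangle_3 _ (u N))|].
    rewrite Cmod_minus_sym. lra. }
  destruct (HL Re) as [l1 H1].
  { intros z w. apply (re_le_Cmod (z - w)). }
  destruct (HL Im) as [l2 H2].
  { intros z w. eapply Rle_trans; [|apply (Rmax_Cmod (z - w))]. apply Rmax_r. }
  exists (l1, l2). intros i. apply Rnot_lt_le. intros Hlt.
  set (d := ((Cmod (u i - (l1, l2)) - e i) / 3)%R).
  assert (Hd : (0 < d)%R) by (unfold d; lra).
  apply is_lim_seq_spec in H1. apply is_lim_seq_spec in H2.
  destruct (H1 (mkposreal d Hd)) as [N1 HN1]. destruct (H2 (mkposreal d Hd)) as [N2 HN2].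
  set (n := (i + N1 + N2)%nat).
  specialize (HN1 n ltac:(unfold n; lia)). specialize (HN2 n ltac:(unfold n; lia)).
  simpl in HN1, HN2.
  pose proof (Hu i n ltac:(unfold n; lia)) as Hi.
  assert (Hc : (Cmod (u n - (l1, l2)) <= 2 * d)%R).
  { eapply Rle_trans; [apply Cmod_2Rmax|].
    assert (sqrt 2 <= 2)%R.
    { rewrite <- (sqrt_square 2) at 2 by lra. apply sqrt_le_1_alt. lra. }
    assert (Hm : (Rmax (Rabs (fst (u n - (l1, l2))%C)) (Rabs (snd (u n - (l1, l2))%C)) <= d)%R).
    { apply Rmax_lub; simpl; unfold Rminus in *; apply Rlt_le; [apply HN1|apply HN2]. }
    pose proof (Rle_trans _ _ _ (Rabs_pos _)
      (Rmax_l (Rabs (fst (u n - (l1, l2))%C)) (Rabs (snd (u n - (l1, l2))%C)))).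
    nra. }
  pose proof (Cmod_triangle_3 (u i) (u n) (l1, l2)). unfold d in *. lra.
Qed.

Lemma nth_padd_opp k l m :
  nth k (padd l (map (Cmult (- (1))) m)) 0 = nth k l 0 - nth k m 0.
Proof.
  revert k m. induction l as [|a l IH]; intros k m.
  - simpl padd. replace (nth k [] (RtoC 0)) with (RtoC 0) by (destruct k; reflexivity).
    revert k. induction m as [|b m IHm]; intros [|k]; simpl; try ring. apply IHm.
  - destruct m as [|b m]; [simpl; destruct k; simpl; ring|].
    destruct k; simpl; [ring|]. apply IH.
Qed.

(** A uniform limit of polynomials on a disc is a power series there: by Cauchy's
    estimate the coefficients of the approximating polynomials converge. *)
Lemma approx_power_series z0 r f :
  (0 < r)%R -> approx_on z0 r f ->
  exists a M, (0 <= M)%R /\ (forall k, Cmod (a k) * r ^ k <= M)%R /\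
    forall w, (Cmod w < r)%R -> is_series (fun k => a k * w ^ k) (f (z0 + w)).
Proof.
  intros Hr Hf.
  set (e := fun j : nat => (/ INR (S j))%R).
  assert (Hepos : forall j, (0 < e j)%R).
  { intros j. apply Rinv_0_lt_compat, lt_0_INR. lia. }
  assert (Hch : exists L : nat -> list C, forall j w, (Cmod w <= r)%R ->
            (Cmod (f (z0 + w)%C - peval (L j) w) <= e j)%R).
  { assert (H : forall j, exists l, forall w, (Cmod w <= r)%R ->
            (Cmod (f (z0 + w)%C - peval l w) <= e j)%R).
    { intros j. destruct (Hf (e j) (Hepos j)) as [l Hl]. exists (pshift z0 l).
      intros w Hw. rewrite peval_shift. apply Hl.
      replace (z0 + w - z0) with w by ring. exact Hw. }
    exists (fun j => proj1_sig (constructive_indefinite_description _ (H j))).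
    intros j. exact (proj2_sig (constructive_indefinite_description _ (H j))). }
  destruct Hch as [L HL].
  assert (Hij : forall i j k, (i <= j)%nat ->
            (Cmod (nth k (L i) 0 - nth k (L j) 0) * r ^ k <= 2 * e i)%R).
  { intros i j k Hle.
    rewrite <- nth_padd_opp. apply peval_cauchy; [lra|]. intros w Hw.
    rewrite peval_add, peval_scal.
    replace (peval (L i) w + - (1) * peval (L j) w)
      with ((f (z0 + w)%C - peval (L j) w) - (f (z0 + w)%C - peval (L i) w)) by ring.
    eapply Rle_trans; [apply Cmod_triangle_minus|].
    pose proof (HL i w Hw). pose proof (HL j w Hw).
    assert (e j <= e i)%R.
    { apply Rinv_le_contravar; [apply lt_0_INR; lia|apply le_INR; lia]. }
    lra. }
  assert (Helim : forall c eps, (0 < c)%R -> (0 < eps)%R ->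
            exists N, forall n, (N <= n)%nat -> (c * e n < eps)%R).
  { intros c eps Hc He. destruct (nfloor_ex (c / eps)) as [N [_ HN]].
    { apply Rlt_le, Rdiv_lt_0_compat; assumption. }
    exists N. intros n Hn. unfold e. apply Rlt_div_l; [apply lt_0_INR; lia|].
    apply Rlt_div_l in HN; [|exact He].
    apply le_INR in Hn. rewrite S_INR. nra. }
  assert (Hlim : forall k, exists l, forall i,
            (Cmod (nth k (L i) 0 - l) * r ^ k <= 2 * e i)%R).
  { intros k. pose proof (pow_lt r k Hr) as Hrk.
    destruct (C_cauchy_lim (fun i => nth k (L i) 0) (fun i => 2 / r ^ k * e i)%R) as [l Hl].
    - intros eps He. apply Helim; [apply Rdiv_lt_0_compat; lra|exact He].
    - intros i j Hle. specialize (Hij i j k Hle).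
      replace (2 / r ^ k * e i)%R with (2 * e i / r ^ k)%R by (field; lra).
      apply Rle_div_r; assumption.
    - exists l. intros i. specialize (Hl i). simpl in Hl.
      replace (2 / r ^ k * e i)%R with (2 * e i / r ^ k)%R in Hl by (field; lra).
      apply Rle_div_r in Hl; assumption. }
  set (a := fun k => proj1_sig (constructive_indefinite_description _ (Hlim k))).
  assert (Ha : forall k i, (Cmod (nth k (L i) 0 - a k) * r ^ k <= 2 * e i)%R).
  { intros k. exact (proj2_sig (constructive_indefinite_description _ (Hlim k))). }
  destruct (peval_bounded (L O) 0 r) as [B [HB Hb]].
  assert (HaM : forall k, (Cmod (a k) * r ^ k <= 2 * e O + B)%R).
  { intros k. pose proof (pow_lt r k Hr) as Hrk.
    assert (H1 : (Cmod (nth k (L O) 0) * r ^ k <= B)%R).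
    { apply peval_cauchy; [lra|]. intros w Hw. apply Hb.
      replace (w - 0) with w by ring. exact Hw. }
    specialize (Ha k O).
    pose proof (Cmod_triangle_3 (a k) (nth k (L O) 0) 0) as HT.
    replace (a k - 0) with (a k) in HT by ring.
    replace (nth k (L O) 0 - 0) with (nth k (L O) 0) in HT by ring.
    rewrite (Cmod_minus_sym (a k) (nth k (L O) 0)) in HT. nra. }
  exists a, (2 * e O + B)%R. split; [pose proof (Hepos O); lra|]. split; [exact HaM|].
  intros w Hw. set (q := (Cmod w / r)%R).
  assert (Hq : (0 <= q < 1)%R).
  { unfold q. split; [apply Rdiv_le_0_compat; [apply Cmod_ge_0|lra]|].
    apply Rlt_div_l; lra. }
  assert (Hqk : forall c k, (Cmod (c * w ^ k) = Cmod c * r ^ k * q ^ k)%R).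
  { intros c k. rewrite Cmod_mult, Cmod_pow. unfold q. rewrite Rmult_assoc, <- Rpow_mult_distr.
    do 2 f_equal. field. lra. }
  destruct (geom_series (fun k => a k * w ^ k) (2 * e O + B) q Hq) as [s [Hs _]].
  { intros k. rewrite Hqk. apply Rmult_le_compat_r; [apply pow_le; lra|apply HaM]. }
  replace (f (z0 + w)) with s; [exact Hs|].
  apply Cmod_small_eq. intros eps He.
  destruct (Helim (2 / (1 - q) + 1)%R (eps / 2)%R) as [j Hj].
  { assert (0 < 2 / (1 - q))%R by (apply Rdiv_lt_0_compat; lra). lra. }
  { lra. }
  specialize (Hj j (Nat.le_refl _)).
  (* compare the series with the polynomial [L j], coefficient by coefficient *)
  assert (Hs' : is_series (fun k => (nth k (L j) 0 - a k) * w ^ k) (peval (L j) w - s)).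
  { apply (is_series_C_ext (fun k => nth k (L j) 0 * w ^ k + - (1) * (a k * w ^ k)));
      [intros; ring|].
    replace (peval (L j) w - s) with (peval (L j) w + - (1) * s) by ring.
    apply is_series_Cplus; [|apply is_series_Cmult, Hs].
    rewrite (peval_Csum (L j) w (length (L j))) by lia. apply is_series_finite.
    intros k Hk. rewrite nth_overflow by lia. ring. }
  apply (geom_series_bound _ (2 * e j) q) in Hs'; [|exact Hq|].
  2:{ intros k. rewrite Hqk. apply Rmult_le_compat_r; [apply pow_le; lra|apply Ha]. }
  eapply Rle_trans; [apply (Cmod_triangle_3 _ (peval (L j) w))|].
  rewrite (Cmod_minus_sym s (peval (L j) w)).
  rewrite (Cmod_minus_sym (peval (L j) w) (f (z0 + w))).

  pose proof (HL j w ltac:(lra)).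
  replace ((2 / (1 - q) + 1) * e j)%R with (2 * e j / (1 - q) + e j)%R in Hj by (field; lra).
  lra.
Qed.

(** The remainder of order [n + 1] near the centre is what both differentiability
    ([n = 1]) and the identity theorem (all [n]) rest on. *)
Lemma approx_taylor z0 r f :
  (0 < r)%R -> approx_on z0 r f ->
  exists a,
    (forall w, (Cmod w < r)%R -> is_series (fun k => a k * w ^ k) (f (z0 + w))) /\
    forall n, exists M, (0 <= M)%R /\ forall w, (Cmod w <= r / 2)%R ->
      (Cmod (Csum (fun k => a k * w ^ k)%C n - f (z0 + w)%C) <= M * Cmod w ^ S n)%R.
Proof.
  intros Hr Hf. destruct (approx_power_series z0 r f Hr Hf) as [a [M [HM [Ha Hs]]]].
  exists a. split; [exact Hs|]. intros n.
  exists (2 * M / r ^ S n)%R. pose proof (pow_lt r (S n) Hr) as Hrn. split.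
  { apply Rdiv_le_0_compat; lra. }
  intros w Hw. set (q := (Cmod w / r)%R).
  assert (Hq : (0 <= q <= 1 / 2)%R).
  { unfold q. split; [apply Rdiv_le_0_compat; [apply Cmod_ge_0|lra]|].
    apply Rle_div_l; lra. }
  destruct (geom_series (fun k => a k * w ^ k) M q ltac:(lra)) as [s [Hss Ht]].
  { intros k. rewrite Cmod_mult, Cmod_pow.
    replace (Cmod (a k) * Cmod w ^ k)%R with (Cmod (a k) * r ^ k * q ^ k)%R.
    - apply Rmult_le_compat_r; [apply pow_le; lra|apply Ha].
    - unfold q. rewrite Rmult_assoc, <- Rpow_mult_distr. do 2 f_equal. field. lra. }
  rewrite (is_series_C_unique _ _ _ (Hs w ltac:(lra)) Hss).
  eapply Rle_trans; [apply Ht|].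
  replace (2 * M / r ^ S n * Cmod w ^ S n)%R with (M * q ^ S n * 2)%R.
  2:{ unfold q. unfold Rdiv at 1. rewrite Rpow_mult_distr, pow_inv. field. lra. }
  unfold Rdiv. apply Rmult_le_compat_l.
  - apply Rmult_le_pos; [exact HM|apply pow_le; lra].
  - replace 2%R with (/ (1 / 2))%R by field. apply Rinv_le_contravar; lra.
Qed.

Lemma approx_ex_derive z0 r f : (0 < r)%R -> approx_on z0 r f -> ex_derive f z0.
Proof.
  intros Hr Hf. destruct (approx_taylor z0 r f Hr Hf) as [a [_ Ht]].
  destruct (Ht 1%nat) as [M [HM Ht1]]. clear Ht. rename Ht1 into Ht.
  assert (H0 : f z0 = a O).
  { specialize (Ht 0). rewrite Cmod_0, Csum_S, Csum_0, Cplus_0_r in Ht.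
    specialize (Ht ltac:(lra)). simpl in Ht. symmetry. apply Cminus_eq_0, Cmod_eq_0.
    pose proof (Cmod_ge_0 (a O - f z0)).
    replace (a O * 1 + a 1%nat * (0 * 1) - f z0) with (a O - f z0) in Ht by ring. lra. }
  assert (Key : forall eps, (0 < eps)%R -> exists d, (0 < d)%R /\ forall y : C,
            (Cmod (y - z0) < d)%R ->
            (Cmod (f y - f z0 - (y - z0) * a 1%nat)%C <= eps * Cmod (y - z0))%R).
  { intros eps He. exists (Rmin (r / 2) (eps / (M + 1))). split.
    { apply Rmin_pos; [lra|]. apply Rdiv_lt_0_compat; lra. }
    intros y Hy. set (w := y - z0) in *.
    assert (Hw1 := Rmin_l (r / 2) (eps / (M + 1))).
    assert (Hw2 := Rmin_r (r / 2) (eps / (M + 1))).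
    specialize (Ht w ltac:(lra)). rewrite Csum_S, Csum_0 in Ht.
    replace (z0 + w) with y in Ht by (unfold w; ring).
    rewrite Cmod_minus_sym in Ht.
    replace (f y - (a O * w ^ 0 + a 1%nat * w ^ 1)) with (f y - f z0 - w * a 1%nat) in Ht
      by (rewrite H0; simpl; ring).
    eapply Rle_trans; [exact Ht|]. simpl. rewrite Rmult_1_r, <- Rmult_assoc.
    apply Rmult_le_compat_r; [apply Cmod_ge_0|].
    assert (Hle : (Cmod w <= eps / (M + 1))%R) by lra.
    apply Rle_div_r in Hle; [|lra]. pose proof (Cmod_ge_0 w). nra. }
  exists (a 1%nat). split; [apply is_linear_scal_l|].
  intros x Hx.
  pose proof (@is_filter_lim_locally_unique C_AbsRing (AbsRing_NormedModule C_AbsRing)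
    z0 x Hx) as Hzx. subst x.
  intros eps. destruct (Key eps (cond_pos eps)) as [d [Hd HK]].
  exists (mkposreal d Hd). intros y Hy. exact (HK y Hy).
Qed.

Lemma entire_ex_derive f z : entire f -> ex_derive f z.
Proof. intros H. apply (approx_ex_derive z 1); [lra|apply H]. Qed.

Lemma entire_continuous f z eps :
  entire f -> (0 < eps)%R ->
  exists d, (0 < d)%R /\ forall w, (Cmod (w - z) < d)%R -> (Cmod (f w - f z) < eps)%R.
Proof.
  intros Hf He. destruct (approx_taylor z 1 f ltac:(lra) (Hf z 1%R)) as [a [_ Ht]].
  destruct (Ht O) as [M [HM Ht1]]. clear Ht. rename Ht1 into Ht.
  assert (H0 : f z = a O).
  { specialize (Ht 0). rewrite Cmod_0, Csum_0, Cplus_0_r in Ht.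
    specialize (Ht ltac:(lra)). simpl in Ht. symmetry. apply Cminus_eq_0, Cmod_eq_0.
    pose proof (Cmod_ge_0 (a O - f z)).
    replace (a O * 1 - f z) with (a O - f z) in Ht by ring. lra. }
  assert (Hq : (0 < eps / (M + 1))%R) by (apply Rdiv_lt_0_compat; lra).
  exists (Rmin (1 / 2) (eps / (M + 1))). split; [apply Rmin_pos; lra|].
  intros w Hw.
  assert (Hw1 := Rmin_l (1 / 2) (eps / (M + 1))).
  assert (Hw2 := Rmin_r (1 / 2) (eps / (M + 1))).
  specialize (Ht (w - z) ltac:(lra)). rewrite Csum_0 in Ht. simpl in Ht.
  replace (z + (w - z)) with w in Ht by ring. rewrite Cmod_minus_sym in Ht.
  replace (f w - a O * 1) with (f w - f z) in Ht by (rewrite H0; ring).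
  eapply Rle_lt_trans; [exact Ht|].
  assert (Hlt : (Cmod (w - z) < eps / (M + 1))%R) by lra.
  apply Rlt_div_r in Hlt; [|lra]. pose proof (Cmod_ge_0 (w - z)). nra.
Qed.

(** The identity theorem: the first non-zero Taylor coefficient at [t0] would
    dominate near [t0]. *)
Lemma entire_zero f (t0 d : R) :
  (0 < d)%R -> entire f -> (forall t : R, (Rabs (t - t0) < d)%R -> f t = 0) ->
  forall z, f z = 0.
Proof.
  intros Hd Hf H0 z. set (r := (Cmod (z - t0) + 1)%R).
  assert (Hr : (0 < r)%R) by (unfold r; pose proof (Cmod_ge_0 (z - t0)); lra).
  destruct (approx_taylor t0 r f Hr (Hf t0 r)) as [a [Hs Ht]].
  assert (Ha : forall n k, (k < n)%nat -> a k = 0).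
  { induction n as [|n IH]; [lia|]. intros k Hk.
    destruct (Nat.eq_dec k n) as [->|Hne]; [|apply IH; lia].
    destruct (Ht n) as [M [HM HT]].
    apply Cmod_eq_0, Rle_antisym; [|apply Cmod_ge_0].
    apply Rnot_lt_le. intros Hlt.
    set (h := Rmin (Rmin (r / 2) (d / 2)) (Cmod (a n) / (2 * (M + 1)))).
    assert (Hh0 : (0 < h)%R).
    { repeat apply Rmin_pos; try lra. apply Rdiv_lt_0_compat; lra. }
    assert (Hh1 : (h <= r / 2)%R) by (eapply Rle_trans; apply Rmin_l).
    assert (Hh2 : (h <= d / 2)%R).
    { eapply Rle_trans; [apply Rmin_l|apply Rmin_r]. }
    assert (Hh3 : (h <= Cmod (a n) / (2 * (M + 1)))%R) by apply Rmin_r.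
    assert (Hhm : Cmod h = h) by (rewrite Cmod_R, Rabs_pos_eq; lra).
    specialize (HT h ltac:(lra)).
    rewrite <- RtoC_plus, H0 in HT.
    2:{ replace (t0 + h - t0)%R with h by ring. rewrite Rabs_pos_eq; lra. }
    assert (HS : Csum (fun k => a k * h ^ k) n = a n * h ^ n).
    { destruct n as [|n]; [apply Csum_0|]. rewrite Csum_S.
      rewrite (Csum_ext _ (fun k => 0 * 1)).
      - rewrite Csum_scal. ring.
      - intros k Hk'. rewrite IH by lia. ring. }
    rewrite HS in HT. replace (a n * h ^ n - 0) with (a n * h ^ n) in HT by ring.
    rewrite Cmod_mult, Cmod_pow, Hhm in HT. simpl in HT.
    pose proof (pow_lt h n Hh0) as Hhn.
    apply Rle_div_r in Hh3; [|lra]. nra. }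
  specialize (Hs (z - t0) ltac:(unfold r; lra)).
  replace (t0 + (z - t0)) with z in Hs by ring.
  apply (is_series_C_unique _ _ _ Hs).
  apply (is_series_C_ext (fun _ => RtoC 0)).
  { intros k. rewrite (Ha (S k) k) by lia. ring. }
  pose proof (is_series_finite (fun _ => RtoC 0) O) as HZ.
  rewrite Csum_0 in HZ. apply HZ. reflexivity.
Qed.

(** * Uniqueness of limits, and the exponential series *)

Lemma Ciota_eq (P : C -> Prop) (w : C) :
  P w -> (forall v, P v -> v = w) -> Ciota P = w.
Proof. intros H U. exact (@iota_unique C_AbsRing C_CompleteNormedModule P w U H). Qed.

Lemma CSeries_eq a s : is_series a s -> CSeries a = s.
Proof.
  intros H. apply Ciota_eq; [exact H|]. intros v Hv.
  apply (is_series_C_unique a); assumption.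
Qed.

Lemma filterlim_C_seq (u : nat -> C) (l : C) :
  filterlim u eventually (locally l) <->
  forall eps, (0 < eps)%R -> exists N, forall n, (N <= n)%nat -> (Cmod (u n - l) < eps)%R.
Proof.
  split.
  - intros H eps He.
    assert (L : locally l (fun w : C => (Cmod (w - l) < eps)%R)).
    { apply locally_C. exists eps. split; auto. }
    destruct (H _ L) as [N HN]. exists N. exact HN.
  - intros H P HP. apply locally_C in HP. destruct HP as [e [He HP]].
    destruct (H e He) as [N HN]. exists N. intros n Hn. apply HP, HN, Hn.
Qed.

Lemma Ciota_seq_lim (u : nat -> C) (l : C) :
  filterlim u eventually (locally l) ->
  Ciota (fun g => filterlim u eventually (locally g)) = l.
Proof.
  intros H. apply Ciota_eq; [exact H|]. intros v Hv.
  exact (filterlim_locally_unique u v l Hv H).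
Qed.

Definition Cderiv (f : R -> C) (t : R) (l : C) : Prop :=
  is_derive (fun t => Re (f t)) t (Re l) /\ is_derive (fun t => Im (f t)) t (Im l).

Lemma Cmult_minus_distr (w a b : C) : w * (a - b) = w * a - w * b.
Proof. ring. Qed.

Lemma exp_le_compat (x y : R) : (x <= y)%R -> (exp x <= exp y)%R.
Proof. intros [H| ->]; [apply Rlt_le, exp_increasing, H|apply Rle_refl]. Qed.

Lemma Cderiv_ext f g t l : (forall s, f s = g s) -> Cderiv f t l -> Cderiv g t l.
Proof.
  intros H [H1 H2]. split.
  - apply (is_derive_ext (fun t => Re (f t))); [intros; rewrite H; reflexivity|exact H1].
  - apply (is_derive_ext (fun t => Im (f t))); [intros; rewrite H; reflexivity|exact H2].
Qed.

Lemma Cderiv_const c t : Cderiv (fun _ => c) t 0.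
Proof. split; simpl; apply (is_derive_const (K := R_AbsRing) (V := R_NormedModule)). Qed.

Lemma Cderiv_minus f g t l m :
  Cderiv f t l -> Cderiv g t m -> Cderiv (fun t => f t - g t) t (l - m).
Proof.
  intros [H1 H2] [H3 H4]. split; simpl.
  - apply (is_derive_minus (fun t => Re (f t)) (fun t => Re (g t)) t (Re l) (Re m)); assumption.
  - apply (is_derive_minus (fun t => Im (f t)) (fun t => Im (g t)) t (Im l) (Im m)); assumption.
Qed.

Lemma Cderiv_Cexp (w : C) t : Cderiv (fun t => Cexp (t * w)) t (w * Cexp (t * w)).
Proof.
  destruct w as [a b]. unfold Cderiv, Cexp. simpl.
  split; auto_derive; auto; unfold Rminus; ring.
Qed.

Lemma is_derive_pow_fact k (t : R) :
  is_derive (fun t => (t ^ S k / INR (fact (S k)))%R) t (t ^ k / INR (fact k))%R.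
Proof.
  assert (Hn : INR (fact k) <> 0%R) by apply INR_fact_neq_0.
  assert (HSn : INR (S k) <> 0%R) by (apply not_0_INR; lia).
  rewrite fact_simpl, mult_INR.
  replace (t ^ k / INR (fact k))%R
    with (INR (S k) * 1 * t ^ pred (S k) / (INR (S k) * INR (fact k)))%R
    by (simpl pred; field; split; assumption).
  generalize (INR (S k) * INR (fact k))%R. intros c.
  unfold Rdiv. apply (is_derive_ext (fun t => / c * t ^ S k)%R);
    [intros; apply Rmult_comm|].
  rewrite (Rmult_comm _ (/ c)).
  apply (is_derive_scal (fun t => t ^ S k)%R t (/ c)).
  apply (is_derive_pow (fun t => t) (S k) t 1%R).
  exact (is_derive_id (K := R_AbsRing) t).
Qed.

Lemma Cderiv_pow (w : C) k t :
  Cderiv (fun t => (t * w) ^ S k / INR (fact (S k))) t (w * ((t * w) ^ k / INR (fact k))).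
Proof.
  assert (Hf : forall n, INR (fact n) <> 0%R) by (intros n; apply INR_fact_neq_0).
  assert (E : forall n (t : R), (t * w) ^ n / INR (fact n)
                = (t ^ n / INR (fact n))%R * w ^ n).
  { intros n s. rewrite Cpow_mult_l, RtoC_div, RtoC_pow by apply Hf. field.
    intros h. apply RtoC_inj in h. exact (Hf n h). }
  assert (D := is_derive_pow_fact k t).
  assert (EL : w * ((t * w) ^ k / INR (fact k)) = (t ^ k / INR (fact k))%R * w ^ S k).
  { rewrite E. simpl. ring. }
  unfold Cderiv. rewrite EL. split.
  - apply (is_derive_ext (fun t => (t ^ S k / INR (fact (S k)) * Re (w ^ S k))%R)).
    { intros s. rewrite E, re_scal_l. reflexivity. }
    rewrite re_scal_l. 
    apply (is_derive_ext (fun t => (Re (w ^ S k) * (t ^ S k / INR (fact (S k))))%R)).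
    { intros; apply Rmult_comm. }
    rewrite Rmult_comm.
    exact (is_derive_scal _ t (Re (w ^ S k)) _ D).
  - apply (is_derive_ext (fun t => (Im (w ^ S k) * (t ^ S k / INR (fact (S k))))%R)).
    { intros s. rewrite E, im_scal_l. apply Rmult_comm. }
    rewrite im_scal_l, Rmult_comm.
    exact (is_derive_scal _ t (Im (w ^ S k)) _ D).
Qed.

Lemma derive_nonneg_le (f df : R -> R) (a b : R) :
  (a <= b)%R ->
  (forall x, a <= x <= b -> is_derive f x (df x))%R ->
  (forall x, a <= x <= b -> 0 <= df x)%R ->
  (f a <= f b)%R.
Proof.
  intros Hab Hd Hp.
  destruct (MVT_gen f a b df) as [c [Hc E]];
    rewrite ?Rmin_left, ?Rmax_right in * by exact Hab.
  - intros x Hx. apply Hd. lra.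
  - intros x Hx. apply (derivable_continuous_pt f x). exists (df x).
    apply is_derive_Reals, Hd, Hx.
  - specialize (Hp c Hc). nra.
Qed.

Lemma Cderiv_bound (f f' : R -> C) (g g' : R -> R) T :
  (0 <= T)%R ->
  (forall t, 0 <= t <= T -> Cderiv f t (f' t))%R ->
  (forall t, 0 <= t <= T -> is_derive g t (g' t))%R ->
  (forall t, 0 <= t <= T -> Cmod (f' t) <= g' t)%R ->
  (Cmod (f T - f 0%R)%C <= g T - g 0)%R.
Proof.
  intros HT Hf Hg Hb. set (d := (f T - f 0%R)%C).
  (* project on the direction of the increment *)
  set (phi := fun t => (Cmod d * g t - (Re d * Re (f t) + Im d * Im (f t)))%R).
  assert (H : (phi 0 <= phi T)%R).
  { apply (derive_nonneg_le phi
      (fun t => Cmod d * g' t - (Re d * Re (f' t) + Im d * Im (f' t)))%R); [exact HT| |].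
    - intros t Ht. destruct (Hf t Ht) as [Hr Hi].
      unfold phi. apply (is_derive_minus (fun t => Cmod d * g t)%R
        (fun t => Re d * Re (f t) + Im d * Im (f t))%R).
      + apply (is_derive_scal g t (Cmod d)), Hg, Ht.
      + apply (is_derive_plus (fun t => Re d * Re (f t))%R (fun t => Im d * Im (f t))%R).
        * exact (is_derive_scal _ t (Re d) _ Hr).
        * exact (is_derive_scal _ t (Im d) _ Hi).
    - intros t Ht. specialize (Hb t Ht).
      assert (HC : (Re d * Re (f' t) + Im d * Im (f' t) <= Cmod d * Cmod (f' t))%R).
      { rewrite <- Cmod_conj, <- Cmod_mult.
        replace (Re d * Re (f' t) + Im d * Im (f' t))%R with (Re (Cconj d * f' t)).
        - eapply Rle_trans; [apply Rle_abs|apply re_le_Cmod].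
        - destruct d, (f' t); simpl; ring. }
      pose proof (Cmod_ge_0 d). nra. }
  unfold phi in H.
  assert (Hd : (Cmod d * Cmod d = Re d * (Re (f T) - Re (f 0%R))
                 + Im d * (Im (f T) - Im (f 0%R)))%R).
  { change (Re (f T) - Re (f 0%R))%R with (Re d).
    change (Im (f T) - Im (f 0%R))%R with (Im d).
    transitivity (Cmod d ^ 2)%R; [ring|]. rewrite Cmod2_alt. ring. }
  destruct (Rle_lt_or_eq_dec _ _ (Cmod_ge_0 d)) as [h|h]; [nra|].
  assert (HG : (g 0 <= g T)%R).
  { apply (derive_nonneg_le g g' 0 T HT Hg).
    intros t Ht. apply Rle_trans with (Cmod (f' t)); [apply Cmod_ge_0|apply Hb, Ht]. }
  lra.
Qed.

(** Each remainder is, along the segment from [0] to [w], the integral of [w] times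
    the preceding one. *)
Lemma Cexp_taylor (w : C) K :
  (Cmod (Cexp w - Csum (fun k => w ^ k / INR (fact k))%C K)
    <= exp (Cmod w) * Cmod w ^ S K / INR (fact (S K)))%R.
Proof.
  set (f := fun K (t : R) => Cexp (t * w) - Csum (fun k => (t * w) ^ k / INR (fact k)) K).
  set (g := fun K (t : R) => (exp (Cmod w) * Cmod w ^ S K * (t ^ S K / INR (fact (S K))))%R).
  assert (Hf0 : forall n, f n 0%R = 0).
  { intros n. unfold f. rewrite Cmult_0_l, Cexp_0. induction n as [|n IH].
    - rewrite Csum_0. simpl. field. 
    - rewrite Csum_S.
      replace (0 ^ S n / INR (fact (S n))) with (RtoC 0).
      + rewrite Cplus_0_r. exact IH.
      + simpl pow. unfold Cdiv. rewrite Cpow_S. ring. }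
  assert (HS : forall n s, f n s - (s * w) ^ S n / INR (fact (S n)) = f (S n) s).
  { intros n s. unfold f. rewrite Csum_S. ring. }
  assert (Hd0 : forall t, Cderiv (f O) t (w * Cexp (t * w))).
  { intros t. replace (w * Cexp (t * w)) with (w * Cexp (t * w) - 0) by ring.
    eapply Cderiv_ext; [|apply Cderiv_minus; [apply Cderiv_Cexp|apply (Cderiv_const 1)]].
    intros s. unfold f. rewrite Csum_0. simpl. field. }
  assert (HdS : forall n t, Cderiv (f (S n)) t (w * f n t)).
  { induction n as [|n IH]; intros t.
    - replace (w * f O t) with (w * Cexp (t * w) - w * ((t * w) ^ 0 / INR (fact 0)))
        by (unfold f; rewrite Csum_0; ring).
      eapply Cderiv_ext; [exact (HS O)|].
      apply Cderiv_minus; [apply Hd0|apply Cderiv_pow].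
    - rewrite <- HS, (Cmult_minus_distr w).
      eapply Cderiv_ext; [exact (HS (S n))|].
      apply Cderiv_minus; [apply IH|apply Cderiv_pow]. }
  assert (Hg0 : forall n, g n 0%R = 0%R).
  { intros n. unfold g. simpl pow. unfold Rdiv. ring. }
  assert (Hgd : forall n t, is_derive (g n) t
            (exp (Cmod w) * Cmod w ^ S n * (t ^ n / INR (fact n)))%R).
  { intros n t. unfold g.
    apply is_derive_scal, is_derive_pow_fact. }
  assert (Hbound : forall n T, (0 <= T <= 1)%R -> (Cmod (f n T) <= g n T)%R).
  { induction n as [|n IH]; intros T HT.
    - pose proof (Cderiv_bound (f O) (fun t => w * Cexp (t * w)) (g O) _ T (proj1 HT)
        (fun t _ => Hd0 t) (fun t _ => Hgd O t)) as HB.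
      rewrite Hf0, Hg0 in HB. replace (f O T - 0) with (f O T) in HB by ring.
      rewrite Rminus_0_r in HB. apply HB. intros t Ht.
      rewrite Cmod_mult, Cmod_Cexp. simpl.
      replace (exp (Cmod w) * (Cmod w * 1) * (1 / 1))%R with (Cmod w * exp (Cmod w))%R by field.
      apply Rmult_le_compat_l; [apply Cmod_ge_0|].
      apply exp_le_compat.
      change (t * Re w - 0 * Im w <= Cmod w)%R.
      pose proof (Rle_trans _ _ _ (Rle_abs _) (re_le_Cmod w)).
      pose proof (Cmod_ge_0 w).
      destruct (Rle_lt_dec 0 (Re w)) as [h|h].
      + pose proof (Rmult_le_pos (1 - t) (Re w) ltac:(lra) h). lra.
      + pose proof (Rmult_le_pos t (- Re w) ltac:(lra) ltac:(lra)). lra.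
    - pose proof (Cderiv_bound (f (S n)) (fun t => w * f n t) (g (S n)) _ T (proj1 HT)
        (fun t _ => HdS n t) (fun t _ => Hgd (S n) t)) as HB.
      rewrite Hf0, Hg0 in HB. replace (f (S n) T - 0) with (f (S n) T) in HB by ring.
      rewrite Rminus_0_r in HB. apply HB. intros t Ht.
      rewrite Cmod_mult. specialize (IH t ltac:(lra)). unfold g in IH.
      pose proof (Cmod_ge_0 w).
      replace (exp (Cmod w) * Cmod w ^ S (S n) * (t ^ S n / INR (fact (S n))))%R
        with (Cmod w * (exp (Cmod w) * Cmod w ^ S n * (t ^ S n / INR (fact (S n)))))%R
        by (simpl; ring).
      apply Rmult_le_compat_l; assumption. }
  specialize (Hbound K 1%R ltac:(lra)). unfold f, g in Hbound.
  rewrite pow1, Cmult_1_l in Hbound. eapply Rle_trans; [exact Hbound|].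
  apply Req_le. unfold Rdiv. ring.
Qed.

(** * The reciprocal Gamma function *)

Lemma entire_Cexp : entire Cexp.
Proof.
  apply entire_limit. intros A eps He.
  set (B := Rabs A).
  assert (HB : (0 <= B)%R) by apply Rabs_pos.
  assert (Hlim : is_lim_seq (fun n => exp B * (B ^ S n / INR (fact (S n))))%R (exp B * 0)%R).
  { apply is_lim_seq_mult'; [apply is_lim_seq_const|].
    apply (is_lim_seq_incr_1 (fun n => B ^ n / INR (fact n)))%R.
    apply is_lim_seq_Reals. exact (cv_speed_pow_fact B). }
  rewrite Rmult_0_r in Hlim. apply is_lim_seq_spec in Hlim.
  destruct (Hlim (mkposreal eps He)) as [K HK]. specialize (HK K (Nat.le_refl _)).
  change (Rabs (exp B * (B ^ S K / INR (fact (S K))) - 0) < eps)%R in HK.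
  rewrite Rminus_0_r in HK. apply Rabs_def2 in HK.
  exists (fun z => Csum (fun k => z ^ k / INR (fact k)) K). split.
  - apply (entire_Csum (fun k z => z ^ k / INR (fact k))). intros k. unfold Cdiv.
    apply (entire_mult (fun z => z ^ k) (fun _ => / INR (fact k))); [|apply entire_const].
    induction k as [|k IH].
    + apply (entire_ext (fun _ => 1)); [reflexivity|apply entire_const].
    + apply (entire_ext (fun z => z * z ^ k)); [reflexivity|].
      apply entire_mult; [apply entire_id|exact IH].
  - intros z Hz. eapply Rle_trans; [apply Cexp_taylor|].
    assert (HzB : (Cmod z <= B)%R) by (eapply Rle_trans; [exact Hz|apply Rle_abs]).
    apply Rle_trans with (exp B * (B ^ S K / INR (fact (S K))))%R; [|lra].
    unfold Rdiv. rewrite Rmult_assoc.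
    assert (0 < / INR (fact (S K)))%R by (apply Rinv_0_lt_compat, INR_fact_lt_0).
    apply Rmult_le_compat.
    + apply Rlt_le, exp_pos.
    + apply Rmult_le_pos; [apply pow_le, Cmod_ge_0|lra].
    + apply exp_le_compat, HzB.
    + apply Rmult_le_compat_r; [lra|]. apply pow_incr. split; [apply Cmod_ge_0|exact HzB].
Qed.

Lemma Cexp_1_bound (w : C) :
  (Cmod (Cexp w - 1 - w)%C <= exp (Cmod w) * Cmod w ^ 2)%R.
Proof.
  pose proof (Cexp_taylor w 1) as H. rewrite Csum_S, Csum_0 in H.
  replace (Cexp w - (w ^ 0 / INR (fact 0) + w ^ 1 / INR (fact 1))) with (Cexp w - 1 - w) in H
    by (simpl; field).
  eapply Rle_trans; [exact H|]. simpl fact. simpl INR.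
  assert (0 <= exp (Cmod w) * Cmod w ^ 2)%R.
  { apply Rmult_le_pos; [apply Rlt_le, exp_pos|apply pow_le, Cmod_ge_0]. }
  lra.
Qed.

Lemma RtoC_neq (x y : R) : x <> y -> RtoC x <> RtoC y.
Proof. intros H h. apply H, RtoC_inj, h. Qed.

Lemma INR_S_neq n : RtoC (INR (S n)) <> 0.
Proof. apply RtoC_neq, not_0_INR. lia. Qed.

Lemma INR_fact_neq n : RtoC (INR (fact n)) <> 0.
Proof. apply RtoC_neq, INR_fact_neq_0. Qed.

Lemma INR_S_C n : RtoC (INR (S n)) = INR n + 1.
Proof. rewrite S_INR, RtoC_plus. reflexivity. Qed.

Lemma Clog_pos (x : R) : (0 < x)%R -> Clog x = ln x.
Proof.
  intros Hx. unfold Clog, Carg. rewrite Cmod_R, (Rabs_pos_eq x) by lra.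
  simpl. destruct (Rle_dec 0 0) as [_|h]; [|lra].
  replace (x / x)%R with 1%R by (field; lra). rewrite acos_1. reflexivity.
Qed.

Lemma Cpower_pos (x : R) (a : C) : (0 < x)%R -> Cpower x a = Cexp (ln x * a).
Proof. intros Hx. unfold Cpower. rewrite Clog_pos by exact Hx. f_equal. ring. Qed.

Lemma ln_succ_bounds n :
  (0 < n)%nat -> (/ INR (S n) <= ln (INR (S n)) - ln (INR n) <= / INR n)%R.
Proof.
  intros Hn. assert (H0 : (0 < INR n)%R) by (apply lt_0_INR; lia).
  assert (H1 : (0 < INR (S n))%R) by (apply lt_0_INR; lia).
  assert (Hle : forall y, (0 < y)%R -> (ln y <= y - 1)%R).
  { intros y Hy. pose proof (exp_ineq1_le (ln y)) as H. rewrite exp_ln in H; lra. }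
  split.
  - pose proof (Hle (INR n / INR (S n))%R ltac:(apply Rdiv_lt_0_compat; lra)) as H.
    unfold Rdiv in H. rewrite ln_mult, ln_Rinv in H; try apply Rinv_0_lt_compat; try lra.
    replace (INR n * / INR (S n) - 1)%R with (- / INR (S n))%R in H.
    { lra. }
    rewrite S_INR in *. field. lra.
  - pose proof (Hle (INR (S n) / INR n)%R ltac:(apply Rdiv_lt_0_compat; lra)) as H.
    unfold Rdiv in H. rewrite ln_mult, ln_Rinv in H; try apply Rinv_0_lt_compat; try lra.
    replace (INR (S n) * / INR n - 1)%R with (/ INR n)%R in H.
    { lra. }
    rewrite S_INR. field. lra.
Qed.

(** Reciprocal of Euler's [n! n^z / (z (z+1) ... (z+n))]. *)
Definition euler_rg (n : nat) (z : C) : C :=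
  poch z (S n) / INR (fact n) * Cexp (- ln (INR n) * z).

Definition euler_ratio (n : nat) (z : C) : C :=
  (1 + z / INR (S n)) * Cexp (- (ln (INR (S n)) - ln (INR n))%R * z).

Lemma euler_rg_S n z : euler_rg (S n) z = euler_rg n z * euler_ratio n z.
Proof.
  unfold euler_rg, euler_ratio.
  replace (Cexp (- ln (INR (S n)) * z))
    with (Cexp (- ln (INR n) * z) * Cexp (- (ln (INR (S n)) - ln (INR n))%R * z)).
  2:{ rewrite <- Cexp_plus. f_equal. rewrite RtoC_minus. ring. }
  change (poch z (S (S n))) with (poch z (S n) * (z + INR (S n))).
  rewrite fact_simpl, mult_INR, RtoC_mult.
  field. split; [apply INR_S_neq|apply INR_fact_neq].
Qed.

Definition euler_const (A : R) : R := (2 * (1 + A) * A ^ 2 * exp A + A + A ^ 2)%R.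

(** Consecutive terms of Euler's limit have ratio [1 + O(1/n^2)], uniformly on
    discs. The bound is written with [1/n - 1/(n+1)] because that telescopes. *)
Lemma euler_ratio_bound A n z :
  (0 < n)%nat -> (Cmod z <= A)%R ->
  (Cmod (euler_ratio n z - 1) <= euler_const A * (/ INR n - / INR (S n)))%R.
Proof.
  intros Hn Hz. pose proof (Cmod_ge_0 z) as Hz0.
  assert (H1 : (1 <= INR n)%R) by (apply (le_INR 1); lia).
  assert (H2 := ln_succ_bounds n Hn).
  set (l := (ln (INR (S n)) - ln (INR n))%R) in *.
  set (m := / INR (S n)) in *. set (k := / INR n) in *.
  assert (Hm : (0 < / INR (S n))%R) by (apply Rinv_0_lt_compat, lt_0_INR; lia).
  assert (Hk : (/ INR n <= 1)%R).
  { rewrite <- Rinv_1. apply Rinv_le_contravar; lra. }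
  set (p := (/ INR n)%R) in *. set (q := (/ INR (S n))%R) in *.
  assert (Hpq : (p * q = p - q)%R) by (unfold p, q; rewrite S_INR; field; lra).
  assert (Hp2 : (p <= 2 * q)%R) by nra.
  (* first-order expansion of the exponential *)
  assert (HE := Cexp_1_bound (- l * z)).
  set (rem := Cexp (- l * z) - 1 - - l * z) in *.
  assert (E : euler_ratio n z - 1 = (1 + z * q) * rem + (q - l)%R * z - q * l * (z * z)).
  { unfold euler_ratio. fold l. unfold rem, q. rewrite RtoC_minus, RtoC_inv.
    - field. apply INR_S_neq.
    - apply not_0_INR. lia. }
  rewrite E.
  assert (Hlz : Cmod (- l * z) = (l * Cmod z)%R).
  { rewrite Cmod_mult, Cmod_opp, Cmod_R, Rabs_pos_eq; lra. }
  rewrite Hlz in HE.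
  assert (Hlz1 : (l * Cmod z <= A)%R) by nra.
  assert (Hrem : (Cmod rem <= exp A * (A ^ 2 * (2 * (p - q))))%R).
  { eapply Rle_trans; [exact HE|]. apply Rmult_le_compat.
    - apply Rlt_le, exp_pos.
    - apply pow2_ge_0.
    - apply exp_le_compat, Hlz1.
    - rewrite Rpow_mult_distr, Rmult_comm. apply Rmult_le_compat.
      + apply pow2_ge_0.
      + apply pow2_ge_0.
      + apply pow_incr. lra.
      + rewrite <- Hpq. nra. }
  assert (T1 : (Cmod ((1 + z * q) * rem) <= (1 + A) * (exp A * (A ^ 2 * (2 * (p - q)))))%R).
  { rewrite Cmod_mult. apply Rmult_le_compat; try apply Cmod_ge_0; [|exact Hrem].
    eapply Rle_trans; [apply Cmod_triangle|]. rewrite Cmod_1, Cmod_mult, Cmod_R.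
    rewrite Rabs_pos_eq by lra. nra. }
  assert (T2 : (Cmod ((q - l)%R * z) <= (p - q) * A)%R).
  { rewrite Cmod_mult, Cmod_R. apply Rmult_le_compat; try apply Cmod_ge_0; [apply Rabs_pos| |exact Hz].
    apply Rabs_le. lra. }
  assert (T3 : (Cmod (q * l * (z * z)) <= (p - q) * A ^ 2)%R).
  { rewrite !Cmod_mult, !Cmod_R, !Rabs_pos_eq by lra.
    apply Rmult_le_compat; [apply Rmult_le_pos; lra|apply Rmult_le_pos; lra| |].
    - rewrite <- Hpq, (Rmult_comm p). apply Rmult_le_compat_l; lra.
    - simpl. rewrite Rmult_1_r. apply Rmult_le_compat; lra. }
  eapply Rle_trans; [apply Cmod_triangle_minus|].
  eapply Rle_trans; [apply Rplus_le_compat; [apply Cmod_triangle|exact T3]|].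
  unfold euler_const. nra.
Qed.

Lemma euler_const_nonneg A : (0 <= A)%R -> (0 <= euler_const A)%R.
Proof.
  intros HA. unfold euler_const. pose proof (exp_pos A).
  pose proof (pow2_ge_0 A).
  assert (0 <= 2 * (1 + A) * A ^ 2 * exp A)%R.
  { repeat apply Rmult_le_pos; try lra. }
  lra.
Qed.

Lemma euler_rg_bounded A n z :
  (0 <= A)%R -> (Cmod z <= A)%R ->
  (Cmod (euler_rg (S n) z) <= A * (1 + A) * exp (euler_const A * (1 - / INR (S n))))%R.
Proof.
  intros HA Hz. pose proof (Cmod_ge_0 z) as Hz0. pose proof (euler_const_nonneg A HA) as HC.
  induction n as [|n IH].
  - unfold euler_rg. simpl. rewrite ln_1.
    replace (1 * (z + 0) * (z + 1) / 1 * Cexp (- 0 * z)) with (z * (1 + z)).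
    2:{ replace (- 0 * z) with (RtoC 0) by ring. rewrite Cexp_0. field. }
    replace (euler_const A * (1 - / 1))%R with 0%R by field.
    rewrite exp_0, Rmult_1_r, Cmod_mult.
    apply Rmult_le_compat; try apply Cmod_ge_0; [exact Hz|].
    eapply Rle_trans; [apply Cmod_triangle|]. rewrite Cmod_1. lra.
  - rewrite euler_rg_S, Cmod_mult.
    assert (Hr := euler_ratio_bound A (S n) z ltac:(lia) Hz).
    set (d := (euler_const A * (/ INR (S n) - / INR (S (S n))))%R) in *.
    assert (Hr1 : (Cmod (euler_ratio (S n) z) <= exp d)%R).
    { apply Rle_trans with (1 + d)%R; [|apply exp_ineq1_le].
      replace (euler_ratio (S n) z) with (1 + (euler_ratio (S n) z - 1)) by ring.
      eapply Rle_trans; [apply Cmod_triangle|]. rewrite Cmod_1. lra. }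
    replace (euler_const A * (1 - / INR (S (S n))))%R
      with (euler_const A * (1 - / INR (S n)) + d)%R by (unfold d; ring).
    rewrite exp_plus, <- Rmult_assoc.
    apply Rmult_le_compat; try apply Cmod_ge_0; assumption.
Qed.

Definition euler_rate (A : R) : R := (A * (1 + A) * exp (euler_const A) * euler_const A)%R.

Lemma euler_rg_cauchy A i j z :
  (0 <= A)%R -> (Cmod z <= A)%R -> (i <= j)%nat ->
  (Cmod (euler_rg (S i) z - euler_rg (S j) z)
    <= euler_rate A * (/ INR (S i) - / INR (S j)))%R.
Proof.
  intros HA Hz Hij. pose proof (euler_const_nonneg A HA) as HC.
  induction Hij as [|j Hij IH].
  - unfold Cminus. rewrite Cplus_opp_r, Cmod_0. lra.
  - eapply Rle_trans; [apply (Cmod_triangle_3 _ (euler_rg (S j) z))|].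
    replace (euler_rate A * (/ INR (S i) - / INR (S (S j))))%R
      with (euler_rate A * (/ INR (S i) - / INR (S j))
            + euler_rate A * (/ INR (S j) - / INR (S (S j))))%R by ring.
    apply Rplus_le_compat; [exact IH|].
    rewrite (euler_rg_S (S j)).
    replace (euler_rg (S j) z - euler_rg (S j) z * euler_ratio (S j) z)
      with (- (euler_rg (S j) z * (euler_ratio (S j) z - 1))) by ring.
    rewrite Cmod_opp, Cmod_mult. unfold euler_rate. rewrite !Rmult_assoc.
    rewrite <- (Rmult_assoc A (1 + A)), <- (Rmult_assoc (A * (1 + A))).
    apply Rmult_le_compat; try apply Cmod_ge_0.
    + eapply Rle_trans; [apply (euler_rg_bounded A); assumption|].
      apply Rmult_le_compat_l; [apply Rmult_le_pos; lra|].
      apply exp_le_compat. 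
      assert (0 < / INR (S j))%R by (apply Rinv_0_lt_compat, lt_0_INR; lia).
      nra.
    + apply euler_ratio_bound; [lia|exact Hz].
Qed.

Lemma euler_rate_nonneg A : (0 <= A)%R -> (0 <= euler_rate A)%R.
Proof.
  intros HA. unfold euler_rate. pose proof (exp_pos (euler_const A)).
  repeat apply Rmult_le_pos; try lra. apply euler_const_nonneg, HA.
Qed.

Lemma inv_succ_lim (c eps : R) :
  (0 <= c)%R -> (0 < eps)%R ->
  exists N, forall n, (N <= n)%nat -> (c * / INR (S n) < eps)%R.
Proof.
  intros Hc He. destruct (nfloor_ex (c / eps)) as [N [_ HN]].
  { apply Rdiv_le_0_compat; lra. }
  exists N. intros n Hn. apply Rlt_div_l; [apply lt_0_INR; lia|].
  apply Rlt_div_l in HN; [|exact He].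
  apply le_INR in Hn. rewrite S_INR. nra.
Qed.

Definition rGamma (z : C) : C :=
  Ciota (fun g => filterlim (fun n => euler_rg n z) eventually (locally g)).

Lemma rGamma_rate A n z :
  (0 <= A)%R -> (Cmod z <= A)%R ->
  (Cmod (euler_rg (S n) z - rGamma z) <= euler_rate A * / INR (S n))%R.
Proof.
  intros HA Hz. pose proof (euler_rate_nonneg A HA) as HR.
  destruct (C_cauchy_lim (fun k => euler_rg (S k) z)
              (fun k => (euler_rate A * / INR (S k))%R)) as [l Hl].
  - intros eps He. apply inv_succ_lim; assumption.
  - intros i j Hij. eapply Rle_trans; [apply (euler_rg_cauchy A); assumption|].
    apply Rmult_le_compat_l; [exact HR|].
    assert (0 < / INR (S j))%R by (apply Rinv_0_lt_compat, lt_0_INR; lia). lra.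
  - replace (rGamma z) with l; [apply Hl|]. symmetry. apply Ciota_seq_lim.
    apply filterlim_C_seq. intros eps He.
    destruct (inv_succ_lim _ _ HR He) as [N HN]. exists (S N). intros [|k] Hk; [lia|].
    eapply Rle_lt_trans; [apply Hl|apply HN; lia].
Qed.

Lemma rGamma_lim z :
  filterlim (fun n => euler_rg n z) eventually (locally (rGamma z)).
Proof.
  apply filterlim_C_seq. intros eps He.
  destruct (inv_succ_lim _ _ (euler_rate_nonneg _ (Cmod_ge_0 z)) He) as [N HN].
  exists (S N). intros [|n] Hn; [lia|].
  eapply Rle_lt_trans; [apply (rGamma_rate (Cmod z)); [apply Cmod_ge_0|lra]|apply HN; lia].
Qed.

Lemma entire_poch n : entire (fun z => poch z n).
Proof.
  induction n as [|n IH]; [exact (entire_const 1)|].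
  apply (entire_mult (fun z => poch z n) (fun z => z + INR n)); [exact IH|].
  apply entire_plus; [apply entire_id|apply entire_const].
Qed.

Lemma entire_rGamma : entire rGamma.
Proof.
  apply entire_limit. intros A eps He.
  destruct (inv_succ_lim _ _ (euler_rate_nonneg _ (Rabs_pos A)) He) as [N HN].
  exists (euler_rg (S N)). split.
  - unfold euler_rg. 
    apply (entire_mult (fun z => poch z (S (S N)) / INR (fact (S N)))
             (fun z => Cexp (- ln (INR (S N)) * z))).
    + apply (entire_mult (fun z => poch z (S (S N))) (fun _ => / INR (fact (S N))));
        [apply entire_poch|apply entire_const].
    + apply (entire_ext (fun z => Cexp (- ln (INR (S N)) * z + 0))).
      { intros z. f_equal. ring. }
      apply (entire_affine Cexp), entire_Cexp.
  - intros z Hz. rewrite Cmod_minus_sym.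
    eapply Rle_trans; [apply (rGamma_rate (Rabs A)); [apply Rabs_pos|]|].
    + eapply Rle_trans; [exact Hz|apply Rle_abs].
    + apply Rlt_le, HN. lia.
Qed.

Lemma poch_neq_0 z n : (forall k, (k < n)%nat -> z <> - INR k) -> poch z n <> 0.
Proof.
  induction n as [|n IH]; intros H; [exact C1_nz|].
  simpl. apply Cmult_neq_0; [apply IH; intros; apply H; lia|].
  intros h. apply (H n ltac:(lia)). replace z with (z + INR n - INR n) by ring.
  rewrite h. ring.
Qed.

(** Off the poles the tail of the product stays within a factor two of its first
    term, hence cannot tend to zero. *)
Lemma rGamma_neq_0 z : ~ nonpos_int z -> rGamma z <> 0.
Proof.
  intros Hz H0. set (A := Cmod z). assert (HA : (0 <= A)%R) by apply Cmod_ge_0.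
  pose proof (euler_const_nonneg A HA) as HC.
  destruct (inv_succ_lim _ (1 / 2) HC ltac:(lra)) as [M HM].
  specialize (HM M (Nat.le_refl _)).
  assert (HP : forall n, (0 < n)%nat -> euler_rg n z <> 0).
  { intros n Hn. unfold euler_rg, Cdiv. apply Cmult_neq_0; [apply Cmult_neq_0|].
    - apply poch_neq_0. intros k _ h. apply Hz. exists k. exact h.
    - rewrite <- RtoC_inv by apply INR_fact_neq_0.
      apply RtoC_neq, Rinv_neq_0_compat, INR_fact_neq_0.
    - apply Cexp_neq_0. }
  assert (HL : forall n, (M <= n)%nat ->
            (Cmod (euler_rg (S M) z) * (1 - euler_const A * (/ INR (S M) - / INR (S n)))
              <= Cmod (euler_rg (S n) z))%R).
  { intros n Hn. induction Hn as [|n Hn IH].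
    - replace (1 - euler_const A * (/ INR (S M) - / INR (S M)))%R with 1%R by ring. lra.
    - rewrite (euler_rg_S (S n)), Cmod_mult.
      assert (Hr := euler_ratio_bound A (S n) z ltac:(lia) (Rle_refl _)).
      set (d := (euler_const A * (/ INR (S n) - / INR (S (S n))))%R) in *.
      set (s := (euler_const A * (/ INR (S M) - / INR (S n)))%R) in *.
      replace (euler_const A * (/ INR (S M) - / INR (S (S n))))%R with (s + d)%R
        by (unfold s, d; ring).
      assert (Hr1 : (1 - d <= Cmod (euler_ratio (S n) z))%R).
      { pose proof (Cmod_triangle_3 1 (euler_ratio (S n) z) 0) as HT.
        replace (1 - 0) with (RtoC 1) in HT by ring. rewrite Cmod_1, Cmod_minus_sym in HT.
        replace (euler_ratio (S n) z - 0) with (euler_ratio (S n) z) in HT by ring. lra. }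
      assert (Hs0 : (0 <= s)%R).
      { apply Rmult_le_pos; [exact HC|].
        assert (/ INR (S n) <= / INR (S M))%R.
        { apply Rinv_le_contravar; [apply lt_0_INR; lia|apply le_INR; lia]. }
        lra. }
      assert (Hd0 : (0 <= d)%R) by (eapply Rle_trans; [apply Cmod_ge_0|exact Hr]).
      assert (Hds : (s + d <= 1 / 2)%R).
      { replace (s + d)%R with (euler_const A * / INR (S M) - euler_const A * / INR (S (S n)))%R
          by (unfold s, d; ring).
        assert (0 <= euler_const A * / INR (S (S n)))%R.
        { apply Rmult_le_pos; [exact HC|]. apply Rlt_le, Rinv_0_lt_compat, lt_0_INR. lia. }
        lra. }
      pose proof (Cmod_ge_0 (euler_rg (S M) z)) as HP0.
      apply Rle_trans with (Cmod (euler_rg (S M) z) * ((1 - s) * (1 - d)))%R.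
      + apply Rmult_le_compat_l; [exact HP0|]. nra.
      + rewrite <- Rmult_assoc. apply Rmult_le_compat; try lra.
        apply Rmult_le_pos; lra. }
  pose proof (proj1 (Cmod_gt_0 _) (HP (S M) ltac:(lia))) as Hpos.
  destruct (proj1 (filterlim_C_seq _ _) (rGamma_lim z) (Cmod (euler_rg (S M) z) / 2)%R)
    as [N HN]; [lra|].
  specialize (HN (S (M + N)) ltac:(lia)). specialize (HL (M + N)%nat ltac:(lia)).
  rewrite H0 in HN. replace (euler_rg (S (M + N)) z - 0) with (euler_rg (S (M + N)) z) in HN by ring.
  assert (0 <= euler_const A * / INR (S (M + N)))%R.
  { apply Rmult_le_pos; [exact HC|]. apply Rlt_le, Rinv_0_lt_compat, lt_0_INR. lia. }
  nra.
Qed.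

Lemma Gamma_rGamma z : ~ nonpos_int z -> / Gamma z = rGamma z.
Proof.
  intros Hz. pose proof (rGamma_neq_0 z Hz) as H0.
  assert (HG : Gamma z = / rGamma z).
  { apply Ciota_seq_lim. apply filterlim_C_seq. intros eps He.
    pose proof (proj1 (Cmod_gt_0 _) H0) as Hm. set (m := Cmod (rGamma z)) in *.
    assert (He' : (0 < Rmin (m / 2) (eps * m * m / 2))%R).
    { apply Rmin_pos; [lra|]. apply Rdiv_lt_0_compat; [|lra]. 
      apply Rmult_lt_0_compat; [apply Rmult_lt_0_compat|]; assumption. }
    destruct (proj1 (filterlim_C_seq _ _) (rGamma_lim z) _ He') as [N HN].
    exists (S N). intros n Hn. specialize (HN n ltac:(lia)).
    pose proof (Rmin_l (m / 2) (eps * m * m / 2)) as R1.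
    pose proof (Rmin_r (m / 2) (eps * m * m / 2)) as R2.
    assert (Hn0 : (0 < INR n)%R) by (apply lt_0_INR; lia).
    assert (Hun : (m / 2 < Cmod (euler_rg n z))%R).
    { pose proof (Cmod_triangle_3 (rGamma z) (euler_rg n z) 0) as HT.
      replace (rGamma z - 0) with (rGamma z) in HT by ring.
      replace (euler_rg n z - 0) with (euler_rg n z) in HT by ring.
      rewrite (Cmod_minus_sym (rGamma z) (euler_rg n z)) in HT. fold m in HT. lra. }
    assert (Hu0 : euler_rg n z <> 0) by (apply Cmod_gt_0; lra).
    assert (Hp0 : poch z (S n) <> 0).
    { apply poch_neq_0. intros k _ h. apply Hz. exists k. exact h. }
    replace (INR (fact n) * Cpower (INR n) z / poch z (S n)) with (/ euler_rg n z).
    2:{ rewrite Cpower_pos by exact Hn0. unfold euler_rg.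
        replace (- ln (INR n) * z) with (- (ln (INR n) * z)) by ring.
        rewrite Cexp_opp. field.
        repeat split; first [exact Hp0|apply Cexp_neq_0|apply INR_fact_neq]. }
    replace (/ euler_rg n z - / rGamma z)
      with (- ((euler_rg n z - rGamma z) / (euler_rg n z * rGamma z)))
      by (field; split; assumption).
    rewrite Cmod_opp, Cmod_div, Cmod_mult by (apply Cmult_neq_0; assumption).
    fold m. apply Rlt_div_l; [apply Rmult_lt_0_compat; lra|].
    nra. }
  rewrite HG. field. exact H0.
Qed.

(** Euler's terms satisfy the functional equation up to a factor
    [1 + (z + 1)/(n + 1)]. *)
Lemma rGamma_S z : rGamma z = z * rGamma (z + 1).
Proof.
  apply Cmod_small_eq. intros eps He.
  set (A := (Cmod z + 1)%R).
  assert (HA : (0 <= A)%R) by (unfold A; pose proof (Cmod_ge_0 z); lra).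
  assert (Hz : (Cmod z <= A)%R) by (unfold A; lra).
  assert (Hz1 : (Cmod (z + 1) <= A)%R).
  { eapply Rle_trans; [apply Cmod_triangle|]. rewrite Cmod_1. unfold A. lra. }
  assert (Hpoch : forall n, z * poch (z + 1) n = poch z (S n)).
  { induction n as [|n IH]; [simpl; ring|].
    change (poch z (S (S n))) with (poch z (S n) * (z + INR (S n))).
    rewrite <- IH, INR_S_C. simpl. ring. }
  assert (E : forall n, z * euler_rg (S n) (z + 1)
                = euler_rg (S n) z * (1 + (z + 1) / INR (S n))).
  { intros n. unfold euler_rg, Cdiv. rewrite !Cmult_assoc, Hpoch.
    replace (Cexp (- ln (INR (S n)) * (z + 1)))
      with (Cexp (- ln (INR (S n)) * z) * / INR (S n)).
    2:{ replace (- ln (INR (S n)) * (z + 1)) 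
          with (- ln (INR (S n)) * z + - (ln (INR (S n)))) by ring.
        rewrite Cexp_plus. f_equal. rewrite Cexp_opp, Cexp_R, exp_ln; [reflexivity|].
        apply lt_0_INR. lia. }
    change (poch z (S (S (S n)))) with (poch z (S (S n)) * (z + INR (S (S n)))).
    rewrite (INR_S_C (S n)). field. split; first [apply INR_S_neq|apply INR_fact_neq]. }
  pose proof (euler_rate_nonneg A HA) as HR.
  destruct (approx_bounded 0 A rGamma (entire_rGamma 0 A)) as [B [HB Hb]].
  set (c := (euler_rate A + Cmod z * euler_rate A + (B + euler_rate A) * A)%R).
  assert (Hc : (0 <= c)%R).
  { unfold c. pose proof (Cmod_ge_0 z).
    pose proof (Rmult_le_pos _ _ H HR). pose proof (Rmult_le_pos (B + euler_rate A) A). lra. }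
  destruct (inv_succ_lim c eps Hc He) as [n Hn]. specialize (Hn n (Nat.le_refl _)).
  assert (Hi : (0 < / INR (S n) <= 1)%R).
  { split; [apply Rinv_0_lt_compat, lt_0_INR; lia|].
    rewrite <- Rinv_1. apply Rinv_le_contravar; [lra|]. apply (le_INR 1). lia. }
  set (h := (/ INR (S n))%R) in *.
  pose proof (rGamma_rate A n z HA Hz) as R1. pose proof (rGamma_rate A n (z + 1) HA Hz1) as R2.
  fold h in R1, R2.
  replace (rGamma z - z * rGamma (z + 1))
    with (- (euler_rg (S n) z - rGamma z) + z * (euler_rg (S n) (z + 1) - rGamma (z + 1))
          - euler_rg (S n) z * ((z + 1) / INR (S n))).
  2:{ rewrite Cmult_minus_distr, E. ring. }
  eapply Rle_trans; [apply Cmod_triangle_minus|].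
  eapply Rle_trans; [apply Rplus_le_compat_r, Cmod_triangle|].
  rewrite Cmod_opp, !Cmod_mult, Cmod_div by apply INR_S_neq. rewrite Cmod_INR.
  unfold Rdiv. fold h.
  assert (Hu : (Cmod (euler_rg (S n) z) <= B + euler_rate A)%R).
  { replace (euler_rg (S n) z) with ((euler_rg (S n) z - rGamma z) + rGamma z) by ring.
    eapply Rle_trans; [apply Cmod_triangle|].
    specialize (Hb z). replace (z - 0) with z in Hb by ring. specialize (Hb Hz). nra. }
  apply Rle_trans with (c * h)%R; [|lra]. unfold c.
  replace ((euler_rate A + Cmod z * euler_rate A + (B + euler_rate A) * A) * h)%R
    with (euler_rate A * h + Cmod z * (euler_rate A * h) + (B + euler_rate A) * (A * h))%R
    by ring.
  apply Rplus_le_compat; [apply Rplus_le_compat|].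
  - exact R1.
  - apply Rmult_le_compat_l; [apply Cmod_ge_0|exact R2].
  - apply Rmult_le_compat; [apply Cmod_ge_0| |exact Hu|].
    + apply Rmult_le_pos; [apply Cmod_ge_0|lra].
    + apply Rmult_le_compat_r; lra.
Qed.

Lemma rGamma_poch z n : rGamma z = poch z n * rGamma (z + INR n).
Proof.
  induction n as [|n IH].
  - simpl. rewrite Cplus_0_r. ring.
  - rewrite IH, rGamma_S, INR_S_C. simpl.
    replace (z + (INR n + 1)) with (z + INR n + 1) by ring. ring.
Qed.

(** * Pochhammer symbols and growth estimates *)

Lemma poch_S z n : poch z (S n) = poch z n * (z + INR n).
Proof. reflexivity. Qed.

Lemma poch_add z n m : poch z (n + m) = poch z n * poch (z + INR n) m.
Proof.
  induction m as [|m IH].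
  - rewrite Nat.add_0_r. simpl. ring.
  - rewrite <- plus_n_Sm, !poch_S, IH, plus_INR, RtoC_plus. ring.
Qed.

Lemma poch_Sl z n : poch z (S n) = z * poch (z + 1) n.
Proof.
  change (S n) with (1 + n)%nat. rewrite poch_add. simpl. ring.
Qed.

Fixpoint rpoch (t : R) (n : nat) : R :=
  match n with
  | O => 1
  | S m => rpoch t m * (t + INR m)
  end.

Lemma RtoC_poch t n : poch (RtoC t) n = rpoch t n.
Proof.
  induction n as [|n IH]; [reflexivity|].
  rewrite poch_S, IH. simpl rpoch. rewrite RtoC_mult, RtoC_plus. reflexivity.
Qed.

Lemma rpoch_S t n : rpoch t (S n) = (rpoch t n * (t + INR n))%R.
Proof. reflexivity. Qed.

Lemma rpoch_pos t n : (0 < t)%R -> (0 < rpoch t n)%R.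
Proof.
  intros Ht. induction n as [|n IH]; simpl; [lra|].
  apply Rmult_lt_0_compat; [exact IH|]. pose proof (pos_INR n). lra.
Qed.

Lemma rpoch_ge_fact t n : (1 <= t)%R -> (INR (fact n) <= rpoch t n)%R.
Proof.
  intros Ht. induction n as [|n IH]; [simpl; lra|].
  rewrite fact_simpl, mult_INR, Rmult_comm, rpoch_S, S_INR.
  pose proof (pos_INR n). pose proof (INR_fact_lt_0 n).
  apply Rmult_le_compat; lra.
Qed.

Lemma rpoch_half_ge t n :
  (1 / 2 <= t)%R -> (INR (fact n) <= 2 * INR (S n) * rpoch t n)%R.
Proof.
  intros Ht. induction n as [|n IH]; [simpl; lra|].
  rewrite fact_simpl, mult_INR, rpoch_S.
  pose proof (pos_INR n) as H0. pose proof (rpoch_pos t n ltac:(lra)) as Hp.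
  apply Rle_trans with (INR (S n) * (2 * INR (S n) * rpoch t n))%R.
  - apply Rmult_le_compat_l; [apply pos_INR|exact IH].
  - rewrite (S_INR (S n)), !S_INR.
    replace ((INR n + 1) * (2 * (INR n + 1) * rpoch t n))%R
      with (rpoch t n * (2 * (INR n + 1) * (INR n + 1)))%R by ring.
    replace (2 * (INR n + 1 + 1) * (rpoch t n * (t + INR n)))%R
      with (rpoch t n * (2 * (INR n + 1 + 1) * (t + INR n)))%R by ring.
    apply Rmult_le_compat_l; [lra|]. nra.
Qed.

Lemma pow_ratio_step A n :
  (INR (S n) ^ A * (INR A + INR (S n)) <= INR (S n) * INR (S (S n)) ^ A)%R.
Proof.
  assert (Hn : (0 < INR (S n))%R) by (apply lt_0_INR; lia).
  assert (HB := bernoulli_le (/ INR (S n)) A (Rlt_le _ _ (Rinv_0_lt_compat _ Hn))).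
  assert (E : (INR (S (S n)) = INR (S n) * (1 + / INR (S n)))%R).
  { rewrite (S_INR (S n)). field. lra. }
  rewrite E, Rpow_mult_distr.
  replace (INR (S n) * (INR (S n) ^ A * (1 + / INR (S n)) ^ A))%R
    with (INR (S n) ^ A * (INR (S n) * (1 + / INR (S n)) ^ A))%R by ring.
  apply Rmult_le_compat_l; [apply pow_le; lra|].
  apply Rle_trans with (INR (S n) * (1 + INR A * / INR (S n)))%R.
  - apply Req_le. field. lra.
  - apply Rmult_le_compat_l; lra.
Qed.

(** Factor by factor, [|z + h + i|] is at most [A + h + i]; the quotient of the
    latter by [h + i + 1] multiplies up to polynomial growth, by Bernoulli's
    inequality ([pow_ratio_step]). *)
Lemma poch_shift_bound A h n z :
  (Cmod z <= INR A)%R ->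
  (INR (fact h) * Cmod (poch (z + INR h) n)
     <= INR (fact (h + n)) * INR (S (h + n)) ^ A)%R.
Proof.
  intros Hz. induction n as [|n IH].
  - rewrite Nat.add_0_r. simpl poch. rewrite Cmod_1, Rmult_1_r.
    rewrite <- (Rmult_1_r (INR (fact h))) at 1.
    apply Rmult_le_compat_l; [apply pos_INR|]. apply pow_R1_Rle. apply (le_INR 1). lia.
  - rewrite poch_S, Cmod_mult, <- plus_n_Sm.
    assert (Hf : (Cmod (z + INR h + INR n) <= INR A + INR (S (h + n)))%R).
    { eapply Rle_trans; [apply Cmod_triangle|].
      eapply Rle_trans; [apply Rplus_le_compat_r, Cmod_triangle|].
      rewrite !Cmod_INR, S_INR, plus_INR. lra. }
    rewrite fact_simpl, mult_INR.
    apply Rle_trans with (INR (fact (h + n)) * INR (S (h + n)) ^ A * (INR A + INR (S (h + n))))%R.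
    + rewrite <- Rmult_assoc. apply Rmult_le_compat; try apply Cmod_ge_0; try assumption.
      apply Rmult_le_pos; [apply pos_INR|apply Cmod_ge_0].
    + pose proof (pow_ratio_step A (h + n)) as HS.
      replace (INR (S (h + n)) * INR (fact (h + n)) * INR (S (S (h + n))) ^ A)%R
        with (INR (fact (h + n)) * (INR (S (h + n)) * INR (S (S (h + n))) ^ A))%R by ring.
      rewrite Rmult_assoc. apply Rmult_le_compat_l; [apply pos_INR|exact HS].
Qed.

Lemma poch_bound A n z :
  (Cmod z <= INR A)%R -> (Cmod (poch z n) <= INR (fact n) * INR (S n) ^ A)%R.
Proof.
  intros Hz. pose proof (poch_shift_bound A 0 n z Hz) as H. simpl INR in H at 1.
  rewrite Cplus_0_r, Rmult_1_l in H. exact H.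
Qed.

Lemma fact_shift_le M j : (INR (fact (M + j)) <= INR (fact j) * INR (S (M + j)) ^ M)%R.
Proof.
  induction M as [|M IH]; [simpl; lra|].
  change (S M + j)%nat with (S (M + j)). rewrite fact_simpl, mult_INR.
  apply Rle_trans with (INR (S (M + j)) * (INR (fact j) * INR (S (M + j)) ^ M))%R.
  - apply Rmult_le_compat_l; [apply pos_INR|exact IH].
  - change (INR (S (S (M + j))) ^ S M)%R
      with (INR (S (S (M + j))) * INR (S (S (M + j))) ^ M)%R.
    assert (H1 : (INR (S (M + j)) <= INR (S (S (M + j))))%R) by (apply le_INR; lia).
    assert (H2 : (INR (S (M + j)) ^ M <= INR (S (S (M + j))) ^ M)%R).
    { apply pow_incr. split; [apply pos_INR|exact H1]. }
    apply Rle_trans with (INR (S (S (M + j))) * (INR (fact j) * INR (S (S (M + j))) ^ M))%R.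
    + apply Rmult_le_compat; [apply pos_INR| |exact H1|].
      * apply Rmult_le_pos; [apply pos_INR|apply pow_le, pos_INR].
      * apply Rmult_le_compat_l; [apply pos_INR|exact H2].
    + apply Req_le. ring.
Qed.

(** Beyond the index [M = A + 1] every factor of [poch (z + M) j] has modulus at
    least that of the corresponding factor of [j!]. *)
Lemma rGamma_shift_bound A :
  exists K B, (0 <= K)%R /\ forall n z, (Cmod z <= INR A)%R ->
    (Cmod (rGamma (z + INR n)) * INR (fact n) <= K * INR (S n) ^ B)%R.
Proof.
  set (M := S A).
  destruct (approx_bounded 0 (INR A + INR M) rGamma (entire_rGamma 0 _)) as [K [HK HKb]].
  assert (HKs : forall m z, (m <= M)%nat -> (Cmod z <= INR A)%R ->
            (Cmod (rGamma (z + INR m)) <= K)%R).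
  { intros m z Hm Hz. apply HKb. replace (z + INR m - 0) with (z + INR m) by ring.
    eapply Rle_trans; [apply Cmod_triangle|]. rewrite Cmod_INR.
    apply le_INR in Hm. lra. }
  assert (Hfm : forall n, (1 <= INR (fact n))%R).
  { intros n. apply (le_INR 1), lt_O_fact. }
  exists (K * INR (fact M))%R, M. split.
  { apply Rmult_le_pos; [exact HK|apply pos_INR]. }
  intros n z Hz.
  destruct (Nat.le_gt_cases M n) as [HMn|HMn].
  - destruct (Nat.le_exists_sub M n HMn) as [j [-> _]].
    assert (Hlow : (INR (fact j) <= Cmod (poch (z + INR M) j))%R).
    { clear HMn. induction j as [|j IH]; [simpl; rewrite Cmod_1; lra|].
      rewrite fact_simpl, mult_INR, Rmult_comm, poch_S, Cmod_mult.
      apply Rmult_le_compat; [apply pos_INR|apply pos_INR|exact IH|].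
      pose proof (Cmod_triangle_minus (z + INR M + INR j) z) as HT.
      replace (z + INR M + INR j - z) with (RtoC (INR M + INR j)) in HT
        by (rewrite RtoC_plus; ring).
      rewrite Cmod_R, Rabs_pos_eq in HT
        by (apply Rplus_le_le_0_compat; apply pos_INR).
      unfold M in HT at 1. rewrite S_INR in *. lra. }
    pose proof (rGamma_poch (z + INR M) j) as E.
    replace (z + INR M + INR j) with (z + INR (j + M)) in E
      by (rewrite plus_INR, RtoC_plus; ring).
    apply (f_equal Cmod) in E. rewrite Cmod_mult in E.
    assert (H1 : (INR (fact j) * Cmod (rGamma (z + INR (j + M))) <= K)%R).
    { eapply Rle_trans; [|apply (HKs M z (Nat.le_refl _) Hz)]. rewrite E.
      apply Rmult_le_compat_r; [apply Cmod_ge_0|exact Hlow]. }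
    pose proof (fact_shift_le M j) as HF. rewrite (Nat.add_comm M j) in HF.
    apply Rle_trans with
      (Cmod (rGamma (z + INR (j + M))) * (INR (fact j) * INR (S (j + M)) ^ M))%R.
    { apply Rmult_le_compat_l; [apply Cmod_ge_0|exact HF]. }
    rewrite <- Rmult_assoc. apply Rmult_le_compat_r; [apply pow_le, pos_INR|].
    rewrite Rmult_comm. specialize (Hfm M). nra.
  - apply Rle_trans with (K * INR (fact M) * 1)%R.
    + rewrite Rmult_1_r. apply Rmult_le_compat; [apply Cmod_ge_0|apply pos_INR| |].
      * apply HKs; [lia|exact Hz].
      * apply le_INR, fact_le. lia.
    + apply Rmult_le_compat_l; [apply Rmult_le_pos; [exact HK|apply pos_INR]|].
      apply pow_R1_Rle, (le_INR 1). lia.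
Qed.

Lemma nat_above (x : R) : exists A : nat, (x <= INR A)%R.
Proof.
  destruct (nfloor_ex (Rmax 0 x) (Rmax_l 0 x)) as [A [_ H]].
  exists (S A). rewrite S_INR. pose proof (Rmax_r 0 x). lra.
Qed.

(** * Gegenbauer polynomials *)

Fixpoint geg_pair (nu x : R) (n : nat) : R * R :=
  match n with
  | O => (1, 2 * nu * x)%R
  | S m =>
      let p := geg_pair nu x m in
      (snd p,
       (2 * (INR m + 1 + nu) * x * snd p - (INR m + 2 * nu) * fst p) / (INR m + 2))%R
  end.

(** The recurrence is taken as the definition because the hypergeometric form, the
    generating function and the connection formula are all verified through it. *)
Definition geg (nu x : R) (n : nat) : R := fst (geg_pair nu x n).

Lemma geg_0 nu x : geg nu x 0 = 1%R.
Proof. reflexivity. Qed.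

Lemma geg_1 nu x : geg nu x 1 = (2 * nu * x)%R.
Proof. reflexivity. Qed.

Lemma geg_SS nu x n :
  ((INR n + 2) * geg nu x (S (S n))
   = 2 * (INR n + 1 + nu) * x * geg nu x (S n) - (INR n + 2 * nu) * geg nu x n)%R.
Proof.
  unfold geg. simpl. pose proof (pos_INR n). field. lra.
Qed.

Lemma geg_unique nu x (u : nat -> R) :
  u O = 1%R -> u 1%nat = (2 * nu * x)%R ->
  (forall n, (INR n + 2) * u (S (S n))
     = 2 * (INR n + 1 + nu) * x * u (S n) - (INR n + 2 * nu) * u n)%R ->
  forall n, u n = geg nu x n.
Proof.
  intros H0 H1 HS.
  assert (H : forall n, u n = geg nu x n /\ u (S n) = geg nu x (S n)).
  { induction n as [|n [IH1 IH2]]; [split; assumption|].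
    split; [exact IH2|]. pose proof (pos_INR n).
    apply (Rmult_eq_reg_l (INR n + 2)); [|lra].
    rewrite HS, geg_SS, IH1, IH2. reflexivity. }
  intros n. apply H.
Qed.

Lemma geg_up nu x n :
  (2 * (INR (S n) + nu) * x * geg nu x (S n)
   = (INR (S n) + 1) * geg nu x (S (S n)) + (INR (S n) + 2 * nu - 1) * geg nu x n)%R.
Proof.
  pose proof (geg_SS nu x n). rewrite S_INR.
  replace (INR n + 1 + 1)%R with (INR n + 2)%R by ring. rewrite H. ring.
Qed.

(** Coefficient of [((1-x)/2)^j] in the hypergeometric form of the [n]-th
    polynomial. *)
Definition geg_coef (nu : R) (n j : nat) : C :=
  poch (2 * nu) n / INR (fact n)
  * (poch (- INR n) j * poch (INR n + 2 * nu) j / (poch (nu + 1 / 2) j * INR (fact j))).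

Lemma half_poch_neq nu j : (-1 / 2 < nu)%R -> poch (nu + 1 / 2) j <> 0.
Proof.
  intros H. replace (nu + 1 / 2) with (RtoC (nu + 1 / 2))
    by (rewrite RtoC_plus, RtoC_div by lra; reflexivity).
  rewrite RtoC_poch. apply RtoC_neq, Rgt_not_eq, rpoch_pos. lra.
Qed.

Lemma geg_coef_shift nu n j :
  (-1 / 2 < nu)%R ->
  geg_coef nu n j
  = poch (2 * nu) (n + j) * poch (- INR n) j
    / (INR (fact n) * poch (nu + 1 / 2) j * INR (fact j)).
Proof.
  intros H. unfold geg_coef. rewrite poch_add, (Cplus_comm (INR n)). field.
  repeat split; try apply INR_fact_neq. apply half_poch_neq, H.
Qed.

Lemma poch_neg_shift (m : nat) j :
  poch (- INR m) j
  = poch (- INR (S m)) j * (INR m + 1 - INR j) / INR (S m).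
Proof.
  pose proof (poch_Sl (- INR (S m)) j) as H. rewrite poch_S in H.
  replace (- INR (S m) + 1) with (- INR m) in H by (rewrite INR_S_C; ring).
  pose proof (INR_S_neq m) as Hm.
  replace (poch (- INR m) j) with (- (- INR (S m) * poch (- INR m) j) / INR (S m))
    by (field; exact Hm).
  rewrite <- H, INR_S_C. field. rewrite <- INR_S_C. exact Hm.
Qed.

Lemma poch_neg_vanish m j : (m < j)%nat -> poch (- INR m) j = 0.
Proof.
  intros Hj. destruct (Nat.le_exists_sub (S m) j Hj) as [k [-> _]].
  rewrite (Nat.add_comm k), poch_add, poch_S.
  replace (- INR m + INR m) with (RtoC 0) by ring. ring.
Qed.

Lemma geg_coef_rec nu n j :
  (-1 / 2 < nu)%R ->
  (INR n + 2) * geg_coef nu (S (S n)) j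
  = 2 * (INR n + 1 + nu)
      * (geg_coef nu (S n) j - 2 * shift_seq (geg_coef nu (S n)) j)
    - (INR n + 2 * nu) * geg_coef nu n j.
Proof.
  intros H. pose proof (INR_fact_neq n) as Hf. pose proof (INR_fact_neq j) as Hfj.
  pose proof (INR_S_neq n) as H1. pose proof (INR_S_neq (S n)) as H2.
  destruct j as [|j].
  - simpl shift_seq. rewrite !geg_coef_shift by exact H.
    rewrite !Nat.add_0_r, !poch_S, !fact_simpl, !mult_INR, !RtoC_mult.
    rewrite !INR_S_C in *. simpl poch. simpl INR. simpl fact. 
    field. repeat split; assumption.
  - simpl shift_seq. rewrite !geg_coef_shift by exact H.
    pose proof (half_poch_neq nu (S j) H) as Hp. rewrite poch_S in Hp.
    pose proof (INR_fact_neq j) as Hj. pose proof (INR_S_neq j) as Hj1.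
    rewrite (poch_neg_shift n (S j)), (poch_neg_shift (S n) (S j)).
    rewrite (poch_Sl (- INR (S (S n))) j).
    replace (- INR (S (S n)) + 1) with (- INR (S n)) by (rewrite (INR_S_C (S n)); ring).
    replace (S (S n) + S j)%nat with (S (S (S (n + j)))) by lia.
    replace (S n + S j)%nat with (S (S (n + j))) by lia.
    replace (n + S j)%nat with (S (n + j)) by lia.
    replace (S n + j)%nat with (S (n + j)) by lia.
    rewrite !(poch_S (2 * nu)), (poch_S (nu + 1 / 2)), !fact_simpl, !mult_INR, !RtoC_mult.
    rewrite !INR_S_C in *. rewrite plus_INR, RtoC_plus.
    assert (Hp1 : poch (nu + 1 / 2) j <> 0) by (apply half_poch_neq, H).
    assert (Hp2 : nu + 1 / 2 + INR j <> 0).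
    { intros h. apply Hp. rewrite h. ring. }
    field. repeat split; try assumption.
    intros h. apply Hp2. replace (nu + 1 / 2 + INR j) with ((nu * 2 + 1 + INR j * 2) / 2)
      by field. rewrite h. field.
Qed.

Lemma geg_coef_series nu (x : R) n :
  (-1 / 2 < nu)%R ->
  is_series (fun j => geg_coef nu n j * ((1 - x) / 2) ^ j) (RtoC (geg nu x n)).
Proof.
  intros H. set (y := (1 - x) / 2).
  assert (Hfin : forall m, is_series (fun j => geg_coef nu m j * y ^ j)
             (Csum (fun j => geg_coef nu m j * y ^ j) m)).
  { intros m. apply is_series_finite. intros k Hk. unfold geg_coef.
    rewrite (poch_neg_vanish m k Hk). unfold Cdiv. ring. }
  assert (Hall : is_series (fun j => geg_coef nu n j * y ^ j) (RtoC (geg nu x n)) /\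
                 is_series (fun j => geg_coef nu (S n) j * y ^ j) (RtoC (geg nu x (S n)))).
  { induction n as [|n [IH1 IH2]].
    - split.
      + assert (E : Csum (fun j => geg_coef nu 0 j * y ^ j) 0 = geg nu x 0).
        { rewrite Csum_0. unfold geg_coef. simpl. rewrite geg_0. field. }
        rewrite <- E. apply (Hfin O).
      + assert (E : Csum (fun j => geg_coef nu 1 j * y ^ j) 1 = geg nu x 1).
        { rewrite Csum_S, Csum_0. unfold geg_coef, y. simpl. rewrite geg_1, !RtoC_mult.
          assert (Hn : nu + 1 / 2 <> 0).
          { pose proof (half_poch_neq nu 1 H) as h. simpl in h. intros h0. apply h.
            replace (nu + 1 / 2 + 0) with (nu + 1 / 2) by ring. rewrite h0. ring. }
          field. repeat split; try exact C1_nz.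
          intros h. apply Hn. replace (nu + 1 / 2) with ((nu * 2 + 1) / 2) by field.
          rewrite h. field. }
        rewrite <- E. apply (Hfin 1%nat).
    - split; [exact IH2|].
      assert (Hn2 : INR n + 2 <> 0).
      { intros h. apply (INR_S_neq (S n)). rewrite !INR_S_C, <- h. ring. }
      assert (E : RtoC (geg nu x (S (S n)))
        = / (INR n + 2) * (2 * (INR n + 1 + nu) * (geg nu x (S n) + - (2) * y * geg nu x (S n))
              + - (INR n + 2 * nu) * geg nu x n)).
      { replace (geg nu x (S (S n)))
          with ((2 * (INR n + 1 + nu) * x * geg nu x (S n) - (INR n + 2 * nu) * geg nu x n)
                / (INR n + 2))%R
          by (rewrite <- geg_SS; field; pose proof (pos_INR n); lra).
        rewrite RtoC_div by (pose proof (pos_INR n); lra).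
        rewrite RtoC_minus, !RtoC_mult, !RtoC_plus, !RtoC_mult. unfold y. field. exact Hn2. }
      rewrite E.
      eapply is_series_C_ext.
      2:{ apply is_series_Cmult, is_series_Cplus; [apply is_series_Cmult, is_series_Cplus|].
          - exact IH2.
          - apply is_series_Cmult, is_series_shift, IH2.
          - apply is_series_Cmult, IH1. }
      intros j. simpl. apply (Cmult_cancel_l (INR n + 2)); [exact Hn2|].
      rewrite (Cmult_assoc (INR n + 2) (geg_coef nu (S (S n)) j)), geg_coef_rec by exact H.
      rewrite Cmult_assoc, Cinv_r, Cmult_1_l by exact Hn2.
      destruct j as [|j]; cbn [shift_seq Cpow]; ring. }
  apply Hall.
Qed.

Lemma Gegenbauer_geg nu (x : R) n :
  (-1 / 2 < nu)%R -> Gegenbauer n nu x = geg nu x n.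
Proof.
  intros H. set (y := (1 - x) / 2).
  set (t := fun j => poch (- INR n) j * poch (INR n + 2 * nu) j
                 / (poch (nu + 1 / 2) j * INR (fact j)) * y ^ j).
  assert (Ht : is_series t (Csum t n)).
  { apply is_series_finite. intros k Hk. unfold t. rewrite poch_neg_vanish by exact Hk.
    unfold Cdiv. ring. }
  unfold Gegenbauer, pFq. fold y.
  rewrite (CSeries_eq _ (Csum t n)).
  - symmetry. apply (is_series_C_unique _ _ _ (geg_coef_series nu x n H)).
    eapply is_series_C_ext; [|apply is_series_Cmult, Ht].
    intros j. unfold geg_coef, t. fold y. unfold Cdiv. ring.
  - eapply is_series_C_ext; [|exact Ht]. intros j. unfold t. simpl. field.
    split; [apply INR_fact_neq|]. apply half_poch_neq, H.
Qed.

(** [geg nu x n] is the coefficient of [r^n] in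
    [(1 - al r)^(-nu) (1 - be r)^(-nu)] where [al, be] are the two unimodular
    numbers with sum [2 x] and product [1]. *)
Lemma geg_convolution nu (x : R) (al be : C) n :
  al + be = 2 * x -> al * be = 1 ->
  RtoC (geg nu x n)
  = Csum (fun k => poch nu k / INR (fact k) * al ^ k
                   * (poch nu (n - k) / INR (fact (n - k)) * be ^ (n - k))) n.
Proof.
  intros Hs Hp.
  set (P := fun (a : C) k => poch nu k / INR (fact k) * a ^ k).
  assert (HPS : forall a k, INR (S k) * P a (S k) = a * ((nu + INR k) * P a k)).
  { intros a k. unfold P. rewrite poch_S, fact_simpl, mult_INR, RtoC_mult, Cpow_S. field.
    split; [apply INR_fact_neq|apply INR_S_neq]. }
  set (S0 := fun n => Csum (fun k => P al k * P be (n - k)%nat) n).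
  set (S1 := fun n => Csum (fun k => INR k * (P al k * P be (n - k)%nat)) n).
  set (S2 := fun n => Csum (fun k => INR (n - k) * (P al k * P be (n - k)%nat)) n).
  (* logarithmic derivatives of the two factors, coefficientwise *)
  assert (H1 : forall n, S1 (S n) = al * (nu * S0 n + S1 n)).
  { intros m. unfold S1, S0. rewrite Csum_Sl. simpl INR at 1.
    rewrite Cmult_0_l, Cplus_0_l, <- Csum_scal, <- Csum_plus, <- Csum_scal.
    apply Csum_ext. intros k _. replace (S m - S k)%nat with (m - k)%nat by lia.
    rewrite Cmult_assoc, HPS. ring. }
  assert (H2 : forall n, S2 (S n) = be * (nu * S0 n + S2 n)).
  { intros m. unfold S2, S0. rewrite Csum_S, Nat.sub_diag. simpl INR at 2.
    rewrite Cmult_0_l, Cplus_0_r, <- Csum_scal, <- Csum_plus, <- Csum_scal.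
    apply Csum_ext. intros k Hk. replace (S m - k)%nat with (S (m - k)) by lia.
    replace (INR (S (m - k)) * (P al k * P be (S (m - k))))
      with (P al k * (INR (S (m - k)) * P be (S (m - k)))) by ring.
    rewrite HPS. ring. }
  assert (H0 : forall n, INR n * S0 n = S1 n + S2 n).
  { intros m. unfold S0, S1, S2. rewrite <- Csum_plus, <- Csum_scal.
    apply Csum_ext. intros k Hk. rewrite minus_INR by exact Hk. rewrite RtoC_minus. ring. }
  assert (Hrec : forall n, (INR n + 2) * S0 (S (S n))
     = 2 * (INR n + 1 + nu) * x * S0 (S n) - (INR n + 2 * nu) * S0 n).
  { intros m. replace (INR m + 2) with (RtoC (INR (S (S m)))) by (rewrite !INR_S_C; ring).
    rewrite H0, (H1 (S m)), (H2 (S m)).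
    replace (2 * (INR m + 1 + nu) * x * S0 (S m))
      with ((al + be) * (nu * S0 (S m) + INR (S m) * S0 (S m)))
      by (rewrite Hs, INR_S_C; ring).
    rewrite H0.
    replace ((INR m + 2 * nu) * S0 m) with (al * S2 (S m) + be * S1 (S m)).
    { ring. }
    rewrite H1, H2.
    replace (al * (be * (nu * S0 m + S2 m)) + be * (al * (nu * S0 m + S1 m)))
      with (al * be * (2 * nu * S0 m + (S1 m + S2 m))) by ring.
    rewrite Hp, <- H0. ring. }
  assert (E0 : S0 O = 1).
  { unfold S0, P. rewrite Csum_0. simpl. field. }
  assert (E1 : S0 1%nat = 2 * nu * x).
  { unfold S0, P. rewrite Csum_S, Csum_0. simpl.
    transitivity (nu * (al + be)); [field|]. rewrite Hs. ring. }
  assert (Hall : forall n, RtoC (geg nu x n) = S0 n /\ RtoC (geg nu x (S n)) = S0 (S n)).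
  { induction n0 as [|m [IH1 IH2]].
    - rewrite E0, E1, geg_0, geg_1, !RtoC_mult. split; reflexivity.
    - split; [exact IH2|]. 
      assert (Hn2 : INR m + 2 <> 0).
      { intros h. apply (INR_S_neq (S m)). rewrite !INR_S_C, <- h. ring. }
      apply (Cmult_cancel_l (INR m + 2)); [exact Hn2|].
      rewrite Hrec, <- IH1, <- IH2, <- RtoC_plus, <- RtoC_mult, geg_SS.
      rewrite RtoC_minus, !RtoC_mult, !RtoC_plus, RtoC_mult. ring. }
  apply Hall.
Qed.

(** The moduli of [al^k] and [be^k] are one, and the two Pochhammer quotients grow
    polynomially; this is uniform up to [x = 1] and [x = -1]. *)
Lemma geg_bound A nu x n :
  (Rabs nu <= INR A)%R -> (-1 <= x <= 1)%R ->
  (Rabs (geg nu x n) <= INR (S n) ^ S (A + A))%R.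
Proof.
  intros Hnu Hx.
  set (s := sqrt (1 - x ^ 2)).
  assert (Hx2 : (0 <= 1 - x ^ 2)%R) by nra.
  assert (Hss : (s * s = 1 - x ^ 2)%R) by (apply sqrt_sqrt; exact Hx2).
  assert (Hm : forall e, (e * e = 1)%R -> Cmod (x, (e * s)%R) = 1%R).
  { intros e He. unfold Cmod. simpl fst; simpl snd.
    replace (x ^ 2 + (e * s) ^ 2)%R with 1%R; [apply sqrt_1|].
    replace ((e * s) ^ 2)%R with (e * e * (s * s))%R by ring. rewrite He, Hss. ring. }
  rewrite <- Cmod_R, (geg_convolution nu x (x, (1 * s)%R) (x, (-1 * s)%R)).
  - change (INR (S n) ^ S (A + A))%R with (INR (S n) * INR (S n) ^ (A + A))%R.
    apply Cmod_Csum_le. intros k Hk.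
    assert (HP : forall j, (j <= n)%nat ->
              (Cmod (poch nu j / INR (fact j)) <= INR (S n) ^ A)%R).
    { intros j Hj. rewrite Cmod_div by apply INR_fact_neq. rewrite Cmod_INR.
      pose proof (INR_fact_lt_0 j) as Hf.
      apply Rle_div_l; [exact Hf|]. rewrite Rmult_comm.
      eapply Rle_trans; [apply (poch_bound A); rewrite Cmod_R; exact Hnu|].
      apply Rmult_le_compat_l; [lra|]. apply pow_incr. split; [apply pos_INR|].
      apply le_INR. lia. }
    pose proof (HP k Hk) as P1. pose proof (HP (n - k)%nat ltac:(lia)) as P2.
    revert P1 P2. generalize (poch nu k / INR (fact k)).
    generalize (poch nu (n - k) / INR (fact (n - k))). intros q p P1 P2.
    rewrite !Cmod_mult, !Cmod_pow, !Hm, !pow1, !Rmult_1_r, pow_add by ring.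
    apply Rmult_le_compat; try apply Cmod_ge_0; assumption.
  - apply injective_projections; simpl; ring.
  - apply injective_projections; simpl; nra.
Qed.

(** Polynomials of negative degree are set to zero: the three-term recurrence then
    holds at every index, and sums over [k] need no boundary terms. *)
Definition geg_down (nu x : R) (N k : nat) : R :=
  if Nat.leb (2 * k) N then geg nu x (N - 2 * k) else 0%R.

(** Coefficient of [C_(p-k)^nu] in [C_(p+k)^mu], without its factor [nu + p - k]. *)
Definition conn (mu nu : R) (p k : nat) : R :=
  (rpoch mu p * rpoch (mu - nu) k / (rpoch nu (S p) * INR (fact k)))%R.

Lemma rpoch_neq nu p : (-1 / 2 < nu)%R -> nu <> 0%R -> rpoch nu p <> 0%R.
Proof.
  intros H H0. induction p as [|p IH]; simpl; [lra|].
  apply Rmult_integral_contrapositive_currified; [exact IH|].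
  destruct p; simpl INR; [lra|]. pose proof (pos_INR p). 
  destruct p; simpl in *; lra.
Qed.

Lemma geg_down_up nu x N k :
  (2 * (INR N - 2 * INR k + nu) * x * geg_down nu x N k
   = (INR N - 2 * INR k + 1) * geg_down nu x (S N) k
     + (INR N - 2 * INR k + 2 * nu - 1) * geg_down nu x (S N) (S k))%R.
Proof.
  unfold geg_down.
  destruct (Nat.leb_spec (2 * k) N) as [H1|H1].
  - destruct (Nat.le_exists_sub (2 * k) N H1) as [n [-> _]].
    replace (n + 2 * k - 2 * k)%nat with n by lia.
    replace (INR (n + 2 * k) - 2 * INR k)%R with (INR n)
      by (rewrite plus_INR, mult_INR; simpl (INR 2); ring).
    destruct (Nat.leb_spec (2 * k) (S (n + 2 * k))); [|lia].
    replace (S (n + 2 * k) - 2 * k)%nat with (S n) by lia.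
    destruct (Nat.leb_spec (2 * S k) (S (n + 2 * k))) as [H3|H3].
    + destruct n as [|n]; [lia|].
      replace (S (S n + 2 * k) - 2 * S k)%nat with n by lia. apply geg_up.
    + destruct n as [|n]; [|lia]. rewrite geg_0, geg_1. simpl INR. ring.
  - destruct (Nat.leb_spec (2 * S k) (S N)); [lia|].
    destruct (Nat.leb_spec (2 * k) (S N)) as [H2|H2]; [|ring].
    (* here [2 k = N + 1], and the coefficient vanishes *)
    replace (INR N - 2 * INR k + 1)%R with 0%R; [ring|].
    assert (HN : (S N = 2 * k)%nat) by lia. apply (f_equal INR) in HN.
    rewrite S_INR, mult_INR in HN. simpl (INR 2) in HN. lra.
Qed.

Lemma geg_down_SS nu x N k : geg_down nu x (S (S N)) (S k) = geg_down nu x N k.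
Proof.
  unfold geg_down. replace (S (S N) - 2 * S k)%nat with (N - 2 * k)%nat by lia.
  destruct (Nat.leb_spec (2 * S k) (S (S N))); destruct (Nat.leb_spec (2 * k) N);
    lia || reflexivity.
Qed.

Lemma conn_rec mu nu N k :
  (-1 / 2 < nu)%R -> nu <> 0%R -> (2 * k <= N)%nat ->
  ((INR N + 2) * ((nu + INR N - 2 * INR k) * conn mu nu (S N - k) (S k))
   = (INR N + 1 + mu)
       * ((INR N - 2 * INR k) * conn mu nu (N - k) (S k)
          + (INR N - 2 * INR k + 2 * nu) * conn mu nu (S N - k) k)
     - (INR N + 2 * mu) * ((nu + INR N - 2 * INR k) * conn mu nu (N - k) k))%R.
Proof.
  intros H H0 Hk.
  destruct (Nat.le_exists_sub k N ltac:(lia)) as [p [-> _]].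
  replace (S (p + k) - k)%nat with (S p) by lia.
  replace (p + k - k)%nat with p by lia.
  unfold conn. rewrite !rpoch_S, !fact_simpl, !mult_INR, plus_INR, !S_INR.
  pose proof (rpoch_neq nu p H H0) as Hp.
  pose proof (rpoch_neq nu (S p) H H0) as Hp1. pose proof (rpoch_neq nu (S (S p)) H H0) as Hp2.
  rewrite rpoch_S in Hp1. rewrite !rpoch_S in Hp2. rewrite S_INR in Hp2.
  assert (nu + INR p <> 0)%R by (intros h; apply Hp1; rewrite h; ring).
  assert (nu + (INR p + 1) <> 0)%R by (intros h; apply Hp2; rewrite h; ring).
  pose proof (INR_fact_neq_0 k). pose proof (pos_INR k).
  field. repeat split; try assumption; lra.
Qed.

(** Connection coefficients between Gegenbauer polynomials of two parameters: the
    right-hand side obeys the recurrence in [N] of the left-hand side. *)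
Lemma geg_connection mu nu x :
  (-1 / 2 < nu)%R -> nu <> 0%R ->
  forall N, geg mu x N
    = Rsum (fun k => (nu + INR N - 2 * INR k) * conn mu nu (N - k) k
                     * geg_down nu x N k)%R N.
Proof.
  intros H H0.
  set (f := fun N k => ((nu + INR N - 2 * INR k) * conn mu nu (N - k) k
                        * geg_down nu x N k)%R).
  assert (Hext : forall N M, (N <= M)%nat -> Rsum (f N) M = Rsum (f N) N).
  { intros N M HM. induction HM as [|M HM IH]; [reflexivity|].
    rewrite Rsum_S, IH. unfold f at 2, geg_down.
    destruct (Nat.leb_spec (2 * S M) N); [lia|]. ring. }
  intros N. symmetry. revert N.
  pose proof (rpoch_neq nu 1 H H0) as Hn1. pose proof (rpoch_neq nu 2 H H0) as Hn2.
  simpl in Hn1, Hn2.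
  assert (Hnu1 : (nu + 1 <> 0)%R) by lra.
  apply geg_unique.
  - rewrite Rsum_0. unfold conn, geg_down. simpl. rewrite geg_0. field. exact H0.
  - rewrite Rsum_S, Rsum_0. unfold conn, geg_down. simpl. rewrite geg_1. field.
    split; assumption.
  - intros N. 
    fold (f N) (f (S N)) (f (S (S N))).
    rewrite <- (Hext N (S N)), <- (Hext (S N) (S (S N))) by lia.
    rewrite (Rsum_Sl (f (S (S N)))).
    assert (E1 : (2 * (INR N + 1 + mu) * x * Rsum (f (S N)) (S (S N))
       = (INR N + 1 + mu) *
         ((INR N + 2) * conn mu nu (S N) 0 * geg_down nu x (S (S N)) 0
          + Rsum (fun k => ((INR N - 2 * INR k) * conn mu nu (N - k) (S k)
          + (INR N - 2 * INR k + 2 * nu) * conn mu nu (S N - k) k)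
             * geg_down nu x (S (S N)) (S k))%R (S N)))%R).
    { replace (2 * (INR N + 1 + mu) * x * Rsum (f (S N)) (S (S N)))%R
        with ((INR N + 1 + mu) * (2 * x * Rsum (f (S N)) (S (S N))))%R by ring.
      f_equal. rewrite <- Rsum_scal.
      rewrite (Rsum_ext _ (fun k =>
        ((INR N - 2 * INR k + 2) * conn mu nu (S N - k) k * geg_down nu x (S (S N)) k
        + (INR N - 2 * INR k + 2 * nu) * conn mu nu (S N - k) k
            * geg_down nu x (S (S N)) (S k))%R)).
      2:{ intros k _. unfold f.
          pose proof (geg_down_up nu x (S N) k) as HU. rewrite S_INR in *.
          replace (2 * x * ((nu + (INR N + 1) - 2 * INR k) * conn mu nu (S N - k) k
                     * geg_down nu x (S N) k))%R
            with (conn mu nu (S N - k) k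
                    * (2 * (INR N + 1 - 2 * INR k + nu) * x * geg_down nu x (S N) k))%R by ring.
          rewrite HU. ring. }
      rewrite Rsum_plus.
      match goal with |- (Rsum ?a _ + Rsum ?b _)%R = _ =>
        rewrite (Rsum_Sl a), (Rsum_S b) end.
      assert (Hz : geg_down nu x (S (S N)) (S (S (S N))) = 0%R).
      { unfold geg_down. destruct (Nat.leb_spec (2 * S (S (S N))) (S (S N))); [lia|reflexivity]. }
      rewrite Hz, (Rmult_0_r (_ * _)), Rplus_0_r, Rplus_assoc, <- Rsum_plus.
      simpl (INR 0). f_equal; [simpl Nat.sub; ring|].
      apply Rsum_ext. intros k _. rewrite S_INR. simpl Nat.sub. ring. }
    rewrite E1, Rmult_plus_distr_l.
    replace ((INR N + 2) * f (S (S N)) 0%nat)%R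
      with ((INR N + 1 + mu) * ((INR N + 2) * conn mu nu (S N) 0
                * geg_down nu x (S (S N)) 0))%R.
    2:{ unfold f. simpl Nat.sub. simpl (INR 0). unfold conn. simpl (rpoch (mu - nu) 0).
        rewrite !rpoch_S, !S_INR.
        assert (G1 : (rpoch nu N <> 0)%R) by (apply rpoch_neq; assumption).
        pose proof (rpoch_neq nu (S (S (S N))) H H0) as G2. rewrite !rpoch_S, !S_INR in G2.
        assert (nu + INR N <> 0)%R by (intros h; apply G2; rewrite h; ring).
        assert (nu + (INR N + 1) <> 0)%R by (intros h; apply G2; rewrite h; ring).
        assert (nu + (INR N + 1 + 1) <> 0)%R by (intros h; apply G2; rewrite h; ring).
        simpl (INR (fact 0)). field. repeat split; assumption. }
    rewrite Rmult_plus_distr_l.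
    match goal with |- (?a + ?b = ?a + ?c - ?m * ?e)%R =>
      enough (b = c + - m * e)%R by lra end.
    rewrite <- !Rsum_scal, <- Rsum_plus.
    apply Rsum_ext. intros k _. unfold f. rewrite geg_down_SS.
    destruct (Nat.le_gt_cases (2 * k) N) as [Hk|Hk].
    + pose proof (conn_rec mu nu N k H H0 Hk) as HC.
      replace (S (S N) - S k)%nat with (S N - k)%nat by lia.
      transitivity ((INR N + 2) * ((nu + INR N - 2 * INR k) * conn mu nu (S N - k) (S k))
                      * geg_down nu x N k)%R.
      * rewrite !S_INR. ring.
      * rewrite HC. ring.
    + unfold geg_down. destruct (Nat.leb_spec (2 * k) N); [lia|]. ring.
Qed.

(** * The product formula for positive real parameters *)

(** Coefficient of [t^m] in [0F1(c; t)]. *)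
Definition coef0F1 (c : R) (m : nat) : R := (/ (rpoch c m * INR (fact m)))%R.

Lemma coef0F1_S c m :
  (0 < c)%R -> (INR (S m) * (c + INR m) * coef0F1 c (S m) = coef0F1 c m)%R.
Proof.
  intros Hc. unfold coef0F1. rewrite rpoch_S, fact_simpl, mult_INR.
  pose proof (rpoch_pos c m Hc). pose proof (INR_fact_lt_0 m). pose proof (pos_INR m).
  pose proof (lt_0_INR (S m) ltac:(lia)).
  field. repeat split; lra.
Qed.

(** Degree-[N] homogeneous part of [0F1(c; u) 0F1(c; v)], with an extra weight
    [w m n] on the monomial [u^m v^n]. *)
Definition wsum (c u v : R) (w : R -> R -> R) (N : nat) : R :=
  Rsum (fun m => w (INR m) (INR (N - m))
                 * (coef0F1 c m * u ^ m * (coef0F1 c (N - m) * v ^ (N - m))))%R N.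

Definition hom (c u v : R) (N : nat) : R := wsum c u v (fun _ _ => 1%R) N.

Lemma wsum_ext c u v w w' N :
  (forall m n, (m + n)%R = INR N -> w m n = w' m n) ->
  wsum c u v w N = wsum c u v w' N.
Proof.
  intros H. apply Rsum_ext. intros m Hm. rewrite (H (INR m) (INR (N - m))); [reflexivity|].
  rewrite minus_INR by exact Hm. ring.
Qed.

Lemma wsum_plus c u v w w' N :
  (wsum c u v w N + wsum c u v w' N = wsum c u v (fun m n => w m n + w' m n) N)%R.
Proof.
  unfold wsum. rewrite <- Rsum_plus. apply Rsum_ext. intros; ring.
Qed.

Lemma wsum_scal c u v w k N :
  (k * wsum c u v w N = wsum c u v (fun m n => k * w m n) N)%R.
Proof.
  unfold wsum. rewrite <- Rsum_scal. apply Rsum_ext. intros; ring.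
Qed.

Lemma wsum_u c u v w N :
  (0 < c)%R ->
  (u * wsum c u v w N
   = wsum c u v (fun m n => m * (c + m - 1) * w (m - 1) n) (S N))%R.
Proof.
  intros Hc. unfold wsum. rewrite Rsum_Sl. simpl (INR 0).
  rewrite !Rmult_0_l, Rplus_0_l, <- Rsum_scal. apply Rsum_ext. intros m Hm.
  replace (S N - S m)%nat with (N - m)%nat by lia.
  rewrite <- (coef0F1_S c m Hc). rewrite S_INR. 
  replace (INR m + 1 - 1)%R with (INR m) by ring. simpl pow. ring.
Qed.

Lemma wsum_v c u v w N :
  (0 < c)%R ->
  (v * wsum c u v w N
   = wsum c u v (fun m n => n * (c + n - 1) * w m (n - 1)) (S N))%R.
Proof.
  intros Hc. unfold wsum. rewrite Rsum_S, Nat.sub_diag. simpl (INR 0).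
  rewrite !Rmult_0_l, Rplus_0_r, <- Rsum_scal. apply Rsum_ext. intros m Hm.
  replace (S N - m)%nat with (S (N - m)) by lia.
  rewrite <- (coef0F1_S c (N - m) Hc). rewrite S_INR.
  replace (INR (N - m) + 1 - 1)%R with (INR (N - m)) by ring. simpl pow. ring.
Qed.

(** Multiplication by [u] or [v] shifts the degree and multiplies the weight by
    [m (c + m - 1)] or [n (c + n - 1)], so the recurrence is an identity between
    polynomial weights. *)
Lemma hom_rec c u v n :
  (0 < c)%R ->
  ((INR n + 2) * (INR n + 2 * c) * (c + INR n + 1) * (c + INR n) * hom c u v (S (S n))
   = (2 * INR n + 2 * c + 1) * (c + INR n) * ((u + v) * hom c u v (S n))
     - (v - u) ^ 2 * hom c u v n)%R.
Proof.
  intros Hc. unfold hom.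
  replace ((v - u) ^ 2 * wsum c u v (fun _ _ => 1) n)%R
    with (v * (v * wsum c u v (fun _ _ => 1) n) + (-2) * (u * (v * wsum c u v (fun _ _ => 1) n))
          + u * (u * wsum c u v (fun _ _ => 1) n))%R by ring.
  rewrite (Rmult_plus_distr_r u v).
  rewrite !wsum_v, !wsum_u by exact Hc.
  match goal with |- (?l = ?a - ?b)%R => enough (l + (-1) * a + b = 0)%R by lra end.
  repeat rewrite ?wsum_plus, ?wsum_scal.
  rewrite (wsum_ext _ _ _ _ (fun _ _ => 0)%R).
  - unfold wsum. rewrite (Rsum_ext _ (fun _ => 0 * 0)%R) by (intros; ring).
    rewrite Rsum_scal. ring.
  - intros m k Hmk. rewrite !S_INR in Hmk.
    assert (E : INR n = (m + k - 2)%R) by lra. rewrite E. ring.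
Qed.

Lemma hom_geg mu u v n :
  (0 < mu)%R -> (0 < v - u)%R ->
  hom (mu + 1 / 2) u v n
  = ((v - u) ^ n * geg mu ((u + v) / (v - u)) n / (rpoch (2 * mu) n * rpoch (mu + 1 / 2) n))%R.
Proof.
  intros Hmu Hr. set (c := (mu + 1 / 2)%R). assert (Hc : (0 < c)%R) by (unfold c; lra).
  assert (Hp : forall n, (0 < rpoch (2 * mu) n * rpoch c n)%R).
  { intros m. apply Rmult_lt_0_compat; apply rpoch_pos; lra. }
  set (f := fun n => (hom c u v n * (rpoch (2 * mu) n * rpoch c n) / (v - u) ^ n)%R).
  assert (Hf : f n = geg mu ((u + v) / (v - u)) n).
  { apply geg_unique.
    - unfold f, hom, wsum. rewrite Rsum_0. unfold coef0F1. simpl. field.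
    - unfold f, hom, wsum. rewrite Rsum_S, Rsum_0. unfold coef0F1. simpl. unfold c. field. lra.
    - intros m. unfold f. rewrite !rpoch_S, !S_INR.
      pose proof (hom_rec c u v m Hc) as HR.
      assert (Hrm : ((v - u) ^ m <> 0)%R) by (apply pow_nonzero; lra).
      transitivity ((INR m + 2) * (INR m + 2 * c) * (c + INR m + 1) * (c + INR m)
          * hom c u v (S (S m)) * ((2 * mu + INR m) * (rpoch (2 * mu) m * rpoch c m))
          / (v - u) ^ (S (S m)))%R.
      + unfold c. simpl pow. field. split; [exact Hrm|lra].
      + rewrite HR. simpl pow. unfold c. field. split; [exact Hrm|lra]. }
  rewrite <- Hf. unfold f. specialize (Hp n).
  assert (Hrm : ((v - u) ^ n <> 0)%R) by (apply pow_nonzero; lra).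
  pose proof (rpoch_pos (2 * mu) n ltac:(lra)). pose proof (rpoch_pos c n ltac:(lra)).
  field. repeat split; try assumption; lra.
Qed.

(** For [u <= 0 <= v] the quotient [(u + v)/(v - u)] lies in [[-1, 1]]: this is where
    the cancellation between the monomials is used. *)
Lemma hom_bound A mu u v n :
  (1 <= mu)%R -> (mu <= INR A)%R -> (u <= 0)%R -> (0 <= v)%R ->
  (Rabs (hom (mu + 1 / 2) u v n) * INR (fact n) * INR (fact n)
    <= INR (S n) ^ S (A + A) * (v - u) ^ n)%R.
Proof.
  intros Hmu HA Hu Hv.
  destruct (Rle_lt_or_eq_dec 0 (v - u) ltac:(lra)) as [Hr|Hr].
  - rewrite hom_geg by lra.
    set (x := ((u + v) / (v - u))%R).
    assert (Hx : (-1 <= x <= 1)%R).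
    { unfold x. split; [apply Rle_div_r; lra|apply Rle_div_l; lra]. }
    assert (HG := geg_bound A mu x n ltac:(rewrite Rabs_pos_eq; lra) Hx).
    pose proof (rpoch_ge_fact (2 * mu) n ltac:(lra)) as P1.
    pose proof (rpoch_ge_fact (mu + 1 / 2) n ltac:(lra)) as P2.
    pose proof (INR_fact_lt_0 n) as Hf. pose proof (pow_lt _ n Hr) as Hp.
    assert (Hpp : (0 < rpoch (2 * mu) n * rpoch (mu + 1 / 2) n)%R).
    { apply Rmult_lt_0_compat; lra. }
    unfold Rdiv at 1. rewrite !Rabs_mult, Rabs_inv, (Rabs_pos_eq ((v - u) ^ n)) by lra.
    rewrite (Rabs_pos_eq (rpoch (2 * mu) n * rpoch (mu + 1 / 2) n)) by lra.
    assert (Hq : (/ (rpoch (2 * mu) n * rpoch (mu + 1 / 2) n) * INR (fact n) * INR (fact n) <= 1)%R).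
    { rewrite Rmult_assoc, Rmult_comm. apply Rle_div_l; [exact Hpp|]. rewrite Rmult_1_l.
      apply Rmult_le_compat; lra. }
    assert (Hq0 : (0 <= / (rpoch (2 * mu) n * rpoch (mu + 1 / 2) n) * INR (fact n) * INR (fact n))%R).
    { repeat apply Rmult_le_pos; try lra. apply Rlt_le, Rinv_0_lt_compat, Hpp. }
    pose proof (Rabs_pos (geg mu x n)) as H0.
    replace ((v - u) ^ n * Rabs (geg mu x n) * / (rpoch (2 * mu) n * rpoch (mu + 1 / 2) n)
              * INR (fact n) * INR (fact n))%R
      with (Rabs (geg mu x n) * (v - u) ^ n
              * (/ (rpoch (2 * mu) n * rpoch (mu + 1 / 2) n) * INR (fact n) * INR (fact n)))%R
      by ring.
    rewrite <- (Rmult_1_r (INR (S n) ^ S (A + A) * (v - u) ^ n)).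
    apply Rmult_le_compat; [apply Rmult_le_pos; lra|exact Hq0| |exact Hq].
    apply Rmult_le_compat_r; lra.
  - assert (u = 0%R) by lra. assert (v = 0%R) by lra. subst u v.
    rewrite Rminus_0_r.
    assert (E : hom (mu + 1 / 2) 0 0 n = if Nat.eqb n 0 then 1%R else 0%R).
    { unfold hom, wsum. destruct n as [|n].
      - rewrite Rsum_0. unfold coef0F1. simpl. field.
      - rewrite (Rsum_ext _ (fun _ => 0 * 0)%R).
        + rewrite Rsum_scal. simpl. ring.
        + intros m Hm. destruct m as [|m]; [simpl; ring|]. simpl pow. ring. }
    rewrite E. destruct n as [|n]; simpl Nat.eqb; cbv iota.
    + simpl. rewrite Rabs_R1. apply Req_le. rewrite pow1. ring.
    + rewrite Rabs_R0. simpl pow. lra.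
Qed.

(** Bailey's variables [u = X (1 - Y)], [v = Y (1 - X)] on the ray [X = - s] with [Y]
    fixed. *)
Definition ray_u (Y s : R) : R := (- s * (1 - Y))%R.
Definition ray_v (Y s : R) : R := (Y * (1 + s))%R.
Definition ray (c Y : R) (N : nat) (s : R) : R := hom c (ray_u Y s) (ray_v Y s) N.

(* [ray1] and [ray2] are the first two derivatives of [ray] in [s]. *)
Definition ray1 (c Y : R) (N : nat) (s : R) : R :=
  Rsum (fun m => coef0F1 c m * coef0F1 c (N - m) *
    (INR m * ray_u Y s ^ pred m * (- (1 - Y)) * ray_v Y s ^ (N - m)
     + ray_u Y s ^ m * (INR (N - m) * ray_v Y s ^ pred (N - m) * Y)))%R N.

Definition ray2 (c Y : R) (N : nat) (s : R) : R :=
  Rsum (fun m => coef0F1 c m * coef0F1 c (N - m) *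
    (INR m * INR (pred m) * ray_u Y s ^ pred (pred m) * (1 - Y) ^ 2 * ray_v Y s ^ (N - m)
     + 2 * (INR m * ray_u Y s ^ pred m * (- (1 - Y)))
         * (INR (N - m) * ray_v Y s ^ pred (N - m) * Y)
     + ray_u Y s ^ m * (INR (N - m) * INR (pred (N - m)) * ray_v Y s ^ pred (pred (N - m))
          * Y ^ 2)))%R N.

Lemma is_derive_Rsum (f f' : nat -> R -> R) n s :
  (forall k, is_derive (f k) s (f' k s)) ->
  is_derive (fun s => Rsum (fun k => f k s) n) s (Rsum (fun k => f' k s) n).
Proof.
  intros H. induction n as [|n IH].
  - apply (is_derive_ext (f O)); [intros; rewrite Rsum_0; reflexivity|].
    rewrite Rsum_0. apply H.
  - apply (is_derive_ext (fun s => Rsum (fun k => f k s) n + f (S n) s)%R).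
    + intros. rewrite Rsum_S. reflexivity.
    + rewrite Rsum_S. apply (is_derive_plus (fun s => Rsum (fun k => f k s) n) (f (S n))).
      * exact IH.
      * apply H.
Qed.

Lemma ray_derive c Y N s : is_derive (ray c Y N) s (ray1 c Y N s).
Proof.
  unfold ray, ray1, hom, wsum.
  apply (is_derive_Rsum
    (fun m s => 1 * (coef0F1 c m * ray_u Y s ^ m * (coef0F1 c (N - m) * ray_v Y s ^ (N - m))))%R
    (fun m s => coef0F1 c m * coef0F1 c (N - m) *
    (INR m * ray_u Y s ^ pred m * (- (1 - Y)) * ray_v Y s ^ (N - m)
     + ray_u Y s ^ m * (INR (N - m) * ray_v Y s ^ pred (N - m) * Y)))%R).
  intros m. unfold ray_u, ray_v. auto_derive; [exact I|]. ring.
Qed.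

Lemma ray1_derive c Y N s : is_derive (ray1 c Y N) s (ray2 c Y N s).
Proof.
  unfold ray1, ray2.
  apply (is_derive_Rsum
    (fun m s => coef0F1 c m * coef0F1 c (N - m) *
    (INR m * ray_u Y s ^ pred m * (- (1 - Y)) * ray_v Y s ^ (N - m)
     + ray_u Y s ^ m * (INR (N - m) * ray_v Y s ^ pred (N - m) * Y)))%R
    (fun m s => coef0F1 c m * coef0F1 c (N - m) *
    (INR m * INR (pred m) * ray_u Y s ^ pred (pred m) * (1 - Y) ^ 2 * ray_v Y s ^ (N - m)
     + 2 * (INR m * ray_u Y s ^ pred m * (- (1 - Y)))
         * (INR (N - m) * ray_v Y s ^ pred (N - m) * Y)
     + ray_u Y s ^ m * (INR (N - m) * INR (pred (N - m)) * ray_v Y s ^ pred (pred (N - m))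
          * Y ^ 2)))%R).
  intros m. unfold ray_u, ray_v. auto_derive; [exact I|]. ring.
Qed.

Definition ray_prev (c Y : R) (N : nat) (s : R) : R :=
  match N with O => 0%R | S M => ray c Y M s end.

(** What remains of the [m]-th term of [0F1(c; u)] after the Bessel-type operator
    [u d^2/du^2 + c d/du]. *)
Definition down (c u : R) (m : nat) : R :=
  match m with O => 0%R | S k => (coef0F1 c k * u ^ k)%R end.

Lemma down_u c Y s m :
  (0 < c)%R ->
  (coef0F1 c m * (s * (1 + s) * (INR m * INR (pred m) * ray_u Y s ^ pred (pred m) * (1 - Y) ^ 2)
              + c * (1 + 2 * s) * (INR m * ray_u Y s ^ pred m * (- (1 - Y))))
   = - (1 + s) * (1 - Y) * down c (ray_u Y s) m + c * INR m * (coef0F1 c m * ray_u Y s ^ m))%R.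
Proof.
  intros Hc. unfold ray_u. destruct m as [|[|m]].
  - simpl. ring.
  - simpl down. rewrite <- (coef0F1_S c 0 Hc). simpl. ring.
  - simpl down. rewrite <- (coef0F1_S c (S m) Hc). simpl pred. rewrite !S_INR. simpl pow. ring.
Qed.

Lemma down_v c Y s m :
  (0 < c)%R ->
  (coef0F1 c m * (s * (1 + s) * (INR m * INR (pred m) * ray_v Y s ^ pred (pred m) * Y ^ 2)
              + c * (1 + 2 * s) * (INR m * ray_v Y s ^ pred m * Y))
   = s * Y * down c (ray_v Y s) m + c * INR m * (coef0F1 c m * ray_v Y s ^ m))%R.
Proof.
  intros Hc. unfold ray_v. destruct m as [|[|m]].
  - simpl. ring.
  - simpl down. rewrite <- (coef0F1_S c 0 Hc). simpl. ring.
  - simpl down. rewrite <- (coef0F1_S c (S m) Hc). simpl pred. rewrite !S_INR. simpl pow. ring.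
Qed.

(** The hypergeometric operator in [X = - s] acts on the homogeneous parts by a
    two-term recurrence that does not involve the numerator parameters. *)
Lemma ray_ode c Y N s :
  (0 < c)%R ->
  (s * (1 + s) * ray2 c Y N s + c * (1 + 2 * s) * ray1 c Y N s
   = - ray_prev c Y N s + INR N * (INR N + 2 * c - 1) * ray c Y N s)%R.
Proof.
  intros Hc.
  set (u := ray_u Y s). set (v := ray_v Y s).
  assert (Hcross : forall m n,
    (s * (1 + s) * (2 * (INR m * u ^ pred m * (- (1 - Y))) * (INR n * v ^ pred n * Y))
     = 2 * INR m * INR n * (u ^ m * v ^ n))%R).
  { intros m n. 
    assert (E1 : (INR m * u ^ pred m * (s * - (1 - Y)) = INR m * u ^ m)%R).
    { destruct m; [simpl; ring|]. unfold u, ray_u. simpl pred. simpl pow. ring. }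
    assert (E2 : (INR n * v ^ pred n * (Y * (1 + s)) = INR n * v ^ n)%R).
    { destruct n; [simpl; ring|]. unfold v, ray_v. simpl pred. simpl pow. ring. }
    transitivity (2 * (INR m * u ^ pred m * (s * - (1 - Y)))
                    * (INR n * v ^ pred n * (Y * (1 + s))))%R; [ring|].
    rewrite E1, E2. ring. }
  assert (EL : (s * (1 + s) * ray2 c Y N s + c * (1 + 2 * s) * ray1 c Y N s
    = (- (1 + s) * (1 - Y)) * Rsum (fun m => down c u m * (coef0F1 c (N - m) * v ^ (N - m)))%R N
      + s * Y * Rsum (fun m => coef0F1 c m * u ^ m * down c v (N - m))%R N
      + wsum c u v (fun m n => c * m + c * n + 2 * m * n) N)%R).
  { unfold ray1, ray2, wsum. rewrite <- !Rsum_scal, <- !Rsum_plus.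
    apply Rsum_ext. intros m _. fold u v.
    pose proof (down_u c Y s m Hc) as Du. pose proof (down_v c Y s (N - m) Hc) as Dv.
    fold u in Du. fold v in Dv.
    pose proof (Hcross m (N - m)%nat) as X.
    transitivity
      (coef0F1 c (N - m) * v ^ (N - m) *
         (coef0F1 c m * (s * (1 + s) * (INR m * INR (pred m) * u ^ pred (pred m) * (1 - Y) ^ 2)
              + c * (1 + 2 * s) * (INR m * u ^ pred m * (- (1 - Y)))))
       + coef0F1 c m * u ^ m *
         (coef0F1 c (N - m) * (s * (1 + s) * (INR (N - m) * INR (pred (N - m))
              * v ^ pred (pred (N - m)) * Y ^ 2)
              + c * (1 + 2 * s) * (INR (N - m) * v ^ pred (N - m) * Y)))
       + coef0F1 c m * coef0F1 c (N - m) * (s * (1 + s) * (2 * (INR m * u ^ pred m * (- (1 - Y)))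
              * (INR (N - m) * v ^ pred (N - m) * Y))))%R; [ring|].
    rewrite Du, Dv, X. ring. }
  rewrite EL. clear EL. unfold ray, hom. fold u v. destruct N as [|N].
  - rewrite !Rsum_0. unfold wsum. rewrite !Rsum_0. simpl. ring.
  - assert (Z1 : Rsum (fun m => down c u m * (coef0F1 c (S N - m) * v ^ (S N - m)))%R (S N)
                 = wsum c u v (fun _ _ => 1)%R N).
    { rewrite Rsum_Sl. simpl (down c u 0). rewrite Rmult_0_l, Rplus_0_l.
      apply Rsum_ext. intros m _. simpl down. simpl Nat.sub. ring. }
    assert (Z2 : Rsum (fun m => coef0F1 c m * u ^ m * down c v (S N - m))%R (S N)
                 = wsum c u v (fun _ _ => 1)%R N).
    { rewrite Rsum_S, Nat.sub_diag. simpl (down c v 0). rewrite Rmult_0_r, Rplus_0_r.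
      apply Rsum_ext. intros m Hm. replace (S N - m)%nat with (S (N - m)) by lia.
      simpl down. ring. }
    rewrite Z1, Z2. simpl ray_prev. unfold ray, hom. fold u v.
    set (h := wsum c u v (fun _ _ => 1)%R N).
    assert (Huv : (- (1 + s) * (1 - Y) * h + s * Y * h = - h + (u * h + v * h))%R).
    { unfold u, v, ray_u, ray_v. ring. }
    rewrite Huv. unfold h. rewrite wsum_u, wsum_v by exact Hc. rewrite Rplus_assoc.
    f_equal. rewrite !wsum_plus, wsum_scal. apply wsum_ext.
    intros m k Hmk. rewrite <- Hmk. ring.
Qed.

(** The energy [s (1+s) e'^2 + ab e^2] of a solution is nonincreasing up to the
    residual, because the damping coefficient [2c - 1 = a + b] is positive. *)
Lemma energy_bound (a b c s0 d : R) (e e1 e2 : R -> R) :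
  (0 < a)%R -> (0 < b)%R -> (2 * c = a + b + 1)%R ->
  (forall s, is_derive e s (e1 s)) ->
  (forall s, is_derive e1 s (e2 s)) ->
  e 0%R = 0%R -> (0 <= s0)%R ->
  (forall s, 0 <= s <= s0 ->
     Rabs (s * (1 + s) * e2 s + c * (1 + 2 * s) * e1 s + a * b * e s) <= d)%R ->
  (a * b * e s0 ^ 2 <= s0 * (d ^ 2 / (a + b)))%R.
Proof.
  intros Ha Hb Hc He He1 H0 Hs0 Hr.
  set (D := (d ^ 2 / (a + b))%R).
  set (phi := fun s => (s * D - (s * (1 + s) * (e1 s * e1 s) + a * b * (e s * e s)))%R).
  assert (Hle : (phi 0 <= phi s0)%R).
  { apply (derive_nonneg_le phi
      (fun s => D - ((1 + 2 * s) * (e1 s * e1 s)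
         + s * (1 + s) * (2 * e1 s * e2 s) + a * b * (2 * e s * e1 s)))%R); [exact Hs0| |].
    - intros s _. unfold phi.
      evar_last.
      + apply (is_derive_minus (fun s => s * D)%R).
        * apply (is_derive_mult (fun s => s) (fun _ => D) s 1%R 0%R);
            [apply (is_derive_id (K := R_AbsRing))
            |apply (is_derive_const (K := R_AbsRing) (V := R_NormedModule))|].
          intros; apply Rmult_comm.
        * apply (is_derive_plus (fun s => s * (1 + s) * (e1 s * e1 s))%R).
          -- apply (is_derive_mult (fun s => s * (1 + s))%R (fun s => e1 s * e1 s)%R s
                (1 + 2 * s)%R).
             ++ auto_derive; [exact I|ring].
             ++ apply (is_derive_mult e1 e1 s (e2 s) (e2 s) (He1 s) (He1 s)).
                intros; apply Rmult_comm.
             ++ intros; apply Rmult_comm.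
          -- apply (is_derive_scal (fun s => e s * e s)%R s (a * b)%R).
             apply (is_derive_mult e e s (e1 s) (e1 s) (He s) (He s)).
             intros; apply Rmult_comm.
      + unfold minus, plus, opp, mult; simpl. unfold mult; simpl. ring.
    - intros s Hs. specialize (Hr s Hs).
      set (r := (s * (1 + s) * e2 s + c * (1 + 2 * s) * e1 s + a * b * e s)%R) in *.
      apply Rabs_le_between in Hr.
      replace (D - ((1 + 2 * s) * (e1 s * e1 s) + s * (1 + s) * (2 * e1 s * e2 s)
                  + a * b * (2 * e s * e1 s)))%R
        with (D + (1 + 2 * s) * (2 * c - 1) * (e1 s * e1 s) - 2 * e1 s * r)%R
        by (unfold r; ring).
      replace (2 * c - 1)%R with (a + b)%R by lra.
      assert (HD : (D * (a + b) = d ^ 2)%R) by (unfold D; field; lra).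
      assert (Hr2 : (r * r <= d ^ 2)%R) by nra.
      assert (Hq : (0 <= 2 * s * (a + b) * (e1 s * e1 s))%R).
      { apply Rmult_le_pos; [apply Rmult_le_pos; lra|apply Rle_0_sqr]. }
      assert (Hsq : (0 <= (D + (a + b) * (e1 s * e1 s) - 2 * e1 s * r) * (a + b))%R).
      { pose proof (Rle_0_sqr ((a + b) * e1 s - r)) as HS. unfold Rsqr in HS. nra. }
      assert (0 <= D + (a + b) * (e1 s * e1 s) - 2 * e1 s * r)%R by nra.
      nra. }
  unfold phi in Hle. rewrite H0 in Hle.
  assert (0 <= s0 * (1 + s0) * (e1 s0 * e1 s0))%R.
  { apply Rmult_le_pos; [apply Rmult_le_pos; lra|apply Rle_0_sqr]. }
  simpl pow. rewrite Rmult_1_r. nra.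
Qed.

Lemma ray_bound A mu Y s0 s n :
  (1 <= mu)%R -> (mu <= INR A)%R -> (0 <= Y <= 1)%R -> (0 <= s <= s0)%R ->
  (Rabs (ray (mu + 1 / 2) Y n s) * INR (fact n) * INR (fact n)
    <= INR (S n) ^ S (A + A) * (Y + s0) ^ n)%R.
Proof.
  intros Hmu HA HY Hs.
  eapply Rle_trans; [apply (hom_bound A); unfold ray_u, ray_v; try assumption; nra|].
  apply Rmult_le_compat_l; [apply pow_le, pos_INR|].
  apply pow_incr. unfold ray_u, ray_v. nra.
Qed.

Section Positive.

Variables (a b : R).
Hypotheses (Ha : (1 <= a)%R) (Hb : (1 <= b)%R).

Let mu := ((a + b) / 2)%R.
Let c := (mu + 1 / 2)%R.
Let al (N : nat) := (rpoch a N * rpoch b N)%R.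

Lemma al_S N : (al (S N) = al N * (INR N * (INR N + 2 * c - 1) + a * b))%R.
Proof. unfold al. rewrite !rpoch_S. unfold c, mu. field. Qed.

(** The coefficients [(a)_N (b)_N] make the two terms of [ray_ode] telescope; only the
    last one survives in a partial sum. *)
Lemma partial_residual Y K s :
  (s * (1 + s) * Rsum (fun N => al N * ray2 c Y N s) K
   + c * (1 + 2 * s) * Rsum (fun N => al N * ray1 c Y N s) K
   + a * b * Rsum (fun N => al N * ray c Y N s) K
   = al (S K) * ray c Y K s)%R.
Proof.
  assert (Hc : (0 < c)%R) by (unfold c, mu; lra).
  rewrite <- !Rsum_scal, <- !Rsum_plus.
  induction K as [|K IH].
  - rewrite Rsum_0. pose proof (ray_ode c Y 0 s Hc) as HO. simpl ray_prev in HO.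
    simpl (INR 0) in HO. rewrite al_S. simpl (INR 0).
    transitivity (al 0 * (s * (1 + s) * ray2 c Y 0 s + c * (1 + 2 * s) * ray1 c Y 0 s)
      + al 0 * (a * b) * ray c Y 0 s)%R; [ring|].
    rewrite HO. ring.
  - rewrite Rsum_S, IH. pose proof (ray_ode c Y (S K) s Hc) as HO. simpl ray_prev in HO.
    rewrite (al_S (S K)).
    transitivity (al (S K) * ray c Y K s
      + al (S K) * (s * (1 + s) * ray2 c Y (S K) s + c * (1 + 2 * s) * ray1 c Y (S K) s)
      + al (S K) * (a * b) * ray c Y (S K) s)%R; [ring|].
    rewrite HO. ring.
Qed.

Lemma al_bound :
  exists D B, (0 <= D)%R /\ forall K,
    (0 <= al (S K) <= D * INR (S K) ^ B * (INR (fact K) * INR (fact K)))%R.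
Proof.
  destruct (nat_above (a + b)) as [A HA].
  exists (1 + (a + b) + a * b)%R, (2 + (A + A))%nat. split; [nra|]. intros K.
  assert (Hp : forall t, (1 <= t)%R -> (t <= INR A)%R ->
            (0 <= rpoch t K <= INR (fact K) * INR (S K) ^ A)%R).
  { intros t Ht HtA. pose proof (rpoch_pos t K ltac:(lra)) as Hpos. split; [lra|].
    pose proof (poch_bound A K t) as HP.
    rewrite RtoC_poch, !Cmod_R, (Rabs_pos_eq (rpoch t K)) in HP by lra.
    apply HP. rewrite Rabs_pos_eq; lra. }
  destruct (Hp a Ha ltac:(lra)) as [A0 A1]. destruct (Hp b Hb ltac:(lra)) as [B0 B1].
  pose proof (Rmult_le_compat _ _ _ _ A0 B0 A1 B1) as Hal. fold (al K) in Hal.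
  assert (Hal0 : (0 <= al K)%R) by (apply Rmult_le_pos; assumption).
  pose proof (pos_INR K) as HK. rewrite al_S.
  assert (Hf : (0 <= INR K * (INR K + (a + b)) + a * b)%R) by nra.
  replace (INR K + 2 * c - 1)%R with (INR K + (a + b))%R by (unfold c, mu; field).
  assert (Hq : (INR K * (INR K + (a + b)) + a * b
                 <= (1 + (a + b) + a * b) * INR (S K) ^ 2)%R).
  { rewrite S_INR. set (q := ((INR K + 1) ^ 2)%R).
    assert (Hq1 : (1 <= q)%R) by (unfold q; nra).
    assert (HqK : (INR K <= q)%R) by (unfold q; nra).
    assert (HqK2 : (INR K * INR K <= q)%R) by (unfold q; nra).
    assert ((a + b) * INR K <= (a + b) * q)%R by (apply Rmult_le_compat_l; lra).
    assert (Hab : (0 <= a * b)%R) by (apply Rmult_le_pos; lra).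
    assert (a * b * 1 <= a * b * q)%R by (apply Rmult_le_compat_l; lra).
    lra. }
  split; [apply Rmult_le_pos; assumption|].
  eapply Rle_trans; [apply Rmult_le_compat; [exact Hal0|exact Hf|exact Hal|exact Hq]|].
  apply Req_le. rewrite !pow_add. ring.
Qed.

Lemma al_ray_lim Y s0 eps :
  (0 <= Y)%R -> (0 <= s0)%R -> (Y + s0 < 1)%R -> (0 < eps)%R ->
  exists K0, forall K s, (K0 <= K)%nat -> (0 <= s <= s0)%R ->
    (Rabs (al (S K) * ray c Y K s) <= eps)%R.
Proof.
  intros HY Hs0 Hlt He.
  destruct (nat_above (a + b)) as [A HA]. destruct al_bound as [D [B [HD HB]]].
  destruct (poly_geom (B + S (A + A)) (Y + s0) ltac:(lra)) as [M [q [Hq [HM [_ HG]]]]].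
  destruct (pow_small (D * M) q eps Hq He) as [K0 HK].
  exists K0. intros K s HKK Hs. specialize (HK K HKK). destruct (HB K) as [H0 H1].
  pose proof (ray_bound A mu Y s0 s K ltac:(unfold mu; lra) ltac:(unfold mu; lra)
                ltac:(lra) Hs) as HR. fold c in HR.
  rewrite Rabs_mult, (Rabs_pos_eq (al (S K))) by exact H0.
  specialize (HG K). rewrite pow_add in HG.
  apply Rle_trans with (D * INR (S K) ^ B
      * (Rabs (ray c Y K s) * INR (fact K) * INR (fact K)))%R.
  - replace (D * INR (S K) ^ B * (Rabs (ray c Y K s) * INR (fact K) * INR (fact K)))%R
      with (D * INR (S K) ^ B * (INR (fact K) * INR (fact K)) * Rabs (ray c Y K s))%R by ring.
    apply Rmult_le_compat_r; [apply Rabs_pos|exact H1].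
  - apply Rle_trans with (D * INR (S K) ^ B * (INR (S K) ^ S (A + A) * (Y + s0) ^ K))%R.
    + apply Rmult_le_compat_l; [apply Rmult_le_pos; [exact HD|apply pow_le, pos_INR]|exact HR].
    + apply Rlt_le. eapply Rle_lt_trans; [|exact HK].
      rewrite !Rmult_assoc. apply Rmult_le_compat_l; [exact HD|]. rewrite <- Rmult_assoc. exact HG.
Qed.

Lemma ray_at_0 Y N : ray c Y N 0 = (coef0F1 c N * Y ^ N)%R.
Proof.
  unfold ray, hom, wsum, ray_u, ray_v.
  replace (- 0 * (1 - Y))%R with 0%R by ring. replace (Y * (1 + 0))%R with Y by ring.
  destruct N as [|N].
  - rewrite Rsum_0. unfold coef0F1. simpl. field.
  - rewrite Rsum_Sl. rewrite (Rsum_ext _ (fun _ => 0 * 0)%R).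
    + rewrite Rsum_scal. rewrite Nat.sub_0_r. unfold coef0F1 at 1. simpl (rpoch c 0). simpl (fact 0).
      simpl (INR 1). simpl (0 ^ 0)%R. field. 
    + intros m _. change (0 ^ S m)%R with (0 * 0 ^ m)%R. ring.
Qed.

Lemma ray_Y0 s N : ray c 0 N s = (coef0F1 c N * (- s) ^ N)%R.
Proof.
  unfold ray, hom, wsum, ray_u, ray_v.
  replace (- s * (1 - 0))%R with (- s)%R by ring. rewrite Rmult_0_l.
  destruct N as [|N].
  - rewrite Rsum_0. unfold coef0F1. simpl. field.
  - rewrite Rsum_S. rewrite (Rsum_ext _ (fun _ => 0 * 0)%R).
    + rewrite Rsum_scal, Nat.sub_diag. unfold coef0F1 at 2. simpl (rpoch c 0). simpl (fact 0).
      simpl (INR 1). simpl (0 ^ 0)%R. field. 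
    + intros m Hm. replace (S N - m)%nat with (S (N - m)) by lia.
      change (0 ^ S (N - m))%R with (0 * 0 ^ (N - m))%R. ring.
Qed.

(** [Sum a_N ray_N - G(Y) G(-s)] solves the hypergeometric equation in [s] up to a
    residual that tends to zero and vanishes at [s = 0]; the energy bound kills it. *)
Lemma product_formula_real Y s0 (G1 G2 : R) :
  (0 <= Y)%R -> (0 <= s0)%R -> (Y + s0 < 1)%R ->
  is_lim_seq (Rsum (fun p => al p * (coef0F1 c p * Y ^ p))%R) G1 ->
  is_lim_seq (Rsum (fun p => al p * (coef0F1 c p * (- s0) ^ p))%R) G2 ->
  is_lim_seq (Rsum (fun N => al N * ray c Y N s0)%R) (G1 * G2)%R.
Proof.
  intros HY Hs0 Hlt H1 H2.
  set (H := fun K => Rsum (fun p => al p * (coef0F1 c p * Y ^ p))%R K) in *.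
  set (h := fun K => Rsum (fun N => al N * ray c Y N s0)%R K).
  set (g := fun K => Rsum (fun p => al p * (coef0F1 c p * (- s0) ^ p))%R K) in *.
  assert (Hlim : is_lim_seq (fun K => H K * g K)%R (G1 * G2)%R).
  { apply is_lim_seq_mult'; [exact H1|exact H2]. }
  assert (Hbd : exists B, (0 <= B)%R /\ forall K, (Rabs (H K) <= B)%R).
  { destruct (filterlim_bounded (K := R_AbsRing) (V := R_NormedModule) H) as [B HB];
      [exists G1; exact H1|].
    exists B. split; [|exact HB]. eapply Rle_trans; [apply Rabs_pos|apply (HB O)]. }
  destruct Hbd as [B [HB HBK]].
  assert (Hd : is_lim_seq (fun K => h K - H K * g K)%R 0%R).
  { apply is_lim_seq_spec. intros eps.
    pose proof (cond_pos eps) as Heps.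
    set (d := (eps / (2 * (1 + B)))%R).
    assert (Hdp : (0 < d)%R) by (apply Rdiv_lt_0_compat; lra).
    destruct (al_ray_lim Y s0 d HY Hs0 Hlt Hdp) as [K1 HK1].
    destruct (al_ray_lim 0 s0 d (Rle_refl 0) Hs0 ltac:(lra) Hdp) as [K2 HK2].
    exists (K1 + K2)%nat. intros K HK. rewrite Rminus_0_r.
    set (f := fun Y s => Rsum (fun N => al N * ray c Y N s)%R K).
    set (f1 := fun Y s => Rsum (fun N => al N * ray1 c Y N s)%R K).
    set (f2 := fun Y s => Rsum (fun N => al N * ray2 c Y N s)%R K).
    assert (Df : forall Y s, is_derive (f Y) s (f1 Y s)).
    { intros Y' s. apply (is_derive_Rsum (fun N s => al N * ray c Y' N s)%R
        (fun N s => al N * ray1 c Y' N s)%R).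
      intros k. apply is_derive_scal, ray_derive. }
    assert (Df1 : forall Y s, is_derive (f1 Y) s (f2 Y s)).
    { intros Y' s. apply (is_derive_Rsum (fun N s => al N * ray1 c Y' N s)%R
        (fun N s => al N * ray2 c Y' N s)%R).
      intros k. apply is_derive_scal, ray1_derive. }
    assert (HfH : f Y 0%R = H K).
    { apply Rsum_ext. intros k _. rewrite ray_at_0. reflexivity. }
    assert (Hfg : f 0%R s0 = g K).
    { apply Rsum_ext. intros k _. rewrite ray_Y0. reflexivity. }
    assert (Hf00 : f 0%R 0%R = 1%R).
    { unfold f. assert (E : forall n, Rsum (fun N => al N * ray c 0 N 0)%R n = 1%R).
      { induction n as [|n IH].
        - rewrite Rsum_0, ray_at_0. unfold al, coef0F1. simpl. field.
        - rewrite Rsum_S, IH, ray_at_0. simpl pow. ring. }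
      apply E. }
    pose proof (energy_bound a b c s0 ((1 + B) * d)%R
      (fun s => f Y s - H K * f 0%R s)%R (fun s => f1 Y s - H K * f1 0%R s)%R
      (fun s => f2 Y s - H K * f2 0%R s)%R) as HE.
    assert (HE' := HE ltac:(lra) ltac:(lra) ltac:(unfold c, mu; field)). clear HE.
    assert (HE : (a * b * (f Y s0 - H K * f 0%R s0) ^ 2
                    <= s0 * (((1 + B) * d) ^ 2 / (a + b)))%R).
    { apply HE'; clear HE'.
      - intros s. apply (is_derive_minus (f Y) (fun s => H K * f 0%R s)%R); [apply Df|].
        apply is_derive_scal, Df.
      - intros s. apply (is_derive_minus (f1 Y) (fun s => H K * f1 0%R s)%R); [apply Df1|].
        apply is_derive_scal, Df1.
      - rewrite HfH, Hf00. ring.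
      - exact Hs0.
      - intros s Hs.
        pose proof (partial_residual Y K s) as R1. pose proof (partial_residual 0 K s) as R2.
        replace (s * (1 + s) * (f2 Y s - H K * f2 0 s)
            + c * (1 + 2 * s) * (f1 Y s - H K * f1 0 s) + a * b * (f Y s - H K * f 0 s))%R
          with (al (S K) * ray c Y K s - H K * (al (S K) * ray c 0 K s))%R
          by (rewrite <- R1, <- R2; unfold f, f1, f2; ring).
        unfold Rminus. eapply Rle_trans; [apply Rabs_triang|]. rewrite Rabs_Ropp, (Rabs_mult (H K)).
        specialize (HK1 K s ltac:(lia) Hs). specialize (HK2 K s ltac:(lia) Hs).
        specialize (HBK K). pose proof (Rabs_pos (H K)).
        pose proof (Rabs_pos (al (S K) * ray c 0 K s)).
        assert (Rabs (H K) * Rabs (al (S K) * ray c 0 K s) <= B * d)%R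
          by (apply Rmult_le_compat; [apply Rabs_pos|apply Rabs_pos|exact HBK|exact HK2]).
        lra. }
    rewrite Hfg in HE. change (f Y s0) with (h K) in HE.
    set (e := (h K - H K * g K)%R) in *.
    assert (Hdd : ((1 + B) * d = eps / 2)%R) by (unfold d; field; lra).
    rewrite Hdd in HE.
    assert (Hab : (1 <= a * b)%R) by nra.
    assert (Hq : (s0 * ((eps / 2) ^ 2 / (a + b)) <= (eps / 2) ^ 2)%R).
    { replace (s0 * ((eps / 2) ^ 2 / (a + b)))%R with ((eps / 2) ^ 2 * (s0 / (a + b)))%R
        by (field; lra).
      rewrite <- (Rmult_1_r ((eps / 2) ^ 2)) at 2.
      apply Rmult_le_compat_l; [apply pow2_ge_0|]. apply Rle_div_l; lra. }
    assert (He2 : (e ^ 2 <= (eps / 2) ^ 2)%R).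
    { pose proof (pow2_ge_0 e). nra. }
    apply Rabs_def1; nra. }
  apply (is_lim_seq_ext (fun K => (h K - H K * g K) + H K * g K)%R); [intros; unfold h; ring|].
  replace (G1 * G2)%R with (0 + G1 * G2)%R by ring.
  apply is_lim_seq_plus'; assumption.
Qed.

End Positive.

(** * The double series and its bounds *)

Definition hyp_term (a b c t : C) (p : nat) : C :=
  poch a p * poch b p * rGamma (c + INR p) * (t ^ p / INR (fact p)).

(** [2F1(a, b; c; t) / Gamma(c)] inside the unit disc, entire in [a], [b], [c]. *)
Definition hyp (a b c t : C) : C := CSeries (hyp_term a b c t).

Lemma hyp_term_bound A :
  exists K B, (0 <= K)%R /\ forall a b c t p,
    (Cmod a <= INR A)%R -> (Cmod b <= INR A)%R -> (Cmod c <= INR A)%R ->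
    (Cmod (hyp_term a b c t p) <= K * (INR (S p) ^ B * Cmod t ^ p))%R.
Proof.
  destruct (rGamma_shift_bound A) as [K [B [HK HB]]].
  exists K, (A + A + B)%nat. split; [exact HK|]. intros a b c t p Ha Hb Hc.
  unfold hyp_term. rewrite !Cmod_mult, Cmod_div, Cmod_pow, Cmod_INR by apply INR_fact_neq.
  pose proof (INR_fact_lt_0 p) as Hf.
  pose proof (poch_bound A p a Ha) as H1. pose proof (poch_bound A p b Hb) as H2.
  pose proof (HB p c Hc) as H3. set (F := INR (fact p)) in *.
  pose proof (pow_le (Cmod t) p (Cmod_ge_0 t)) as Ht.
  replace (Cmod (poch a p) * Cmod (poch b p) * Cmod (rGamma (c + INR p)) * (Cmod t ^ p / F))%R
    with ((Cmod (poch a p) / F) * (Cmod (poch b p) / F) * (Cmod (rGamma (c + INR p)) * F)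
            * Cmod t ^ p)%R by (field; lra).
  rewrite !pow_add.
  replace (K * (INR (S p) ^ A * INR (S p) ^ A * INR (S p) ^ B * Cmod t ^ p))%R
    with (INR (S p) ^ A * INR (S p) ^ A * (K * INR (S p) ^ B) * Cmod t ^ p)%R by ring.
  assert (G : forall z, (Cmod z <= F * INR (S p) ^ A)%R -> (0 <= Cmod z / F <= INR (S p) ^ A)%R).
  { intros z Hz. split; [apply Rdiv_le_0_compat; [apply Cmod_ge_0|exact Hf]|].
    apply Rle_div_l; [exact Hf|]. lra. }
  destruct (G _ H1). destruct (G _ H2).
  apply Rmult_le_compat_r; [exact Ht|].
  apply Rmult_le_compat; [apply Rmult_le_pos; assumption
    |apply Rmult_le_pos; [apply Cmod_ge_0|lra]| |exact H3].
  apply Rmult_le_compat; assumption.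
Qed.

(** [M] and [q] are chosen before [f]: they serve a whole family of series. *)
Lemma poly_dominated (K : R) (B : nat) (q0 : R) :
  (0 <= K)%R -> (0 <= q0 < 1)%R ->
  exists M q, (0 <= q < 1)%R /\ forall (f : nat -> C),
    (forall n, Cmod (f n) <= K * (INR (S n) ^ B * q0 ^ n))%R ->
    forall n, (Cmod (f n) <= M * q ^ n)%R.
Proof.
  intros HK Hq. destruct (poly_geom B q0 Hq) as [M [q [Hq1 [HM [_ HG]]]]].
  exists (K * M)%R, q. split; [exact Hq1|]. intros f Hf n.
  eapply Rle_trans; [apply Hf|]. rewrite Rmult_assoc. apply Rmult_le_compat_l; auto.
Qed.

Lemma dominated_CSeries (a : nat -> C) (M q : R) :
  (0 <= q < 1)%R -> (forall n, Cmod (a n) <= M * q ^ n)%R -> is_series a (CSeries a).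
Proof.
  intros Hq Ha. destruct (geom_series a M q Hq Ha) as [s [Hs _]].
  rewrite (CSeries_eq a s Hs). exact Hs.
Qed.

Lemma hyp_series a b c t :
  (Cmod t < 1)%R -> is_series (hyp_term a b c t) (hyp a b c t).
Proof.
  intros Ht. destruct (nat_above (Cmod a + Cmod b + Cmod c)) as [A HA].
  pose proof (Cmod_ge_0 a). pose proof (Cmod_ge_0 b). pose proof (Cmod_ge_0 c).
  destruct (hyp_term_bound A) as [K [B [HK HB]]].
  destruct (poly_dominated K B (Cmod t) HK (conj (Cmod_ge_0 t) Ht)) as [M [q [Hq HM]]].
  apply (dominated_CSeries _ M q Hq), HM. intros n. apply HB; lra.
Qed.

Lemma entire_affine2 f (al be : C) (g : C -> C) :
  entire f -> (forall z, g z = al * z + be) -> entire (fun z => f (g z)).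
Proof.
  intros Hf Hg. apply (entire_ext (fun z => f (al * z + be))).
  - intros z. rewrite Hg. reflexivity.
  - apply entire_affine, Hf.
Qed.

(** Affine dependence suffices, since every continuation argument moves along a line
    in parameter space. *)
Lemma entire_hyp (a1 a0 b1 b0 c1 c0 t : C) :
  (Cmod t < 1)%R ->
  entire (fun z => hyp (a1 * z + a0) (b1 * z + b0) (c1 * z + c0) t).
Proof.
  intros Ht.
  apply (entire_series (fun p z => hyp_term (a1 * z + a0) (b1 * z + b0) (c1 * z + c0) t p)).
  - intros p. unfold hyp_term.
    apply (entire_mult (fun z => poch (a1 * z + a0) p * poch (b1 * z + b0) p
             * rGamma (c1 * z + c0 + INR p)) (fun _ => t ^ p / INR (fact p)));
      [|apply entire_const].
    apply (entire_mult (fun z => poch (a1 * z + a0) p * poch (b1 * z + b0) p)).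
    + apply (entire_mult (fun z => poch (a1 * z + a0) p)).
      * exact (entire_affine (fun z => poch z p) a1 a0 (entire_poch p)).
      * exact (entire_affine (fun z => poch z p) b1 b0 (entire_poch p)).
    + apply (entire_affine2 rGamma c1 (c0 + INR p)); [apply entire_rGamma|intros; ring].
  - intros z. apply hyp_series, Ht.
  - intros R0.
    set (R1 := Rabs R0).
    destruct (nat_above (Cmod a1 * R1 + Cmod a0 + (Cmod b1 * R1 + Cmod b0)
                         + (Cmod c1 * R1 + Cmod c0))) as [A HA].
    destruct (hyp_term_bound A) as [K [B [HK HB]]].
    destruct (poly_dominated K B (Cmod t) HK (conj (Cmod_ge_0 t) Ht)) as [M [q [Hq HM]]].
    exists M, q. split; [exact Hq|]. intros n z Hz.
    apply (HM (hyp_term (a1 * z + a0) (b1 * z + b0) (c1 * z + c0) t)).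
    intros p.
    assert (Hz1 : (Cmod z <= R1)%R) by (eapply Rle_trans; [exact Hz|apply Rle_abs]).
    assert (G : forall u v : C, (0 <= Cmod u * R1 + Cmod v)%R /\
              (Cmod (u * z + v) <= Cmod u * R1 + Cmod v)%R).
    { intros u v. split.
      - apply Rplus_le_le_0_compat; [apply Rmult_le_pos; [apply Cmod_ge_0|apply Rabs_pos]
          |apply Cmod_ge_0].
      - eapply Rle_trans; [apply Cmod_triangle|]. apply Rplus_le_compat_r.
        rewrite Cmod_mult. apply Rmult_le_compat_l; [apply Cmod_ge_0|exact Hz1]. }
    destruct (G a1 a0), (G b1 b0), (G c1 c0). apply HB; lra.
Qed.

Lemma poch_double z f :
  poch (2 * z) (f + f) = 2 ^ (f + f) * poch z f * poch (z + 1 / 2) f.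
Proof.
  induction f as [|f IH]; [simpl; ring|].
  replace (S f + S f)%nat with (S (S (f + f))) by lia.
  rewrite !poch_S, IH, INR_S_C, plus_INR, RtoC_plus, !Cpow_S. field.
Qed.

Lemma poch_double_S z f :
  poch (2 * z) (S (f + f)) = 2 ^ S (f + f) * poch z (S f) * poch (z + 1 / 2) f.
Proof.
  rewrite !poch_S, poch_double, plus_INR, RtoC_plus, Cpow_S. ring.
Qed.

(** The duplication formula on [N = n + 2 k] factors, split as evenly as
    possible. *)
Lemma poch_duplication z n k :
  poch (2 * z) (n + 2 * k)
  = 2 ^ (n + 2 * k) * poch z (n - Nat.div2 n + k) * poch (z + 1 / 2) (Nat.div2 n + k).
Proof.
  pose proof (Nat.div2_odd n) as Hn. set (h := Nat.div2 n) in *. clearbody h.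
  destruct (Nat.odd n); simpl Nat.b2n in Hn; subst n.
  - replace (2 * h + 1 + 2 * k)%nat with (S ((h + k) + (h + k))) by lia.
    replace (2 * h + 1 - h + k)%nat with (S (h + k)) by lia.
    apply poch_double_S.
  - replace (2 * h + 0 + 2 * k)%nat with ((h + k) + (h + k))%nat by lia.
    replace (2 * h + 0 - h + k)%nat with (h + k)%nat by lia.
    apply poch_double.
Qed.

(** A binomial coefficient is at most the sum of its row. *)
Lemma fact_split_le f h : (INR (fact (f + h)) <= 2 ^ (f + h) * (INR (fact f) * INR (fact h)))%R.
Proof.
  assert (H1 : forall n, (1 <= 2 ^ n)%R) by (intros n; apply pow_R1_Rle; lra).
  remember (f + h)%nat as N eqn:HN. revert f h HN.
  induction N as [|N IH]; intros f h HN.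
  - assert (f = O) by lia. assert (h = O) by lia. subst. simpl. lra.
  - destruct f as [|f].
    + simpl in HN. subst h. simpl (fact 0). simpl (INR 1). rewrite Rmult_1_l.
      pose proof (INR_fact_lt_0 (S N)). specialize (H1 (S N)). nra.
    + destruct h as [|h].
      * rewrite Nat.add_0_r in HN. rewrite HN. simpl (fact 0). simpl (INR 1).
        rewrite Rmult_1_r. pose proof (INR_fact_lt_0 (S f)). specialize (H1 (S f)). nra.
      * pose proof (IH f (S h) ltac:(lia)) as A. pose proof (IH (S f) h ltac:(lia)) as B.
        (* Pascal's rule, multiplied out *)
        rewrite (fact_simpl N), HN, mult_INR.
        replace (INR (S f + S h)) with (INR (S f) + INR (S h))%R by (rewrite plus_INR; ring).
        rewrite (fact_simpl f), (fact_simpl h), !mult_INR in *.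
        pose proof (pos_INR (S f)). pose proof (pos_INR (S h)).
        assert (E : (S f + S h = S N)%nat) by lia. rewrite E. 
        change (2 ^ S N)%R with (2 * 2 ^ N)%R. 
        apply Rmult_le_compat_l with (r := INR (S f)) in A; [|assumption].
        apply Rmult_le_compat_l with (r := INR (S h)) in B; [|assumption].
        set (D := (2 ^ N)%R) in *. nra.
Qed.

(** The coefficient of [rho^(n + 2k)] times the [n]-th Gegenbauer polynomial. The
    quotient [(mu)_(n+k) / (Gamma(mu+1/2)^2 (2mu)_(n+2k) (mu+1/2)_(n+2k))] is written
    without denominators in [mu = (a + b) / 2], by the duplication formula. *)
Definition dcoef (nu : R) (a b : C) (n k : nat) : C :=
  poch a (n + 2 * k) * poch b (n + 2 * k) * (nu + INR n)
  * (/ 2 ^ (n + 2 * k)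
     * rGamma ((a + b + 1) / 2 + INR (n + 2 * k))
     * rGamma ((a + b + 1) / 2 + INR (Nat.div2 n + k))
     * poch ((a + b) / 2 + INR (n - Nat.div2 n + k)) (Nat.div2 n)
     * poch ((a + b) / 2 - nu) k
     / (poch (nu + 1) (n + k) * INR (fact k))).

Lemma dcoef_sym nu a b n k : dcoef nu a b n k = dcoef nu b a n k.
Proof. unfold dcoef. rewrite (Cplus_comm a b). ring. Qed.

Lemma two_pow_neq n : 2 ^ n <> 0.
Proof. apply Cpow_nz. apply RtoC_neq. lra. Qed.

Lemma nu1_poch (nu : R) j : poch (nu + 1) j = rpoch (nu + 1) j.
Proof. rewrite <- RtoC_plus. apply RtoC_poch. Qed.

Lemma nu1_poch_neq nu j : (-1 / 2 < nu)%R -> poch (nu + 1) j <> 0.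
Proof.
  intros H. rewrite nu1_poch. apply RtoC_neq, Rgt_not_eq, rpoch_pos. lra.
Qed.

(** The two factors [1/Gamma(c)] are cancelled against [(c)_N] and against the half of
    [(2 mu)_N] that consists of half-integer shifts. *)
Lemma dcoef_generic nu (a b : C) n k :
  (-1 / 2 < nu)%R ->
  poch (a + b) (n + 2 * k) <> 0 -> poch ((a + b + 1) / 2) (n + 2 * k) <> 0 ->
  dcoef nu a b n k
  = rGamma ((a + b + 1) / 2) ^ 2
    * ((nu + INR n) * poch a (n + 2 * k) * poch b (n + 2 * k)
       * poch ((a + b) / 2) (n + k) * poch ((a + b) / 2 - nu) k
       / (poch (a + b) (n + 2 * k) * poch ((a + b + 1) / 2) (n + 2 * k)
          * poch (nu + 1) (n + k) * INR (fact k))).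
Proof.
  intros Hnu H2 Hc. unfold dcoef.
  set (mu := (a + b) / 2) in *. set (c := (a + b + 1) / 2) in *.
  set (N := (n + 2 * k)%nat) in *. set (f := (Nat.div2 n + k)%nat).
  set (h := (n - Nat.div2 n + k)%nat).
  pose proof (poch_duplication mu n k) as HD. fold N f h in HD.
  replace (2 * mu) with (a + b) in HD by (unfold mu; field).
  replace (mu + 1 / 2) with c in HD by (unfold mu, c; field).
  pose proof (rGamma_poch c N) as G1. pose proof (rGamma_poch c f) as G2.
  assert (HM : poch mu (n + k) = poch mu h * poch (mu + INR h) (Nat.div2 n)).
  { rewrite <- poch_add. f_equal. unfold h. pose proof (Nat.div2_odd n). lia. }
  rewrite HD in H2.
  assert (Hh : poch mu h <> 0) by (intros z; apply H2; rewrite z; ring).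
  assert (Hf : poch c f <> 0) by (intros z; apply H2; rewrite z; ring).
  replace (rGamma c ^ 2) with (rGamma c * rGamma c) by ring.
  rewrite G1 at 1. rewrite G2. rewrite HM, HD.
  pose proof (two_pow_neq N). pose proof (nu1_poch_neq nu (n + k) Hnu).
  pose proof (INR_fact_neq k).
  field. repeat split; assumption.
Qed.

Lemma entire_dcoef nu b n k : entire (fun a => dcoef nu a b n k).
Proof.
  unfold dcoef. unfold Cdiv at 1.
  apply (entire_mult (fun a => poch a (n + 2 * k) * poch b (n + 2 * k) * (nu + INR n))).
  - apply (entire_mult (fun a => poch a (n + 2 * k) * poch b (n + 2 * k)) (fun _ => nu + INR n));
      [|apply entire_const].
    apply (entire_mult (fun a => poch a (n + 2 * k)) (fun _ => poch b (n + 2 * k)));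
      [apply entire_poch|apply entire_const].
  - apply (entire_mult _ (fun _ => / (poch (nu + 1) (n + k) * INR (fact k))));
      [|apply entire_const].
    apply (entire_mult _ (fun a => poch ((a + b) * / 2 - nu) k)).
    2:{ apply (entire_affine2 (fun z => poch z k) (/ 2) (b / 2 - nu));
          [apply entire_poch|intros; field]. }
    apply (entire_mult _ (fun a => poch ((a + b) / 2 + INR (n - Nat.div2 n + k)) (Nat.div2 n))).
    2:{ apply (entire_affine2 (fun z => poch z (Nat.div2 n)) (/ 2)
                 (b / 2 + INR (n - Nat.div2 n + k))); [apply entire_poch|intros; field]. }
    apply (entire_mult (fun a => / 2 ^ (n + 2 * k) * rGamma ((a + b + 1) / 2 + INR (n + 2 * k)))
             (fun a => rGamma ((a + b + 1) / 2 + INR (Nat.div2 n + k)))).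
    2:{ apply (entire_affine2 rGamma (/ 2) ((b + 1) / 2 + INR (Nat.div2 n + k)));
          [apply entire_rGamma|intros; field]. }
    apply (entire_mult (fun _ => / 2 ^ (n + 2 * k))); [apply entire_const|].
    apply (entire_affine2 rGamma (/ 2) ((b + 1) / 2 + INR (n + 2 * k)));
      [apply entire_rGamma|intros; field].
Qed.

Lemma Rle_mult_chain x x' y y' :
  (0 <= x -> 0 <= y -> x <= x' -> y <= y' -> x * y <= x' * y')%R.
Proof. intros. apply Rmult_le_compat; assumption. Qed.

(** The factorials of all the factors cancel up to [(n+2k)! / (2^(n+2k) f! h!)],
    a central binomial probability. *)
Lemma dcoef_bound nu A :
  (-1 / 2 < nu)%R ->
  exists K B, (0 <= K)%R /\ forall a b n k,
    (Cmod a <= INR A)%R -> (Cmod b <= INR A)%R ->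
    (Cmod (dcoef nu a b n k) <= K * INR (S (n + 2 * k)) ^ B)%R.
Proof.
  intros Hnu. destruct (nat_above (INR A + Rabs nu + 1)) as [D HD].
  pose proof (Rabs_pos nu) as Hnu0. pose proof (pos_INR A) as HA0.
  destruct (rGamma_shift_bound D) as [K [B [HK HB]]].
  exists (K * K * 2 * INR D)%R, (D + D + B + B + D + D + 1 + 1)%nat.
  split. { repeat apply Rmult_le_pos; try lra; apply pos_INR. }
  intros a b n k Ha Hb.
  set (N := (n + 2 * k)%nat). set (p := INR (S N)).
  set (f := (Nat.div2 n + k)%nat). set (h := (n - Nat.div2 n + k)%nat).
  assert (Hfh : (f + h = N)%nat).
  { unfold f, h, N. pose proof (Nat.div2_odd n). lia. }
  assert (Hp1 : (1 <= p)%R) by (apply (le_INR 1); lia).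
  assert (Hpj : forall j E, (j <= N)%nat -> (INR (S j) ^ E <= p ^ E)%R).
  { intros j E Hj. apply pow_incr. split; [apply pos_INR|apply le_INR; lia]. }
  assert (Hab : (Cmod (a + b) <= 2 * INR A)%R).
  { eapply Rle_trans; [apply Cmod_triangle|lra]. }
  assert (H2 : Cmod 2 = 2%R) by (rewrite Cmod_R; apply Rabs_pos_eq; lra).
  assert (Hmu : (Cmod ((a + b) / 2) <= INR A)%R).
  { rewrite Cmod_div, H2 by (apply RtoC_neq; lra). lra. }
  assert (Hc : (Cmod ((a + b + 1) / 2) <= INR D)%R).
  { rewrite Cmod_div, H2 by (apply RtoC_neq; lra).
    pose proof (Cmod_triangle (a + b) 1) as HT. rewrite Cmod_1 in HT. lra. }
  assert (Hmn : (Cmod ((a + b) / 2 - nu) <= INR D)%R).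
  { eapply Rle_trans; [apply Cmod_triangle_minus|]. rewrite Cmod_R. lra. }
  assert (Ea : (Cmod (poch a N) <= INR (fact N) * p ^ D)%R) by (apply poch_bound; lra).
  assert (Eb : (Cmod (poch b N) <= INR (fact N) * p ^ D)%R) by (apply poch_bound; lra).
  assert (En : (Cmod (nu + INR n) <= INR D * p)%R).
  { eapply Rle_trans; [apply Cmod_triangle|]. rewrite Cmod_R, Cmod_INR.
    assert (INR n <= p - 1)%R.
    { unfold p. rewrite S_INR. assert (INR n <= INR N)%R by (apply le_INR; unfold N; lia). lra. }
    nra. }
  assert (E1 := HB N ((a + b + 1) / 2) Hc). fold p in E1.
  assert (E2 : (Cmod (rGamma ((a + b + 1) / 2 + INR f)) * INR (fact f) <= K * p ^ B)%R).
  { eapply Rle_trans; [apply (HB f _ Hc)|]. apply Rmult_le_compat_l; [exact HK|].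
    apply Hpj. lia. }
  assert (E3 : (INR (fact h) * Cmod (poch ((a + b) / 2 + INR h) (Nat.div2 n))
                  <= INR (fact (n + k)) * p ^ D)%R).
  { replace (n + k)%nat with (h + Nat.div2 n)%nat
      by (unfold h; pose proof (Nat.div2_odd n); lia).
    eapply Rle_trans; [apply (poch_shift_bound D); lra|].
    apply Rmult_le_compat_l; [apply pos_INR|]. apply Hpj.
    unfold h, N. pose proof (Nat.div2_odd n). lia. }
  assert (E4 : (Cmod (poch ((a + b) / 2 - nu) k) <= INR (fact k) * p ^ D)%R).
  { eapply Rle_trans; [apply (poch_bound D); exact Hmn|].
    apply Rmult_le_compat_l; [apply pos_INR|]. apply Hpj. unfold N. lia. }
  assert (E5 : (INR (fact (n + k)) <= 2 * p * rpoch (nu + 1) (n + k))%R).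
  { eapply Rle_trans; [apply (rpoch_half_ge (nu + 1)); lra|].
    pose proof (rpoch_pos (nu + 1) (n + k) ltac:(lra)).
    apply Rmult_le_compat_r; [lra|]. apply Rmult_le_compat_l; [lra|].
    apply le_INR. unfold N. lia. }
  assert (E6 := fact_split_le f h). rewrite Hfh in E6.
  pose proof (rpoch_pos (nu + 1) (n + k) ltac:(lra)) as Hr.
  unfold dcoef. fold N f h.
  rewrite Cmod_mult, Cmod_div.
  2:{ apply Cmult_neq_0; [apply nu1_poch_neq, Hnu|apply INR_fact_neq]. }
  rewrite nu1_poch. rewrite !Cmod_mult, Cmod_inv, Cmod_pow, H2 by apply two_pow_neq.
  rewrite Cmod_INR, (Cmod_R (rpoch _ _)), (Rabs_pos_eq (rpoch _ _)) by lra.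
  revert Ea Eb En E1 E2 E3 E4 E5 E6.
  pose proof (INR_fact_lt_0 N) as F1. pose proof (INR_fact_lt_0 f) as F2.
  pose proof (INR_fact_lt_0 h) as F3. pose proof (INR_fact_lt_0 (n + k)) as F4.
  pose proof (INR_fact_lt_0 k) as F5. pose proof (pow_lt 2 N ltac:(lra)) as F6.
  pose proof (pow_le p D ltac:(lra)) as P1. pose proof (pow_le p B ltac:(lra)) as P2.
  generalize (Cmod_ge_0 (poch a N)) (Cmod_ge_0 (poch b N)) (Cmod_ge_0 (nu + INR n))
    (Cmod_ge_0 (rGamma ((a + b + 1) / 2 + INR N)))
    (Cmod_ge_0 (rGamma ((a + b + 1) / 2 + INR f)))
    (Cmod_ge_0 (poch ((a + b) / 2 + INR h) (Nat.div2 n)))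
    (Cmod_ge_0 (poch ((a + b) / 2 - nu) k)).
  generalize (Cmod (poch a N)) (Cmod (poch b N)) (Cmod (nu + INR n))
    (Cmod (rGamma ((a + b + 1) / 2 + INR N)))
    (Cmod (rGamma ((a + b + 1) / 2 + INR f)))
    (Cmod (poch ((a + b) / 2 + INR h) (Nat.div2 n)))
    (Cmod (poch ((a + b) / 2 - nu) k)).
  intros xa xb xn x1 x2 x3 x4 Ya Yb Yn Y1 Y2 Y3 Y4 Ea Eb En E1 E2 E3 E4 E5 E6.
  rewrite !pow_add, !pow_1.
  revert Hr F1 F2 F3 F4 F5 F6 P1 P2 Ea Eb E1 E2 E3 E4 E5 E6.
  pose proof (pos_INR D) as HD0.
  clearbody p.
  generalize (rpoch (nu + 1) (n + k)) (INR (fact N)) (INR (fact f)) (INR (fact h))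
    (INR (fact (n + k))) (INR (fact k)) (2 ^ N)%R (p ^ D)%R (p ^ B)%R.
  intros r fN ff fh fnk fk tw pD pB Hr F1 F2 F3 F4 F5 F6 P1 P2 Ea Eb E1 E2 E3 E4 E5 E6.
  (* group each quantity with the factorial that normalises it *)
  replace (xa * xb * xn * (/ tw * x1 * x2 * x3 * x4 / (r * fk)))%R
    with ((xa / fN) * (xb / fN) * xn * (x1 * fN) * (x2 * ff) * (fh * x3 / fnk)
          * (x4 / fk) * (fN / (tw * (ff * fh))) * (fnk / r))%R
    by (field; repeat split; lra).
  replace (K * K * 2 * INR D * (pD * pD * pB * pB * pD * pD * p * p))%R
    with (pD * pD * (INR D * p) * (K * pB) * (K * pB) * pD * pD * 1 * (2 * p))%R by ring.
  assert (Q : forall u w m, (0 <= u)%R -> (0 < w)%R -> (u <= m * w)%R -> (0 <= u / w <= m)%R).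
  { intros u w m Hu Hw Hm. split; [apply Rdiv_le_0_compat; assumption|].
    apply Rle_div_l; assumption. }
  destruct (Q xa fN pD Ya F1 ltac:(lra)). destruct (Q xb fN pD Yb F1 ltac:(lra)).
  destruct (Q (fh * x3)%R fnk pD ltac:(apply Rmult_le_pos; lra) F4 ltac:(lra)).
  destruct (Q x4 fk pD Y4 F5 ltac:(lra)).
  destruct (Q fN (tw * (ff * fh))%R 1%R ltac:(lra)
              ltac:(repeat apply Rmult_lt_0_compat; assumption) ltac:(lra)).
  destruct (Q fnk r (2 * p)%R ltac:(lra) Hr ltac:(lra)).
  assert (0 <= x1 * fN)%R by (apply Rmult_le_pos; lra).
  assert (0 <= x2 * ff)%R by (apply Rmult_le_pos; lra).
  repeat first [assumption | apply Rle_mult_chain | apply Rmult_le_pos].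
Qed.

(** * Rearrangement along diagonals *)

(** Substituting [N = n + j] in a sum cut off at [K]. *)
Lemma Csum_reindex (g : nat -> C) j K :
  Csum (fun N => if Nat.leb j N then g (N - j)%nat else 0) K
  = Csum (fun n => if Nat.leb (n + j) K then g n else 0) K.
Proof.
  revert K. induction j as [|j IH]; intros K.
  - apply Csum_ext. intros k Hk. simpl. rewrite Nat.sub_0_r, Nat.add_0_r.
    destruct (Nat.leb_spec k K); [reflexivity|lia].
  - destruct K as [|K].
    + rewrite !Csum_0. reflexivity.
    + rewrite Csum_Sl. simpl (if Nat.leb (S j) 0 then _ else _). rewrite Cplus_0_l.
      rewrite Csum_S. destruct (Nat.leb_spec (S K + S j) (S K)); [lia|]. rewrite Cplus_0_r.
      transitivity (Csum (fun N => if Nat.leb j N then g (N - j)%nat else 0) K).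
      * apply Csum_ext. intros k _. reflexivity.
      * rewrite IH. apply Csum_ext. intros k _.
        destruct (Nat.leb_spec (k + j) K); destruct (Nat.leb_spec (k + S j) (S K));
          lia || reflexivity.
Qed.

Definition diagonal (m : nat) (tau : nat -> nat -> C) (N : nat) : C :=
  Csum (fun k => if Nat.leb (m * k) N then tau (N - m * k)%nat k else 0) N.

Lemma Csum_minus (f g : nat -> C) n : Csum (fun k => f k - g k) n = Csum f n - Csum g n.
Proof.
  rewrite (Csum_ext _ (fun k => f k + - (1) * g k)) by (intros; ring).
  rewrite Csum_plus, Csum_scal. ring.
Qed.

Lemma Csum_switch (f : nat -> nat -> C) m n :
  Csum (fun i => Csum (f i) n) m = Csum (fun j => Csum (fun i => f i j) m) n.
Proof. exact (sum_n_switch f m n). Qed.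

Lemma Csum_diagonal m tau K :
  (1 <= m)%nat ->
  Csum (diagonal m tau) K
  = Csum (fun n => Csum (fun k => if Nat.leb (n + m * k) K then tau n k else 0) K) K.
Proof.
  intros Hm. rewrite Csum_switch.
  transitivity (Csum (fun N => Csum (fun k => if Nat.leb (m * k) N
                   then tau (N - m * k)%nat k else 0) K) K).
  - apply Csum_ext. intros N HN. unfold diagonal.
    induction HN as [|K HN IH]; [reflexivity|].
    rewrite Csum_S, IH. destruct (Nat.leb_spec (m * S K) N); [nia|]. rewrite Cplus_0_r. reflexivity.
  - rewrite Csum_switch. apply Csum_ext. intros k _.
    apply (Csum_reindex (fun n => tau n k)).
Qed.

(** Summing by rows or by the lines [n + m k = N] differs, after [K] steps, by
    terms of size at most [q^K], of which there are quadratically many. *)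
Lemma diagonal_series m (tau : nat -> nat -> C) (t : nat -> C) M q :
  (1 <= m)%nat -> (0 <= q < 1)%R ->
  (forall n k, Cmod (tau n k) <= M * q ^ (n + m * k))%R ->
  (forall n, is_series (tau n) (t n)) ->
  forall S0, is_series t S0 <-> is_series (diagonal m tau) S0.
Proof.
  intros Hm Hq Hb Ht.
  assert (HM : (0 <= M)%R).
  { pose proof (Hb O O) as H. pose proof (Cmod_ge_0 (tau O O)).
    replace (0 + m * 0)%nat with O in H by lia. simpl in H. lra. }
  assert (Hqp : forall i j, (i <= j)%nat -> (q ^ j <= q ^ i)%R).
  { intros i j Hij. destruct (Nat.le_exists_sub i j Hij) as [d [-> _]].
    rewrite pow_add. pose proof (pow_le q i ltac:(lra)).
    assert (q ^ d <= 1)%R by (rewrite <- (pow1 d); apply pow_incr; lra). nra. }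
  set (L := (M * (1 + 1 / (1 - q)))%R).
  assert (Hi : (0 <= 1 / (1 - q))%R) by (apply Rdiv_le_0_compat; lra).
  assert (HL : (0 <= L)%R) by (apply Rmult_le_pos; lra).
  assert (Hdiff : forall K, (Cmod (Csum t K - Csum (diagonal m tau) K)
                      <= L * (INR (S K) ^ 2 * q ^ K))%R).
  { intros K. rewrite Csum_diagonal by exact Hm. rewrite <- Csum_minus.
    replace (L * (INR (S K) ^ 2 * q ^ K))%R
      with (INR (S K) * (INR (S K) * (L * q ^ K)))%R by ring.
    apply Cmod_Csum_le. intros n Hn.
    destruct (geom_series (tau n) (M * q ^ n) q Hq) as [s [Hs Htail]].
    { intros k. eapply Rle_trans; [apply Hb|]. rewrite Rmult_assoc.
      apply Rmult_le_compat_l; [exact HM|]. rewrite <- pow_add. apply Hqp. nia. }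
    rewrite (is_series_C_unique _ _ _ (Ht n) Hs).
    eapply Rle_trans; [apply (Cmod_triangle_3 _ (Csum (tau n) K))|].
    assert (T1 : (Cmod (s - Csum (tau n) K) <= M * (1 / (1 - q)) * q ^ K)%R).
    { rewrite Cmod_minus_sym. eapply Rle_trans; [apply Htail|].
      replace (M * q ^ n * q ^ S K / (1 - q))%R
        with (M * (1 / (1 - q)) * (q ^ n * q ^ S K))%R by (field; lra).
      apply Rmult_le_compat_l; [apply Rmult_le_pos; assumption|].
      rewrite <- pow_add. apply Hqp. lia. }
    assert (T2 : (Cmod (Csum (tau n) K
        - Csum (fun k => if Nat.leb (n + m * k) K then tau n k else 0)%C K)
        <= INR (S K) * (M * q ^ K))%R).
    { rewrite <- Csum_minus. apply Cmod_Csum_le. intros k Hk.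
      destruct (Nat.leb_spec (n + m * k) K) as [H|H].
      - unfold Cminus. rewrite Cplus_opp_r, Cmod_0. apply Rmult_le_pos; [exact HM|].
        apply pow_le; lra.
      - replace (tau n k - 0) with (tau n k) by ring. eapply Rle_trans; [apply Hb|].
        apply Rmult_le_compat_l; [exact HM|]. apply Hqp. lia. }
    assert (HS : (1 <= INR (S K))%R) by (apply (le_INR 1); lia).
    pose proof (pow_le q K ltac:(lra)) as HqK.
    assert (0 <= M * (1 / (1 - q)) * q ^ K)%R.
    { apply Rmult_le_pos; [apply Rmult_le_pos; assumption|exact HqK]. }
    unfold L.
    replace (INR (S K) * (M * (1 + 1 / (1 - q)) * q ^ K))%R
      with (INR (S K) * (M * q ^ K) + INR (S K) * (M * (1 / (1 - q)) * q ^ K))%R by ring.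
    nra. }
  destruct (poly_geom 2 q Hq) as [P [q' [Hq' [HP [_ HG]]]]].
  assert (Hsmall : forall eps, (0 < eps)%R -> exists K0, forall K, (K0 <= K)%nat ->
            (Cmod (Csum t K - Csum (diagonal m tau) K) < eps)%R).
  { intros eps He.
    destruct (pow_small (L * P) q' eps Hq' He) as [K0 HK].
    exists K0. intros K HKK. specialize (HK K HKK).
    eapply Rle_lt_trans; [apply Hdiff|]. eapply Rle_lt_trans; [|exact HK].
    rewrite Rmult_assoc. apply Rmult_le_compat_l; [exact HL|]. apply HG. }
  intros S0. rewrite !is_series_C. split; intros H eps He.
  all: destruct (H (eps / 2)%R ltac:(lra)) as [N1 H1].
  all: destruct (Hsmall (eps / 2)%R ltac:(lra)) as [N2 H2].
  all: exists (N1 + N2)%nat; intros n Hn.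
  all: specialize (H1 n ltac:(lia)); specialize (H2 n ltac:(lia)).
  - rewrite Cmod_minus_sym in H2.
    eapply Rle_lt_trans; [apply (Cmod_triangle_3 _ (Csum t n))|]. lra.
  - eapply Rle_lt_trans; [apply (Cmod_triangle_3 _ (Csum (diagonal m tau) n))|]. lra.
Qed.

(** * The product formula for all parameters *)

Definition rho_coef (nu : R) (a b : C) (x : R) (N : nat) : C :=
  diagonal 2 (fun n k => dcoef nu a b n k * geg nu x n) N.

(** Arranged by powers of [rho], the double series is visibly holomorphic in [rho] and
    converges uniformly in [x]. *)
Definition gegenbauer_sum (nu : R) (a b : C) (x : R) (rho : C) : C :=
  CSeries (fun N => rho_coef nu a b x N * rho ^ N).

Lemma dcoef_geg_bound nu A :
  (-1 / 2 < nu)%R ->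
  exists K B, (0 <= K)%R /\ forall a b x n k,
    (Cmod a <= INR A)%R -> (Cmod b <= INR A)%R -> (-1 <= x <= 1)%R ->
    (Cmod (dcoef nu a b n k * geg nu x n)%C <= K * INR (S (n + 2 * k)) ^ B)%R.
Proof.
  intros Hnu. destruct (dcoef_bound nu A Hnu) as [K [B [HK HB]]].
  destruct (nat_above (Rabs nu)) as [D HD].
  exists K, (B + S (D + D))%nat. split; [exact HK|]. intros a b x n k Ha Hb Hx.
  rewrite Cmod_mult, Cmod_R, pow_add, <- Rmult_assoc.
  apply Rmult_le_compat; [apply Cmod_ge_0|apply Rabs_pos|apply HB; assumption|].
  eapply Rle_trans; [apply (geg_bound D nu x n HD Hx)|].
  apply pow_incr. split; [apply pos_INR|apply le_INR; lia].
Qed.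

Lemma rho_coef_bound nu A :
  (-1 / 2 < nu)%R ->
  exists K B, (0 <= K)%R /\ forall a b x N,
    (Cmod a <= INR A)%R -> (Cmod b <= INR A)%R -> (-1 <= x <= 1)%R ->
    (Cmod (rho_coef nu a b x N) <= K * INR (S N) ^ B)%R.
Proof.
  intros Hnu. destruct (dcoef_geg_bound nu A Hnu) as [K [B [HK HB]]].
  exists K, (S B). split; [exact HK|]. intros a b x N Ha Hb Hx.
  change (INR (S N) ^ S B)%R with (INR (S N) * INR (S N) ^ B)%R.
  replace (K * (INR (S N) * INR (S N) ^ B))%R with (INR (S N) * (K * INR (S N) ^ B))%R by ring.
  apply Cmod_Csum_le. intros k Hk. destruct (Nat.leb_spec (2 * k) N) as [H|H].
  - pose proof (HB a b x (N - 2 * k)%nat k Ha Hb Hx) as H1.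
    replace (N - 2 * k + 2 * k)%nat with N in H1 by lia. exact H1.
  - rewrite Cmod_0. apply Rmult_le_pos; [exact HK|apply pow_le, pos_INR].
Qed.

Lemma gegenbauer_sum_dominated nu A r :
  (-1 / 2 < nu)%R -> (0 <= r < 1)%R ->
  exists M q, (0 <= q < 1)%R /\ forall a b x rho,
    (Cmod a <= INR A)%R -> (Cmod b <= INR A)%R -> (-1 <= x <= 1)%R -> (Cmod rho <= r)%R ->
    forall N, (Cmod (rho_coef nu a b x N * rho ^ N)%C <= M * q ^ N)%R.
Proof.
  intros Hnu Hr. destruct (rho_coef_bound nu A Hnu) as [K [B [HK HB]]].
  destruct (poly_dominated K B r HK Hr) as [M [q [Hq HM]]].
  exists M, q. split; [exact Hq|]. intros a b x rho Ha Hb Hx Hrho.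
  apply HM. intros N. rewrite Cmod_mult, Cmod_pow, <- Rmult_assoc.
  apply Rmult_le_compat; [apply Cmod_ge_0|apply pow_le, Cmod_ge_0|apply HB; assumption|].
  apply pow_incr. split; [apply Cmod_ge_0|exact Hrho].
Qed.

Lemma gegenbauer_sum_series nu a b x rho :
  (-1 / 2 < nu)%R -> (-1 <= x <= 1)%R -> (Cmod rho < 1)%R ->
  is_series (fun N => rho_coef nu a b x N * rho ^ N) (gegenbauer_sum nu a b x rho).
Proof.
  intros Hnu Hx Hr. destruct (nat_above (Cmod a + Cmod b)) as [A HA].
  pose proof (Cmod_ge_0 a). pose proof (Cmod_ge_0 b).
  destruct (gegenbauer_sum_dominated nu A (Cmod rho) Hnu (conj (Cmod_ge_0 _) Hr)) as [M [q [Hq HM]]].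
  apply (dominated_CSeries _ M q Hq), HM; lra || assumption.
Qed.

Lemma gegenbauer_sum_sym nu a b x rho : gegenbauer_sum nu a b x rho = gegenbauer_sum nu b a x rho.
Proof.
  unfold gegenbauer_sum. f_equal. apply FunctionalExtensionality.functional_extensionality.
  intros N. f_equal. apply Csum_ext. intros k _.
  destruct (Nat.leb (2 * k) N); [|reflexivity]. rewrite dcoef_sym. reflexivity.
Qed.

Lemma hyp_sym a b c t : hyp a b c t = hyp b a c t.
Proof.
  unfold hyp. f_equal. apply FunctionalExtensionality.functional_extensionality.
  intros N. unfold hyp_term. ring.
Qed.

Lemma entire_gegenbauer_sum nu b x rho :
  (-1 / 2 < nu)%R -> (-1 <= x <= 1)%R -> (Cmod rho < 1)%R ->
  entire (fun a => gegenbauer_sum nu a b x rho).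
Proof.
  intros Hnu Hx Hr.
  apply (entire_series (fun N a => rho_coef nu a b x N * rho ^ N)).
  - intros N. apply (entire_mult (fun a => rho_coef nu a b x N) (fun _ => rho ^ N));
      [|apply entire_const].
    unfold rho_coef, diagonal.
    apply (entire_Csum (fun k a => if Nat.leb (2 * k) N then
             dcoef nu a b (N - 2 * k) k * geg nu x (N - 2 * k) else 0)).
    intros k. destruct (Nat.leb (2 * k) N); [|apply entire_const].
    apply (entire_mult (fun a => dcoef nu a b (N - 2 * k) k)); [apply entire_dcoef|apply entire_const].
  - intros a. apply gegenbauer_sum_series; assumption.
  - intros R0. destruct (nat_above (Rabs R0 + Cmod b)) as [A HA].
    pose proof (Cmod_ge_0 b). pose proof (Rabs_pos R0).
    destruct (gegenbauer_sum_dominated nu A (Cmod rho) Hnu (conj (Cmod_ge_0 _) Hr)) as [M [q [Hq HM]]].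
    exists M, q. split; [exact Hq|]. intros n z Hz.
    apply (HM z b x rho); try lra; try assumption.
    pose proof (Rle_abs R0). lra.
Qed.

Lemma Csum_RtoC (f : nat -> R) n : Csum (fun k => RtoC (f k)) n = Rsum f n.
Proof.
  induction n as [|n IH]; [rewrite Csum_0, Rsum_0; reflexivity|].
  rewrite Csum_S, Rsum_S, IH, RtoC_plus. reflexivity.
Qed.

Lemma is_series_RtoC (f : nat -> R) (l : R) :
  is_lim_seq (Rsum f) l -> is_series (fun n => RtoC (f n)) (RtoC l).
Proof.
  intros H. apply is_series_C. intros eps He. apply is_lim_seq_spec in H.
  destruct (H (mkposreal eps He)) as [N HN]. exists N. intros n Hn.
  rewrite Csum_RtoC, <- RtoC_minus, Cmod_R. apply HN, Hn.
Qed.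

Lemma is_series_RtoC_inv (f : nat -> R) (z : C) :
  is_series (fun n => RtoC (f n)) z -> is_lim_seq (Rsum f) (Re z) /\ z = RtoC (Re z).
Proof.
  intros H. rewrite is_series_C in H.
  assert (HL : is_lim_seq (Rsum f) (Re z)).
  { apply is_lim_seq_spec. intros eps. destruct (H eps (cond_pos eps)) as [N HN].
    exists N. intros n Hn. specialize (HN n Hn). rewrite Csum_RtoC in HN.
    eapply Rle_lt_trans; [|exact HN]. apply (re_le_Cmod (Rsum f n - z)). }
  split; [exact HL|].
  apply (is_series_C_unique (fun n => RtoC (f n))).
  - apply is_series_C, H.
  - apply is_series_RtoC, HL.
Qed.

Lemma hyp_real (a b c t : R) p :
  (0 < c)%R ->
  hyp_term a b c t p = rGamma c * RtoC (rpoch a p * rpoch b p * (coef0F1 c p * t ^ p)).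
Proof.
  intros Hc. unfold hyp_term. rewrite (rGamma_poch c p), !RtoC_poch.
  pose proof (rpoch_pos c p Hc) as Hp. pose proof (INR_fact_lt_0 p) as Hf.
  assert (E : (coef0F1 c p * t ^ p)%R = (/ rpoch c p * (t ^ p / INR (fact p)))%R).
  { unfold coef0F1. field. lra. }
  rewrite E, !RtoC_mult, RtoC_div, RtoC_inv, RtoC_pow by lra.
  field. split; apply RtoC_neq; lra.
Qed.

Lemma pos_not_nonpos (c : R) : (0 < c)%R -> ~ nonpos_int c.
Proof.
  intros Hc [k Hk]. rewrite <- RtoC_opp in Hk. apply RtoC_inj in Hk.
  pose proof (pos_INR k). lra.
Qed.

(** The connection formula, with the constants of [hom_geg]. *)
Lemma rho_coef_ray nu (a b : R) Y s N :
  (-1 / 2 < nu)%R -> nu <> 0%R -> (1 <= a)%R -> (1 <= b)%R ->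
  (0 < ray_v Y s - ray_u Y s)%R ->
  rho_coef nu a b ((ray_u Y s + ray_v Y s) / (ray_v Y s - ray_u Y s)) N
    * (ray_v Y s - ray_u Y s)%R ^ N
  = nu * rGamma ((a + b) / 2 + 1 / 2)%R ^ 2
      * RtoC (rpoch a N * rpoch b N * ray ((a + b) / 2 + 1 / 2) Y N s).
Proof.
  intros Hnu Hnu0 Ha Hb Hr. unfold ray.
  set (u := ray_u Y s) in *. set (v := ray_v Y s) in *.
  set (mu := ((a + b) / 2)%R). set (c := (mu + 1 / 2)%R).
  set (x := ((u + v) / (v - u))%R).
  assert (Hmu : (1 <= mu)%R) by (unfold mu; lra).
  unfold c. rewrite hom_geg by lra. fold c x.
  rewrite (geg_connection mu nu x Hnu Hnu0 N).
  pose proof (rpoch_pos (2 * mu) N ltac:(lra)) as P1.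
  pose proof (rpoch_pos c N ltac:(unfold c; lra)) as P2.
  set (t := fun k => ((nu + INR N - 2 * INR k) * conn mu nu (N - k) k * geg_down nu x N k)%R).
  replace (rpoch a N * rpoch b N * ((v - u) ^ N * Rsum t N / (rpoch (2 * mu) N * rpoch c N)))%R
    with (rpoch a N * rpoch b N / (rpoch (2 * mu) N * rpoch c N) * Rsum t N * (v - u) ^ N)%R
    by (field; lra).
  rewrite RtoC_mult, (RtoC_pow (v - u)), Cmult_assoc. f_equal.
  rewrite <- Rsum_scal, <- Csum_RtoC, <- Csum_scal.
  unfold rho_coef, diagonal. apply Csum_ext. intros k Hk. unfold t, geg_down.
  destruct (Nat.leb_spec (2 * k) N) as [H|H].
  2:{ rewrite !Rmult_0_r. ring. }
  destruct (Nat.le_exists_sub (2 * k) N H) as [n [E _]]. 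
  replace (N - 2 * k)%nat with n by lia. replace (N - k)%nat with (n + k)%nat by lia.
  assert (EN : N = (n + 2 * k)%nat) by lia. clear E Hk H. subst N.
  assert (Ec : (RtoC a + RtoC b + 1) / 2 = RtoC c).
  { unfold c, mu. rewrite RtoC_plus, !RtoC_div, RtoC_plus by lra. field. }
  assert (Em : (RtoC a + RtoC b) / 2 = RtoC mu).
  { unfold mu. rewrite RtoC_div, RtoC_plus by lra. reflexivity. }
  assert (Es : RtoC a + RtoC b = RtoC (2 * mu)).
  { unfold mu. rewrite <- RtoC_plus. f_equal. field. }
  rewrite (dcoef_generic nu a b n k Hnu).
  - rewrite Ec, Em, Es, nu1_poch, <- RtoC_minus, !RtoC_poch.
    unfold conn.
    assert (P3 : (0 < rpoch (nu + 1) (n + k))%R) by (apply rpoch_pos; lra).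
    assert (E5 : rpoch nu (S (n + k)) = (nu * rpoch (nu + 1) (n + k))%R).
    { apply RtoC_inj. rewrite RtoC_mult, <- !RtoC_poch, poch_Sl, RtoC_plus. reflexivity. }
    rewrite E5. pose proof (INR_fact_lt_0 k) as P4.
    replace (nu + INR (n + 2 * k) - 2 * INR k)%R with (nu + INR n)%R
      by (rewrite plus_INR, mult_INR; simpl (INR 2); ring).
    repeat rewrite ?RtoC_mult, ?RtoC_plus.
    rewrite !RtoC_div by (repeat apply Rmult_integral_contrapositive_currified; lra).
    repeat rewrite ?RtoC_mult, ?RtoC_plus.
    field. repeat split; apply RtoC_neq; lra.
  - rewrite Es, RtoC_poch. apply RtoC_neq. lra.
  - rewrite Ec, RtoC_poch. apply RtoC_neq. lra.
Qed.

(** [product_formula_real] with the factor [1/Gamma(c)^2] restored. *)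
Lemma product_formula_pos nu (a b : R) Y s :
  (-1 / 2 < nu)%R -> nu <> 0%R -> (1 <= a)%R -> (1 <= b)%R ->
  (0 <= Y)%R -> (0 <= s)%R -> (0 < Y + s < 1)%R ->
  gegenbauer_sum nu a b ((ray_u Y s + ray_v Y s) / (ray_v Y s - ray_u Y s))
    (ray_v Y s - ray_u Y s)%R
  = nu * (hyp a b ((a + b + 1) / 2) (- s)%R * hyp a b ((a + b + 1) / 2) Y).
Proof.
  intros Hnu Hnu0 Ha Hb HY Hs Hlt.
  set (c := ((a + b) / 2 + 1 / 2)%R). assert (Hc : (0 < c)%R) by (unfold c; lra).
  assert (Ec : (RtoC a + RtoC b + 1) / 2 = RtoC c).
  { unfold c. rewrite RtoC_plus, !RtoC_div, RtoC_plus by lra. field. }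
  assert (Hr0 : (ray_v Y s - ray_u Y s = Y + s)%R) by (unfold ray_u, ray_v; ring).
  rewrite Ec.
  assert (HG : forall t : R, (Rabs t < 1)%R -> exists g : R,
    hyp a b c t = rGamma c * g /\
    is_lim_seq (Rsum (fun p => rpoch a p * rpoch b p * (coef0F1 c p * t ^ p))%R) g).
  { intros t Ht. pose proof (hyp_series a b c t ltac:(rewrite Cmod_R; exact Ht)) as HS.
    pose proof (rGamma_neq_0 c (pos_not_nonpos c Hc)) as H0.
    apply (is_series_Cmult (/ rGamma c)) in HS.
    apply (is_series_C_ext _ (fun p => RtoC (rpoch a p * rpoch b p * (coef0F1 c p * t ^ p)))) in HS.
    - destruct (is_series_RtoC_inv _ _ HS) as [HL HZ].
      exists (Re (/ rGamma c * hyp a b c t)). split; [|exact HL].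
      rewrite <- HZ. field. exact H0.
    - intros p. rewrite hyp_real by exact Hc. field. exact H0. }
  destruct (HG Y) as [G1 [E1 L1]]; [rewrite Rabs_pos_eq; lra|].
  destruct (HG (- s)%R) as [G2 [E2 L2]]; [rewrite Rabs_Ropp, Rabs_pos_eq; lra|].
  rewrite E1, E2.
  pose proof (product_formula_real a b Ha Hb Y s G1 G2 HY Hs ltac:(lra) L1 L2) as HP.
  apply is_series_RtoC in HP.
  apply (is_series_Cmult (nu * rGamma c ^ 2)) in HP.
  unfold gegenbauer_sum. rewrite (CSeries_eq _ _ (is_series_C_ext _ _ _ (fun N =>
     eq_sym (rho_coef_ray nu a b Y s N Hnu Hnu0 Ha Hb ltac:(lra))) HP)).
  rewrite RtoC_mult. ring.
Qed.

(** Both sides are entire in [a] and in [b], so the positive real case implies the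
    general one. *)
Lemma product_formula nu (a b : C) Y s :
  (-1 / 2 < nu)%R -> nu <> 0%R ->
  (0 <= Y)%R -> (0 <= s)%R -> (0 < Y + s < 1)%R ->
  gegenbauer_sum nu a b ((ray_u Y s + ray_v Y s) / (ray_v Y s - ray_u Y s))
    (ray_v Y s - ray_u Y s)%R
  = nu * (hyp a b ((a + b + 1) / 2) (- s)%R * hyp a b ((a + b + 1) / 2) Y).
Proof.
  intros Hnu Hnu0 HY Hs Hlt.
  set (x := ((ray_u Y s + ray_v Y s) / (ray_v Y s - ray_u Y s))%R).
  set (r := (ray_v Y s - ray_u Y s)%R).
  assert (Hr : (r = Y + s)%R) by (unfold r, ray_u, ray_v; ring).
  assert (Hr1 : (Cmod r < 1)%R) by (rewrite Cmod_R, Rabs_pos_eq; lra).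
  assert (HY1 : (Cmod Y < 1)%R) by (rewrite Cmod_R, Rabs_pos_eq; lra).
  assert (Hs1 : (Cmod (- s)%R < 1)%R) by (rewrite Cmod_R, Rabs_Ropp, Rabs_pos_eq; lra).
  assert (Hx : (-1 <= x <= 1)%R).
  { assert (ray_u Y s <= 0)%R by (unfold ray_u; nra).
    assert (0 <= ray_v Y s)%R by (unfold ray_v; nra).
    fold r in x. unfold x. fold r.
    split; [apply Rle_div_r; unfold r in *; lra|apply Rle_div_l; unfold r in *; lra]. }
  set (D := fun a b => gegenbauer_sum nu a b x r
              + - nu * (hyp a b ((a + b + 1) / 2) (- s)%R * hyp a b ((a + b + 1) / 2) Y)).
  assert (HD : forall b, entire (fun a => D a b)).
  { intros b0. unfold D. apply entire_plus; [apply entire_gegenbauer_sum; assumption|].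
    apply entire_mult; [apply entire_const|].
    assert (HE : forall t : R, (Cmod t < 1)%R ->
              entire (fun a => hyp a b0 ((a + b0 + 1) / 2) t)).
    { intros t Ht.
      apply (entire_ext (fun a => hyp (1 * a + 0) (0 * a + b0) (/ 2 * a + (b0 + 1) / 2) t)).
      - intros z. f_equal; field.
      - apply entire_hyp, Ht. }
    apply entire_mult; apply HE; assumption. }
  assert (Hsym : forall a b, D a b = D b a).
  { intros a0 b0. unfold D. rewrite gegenbauer_sum_sym, !(hyp_sym a0 b0), (Cplus_comm a0 b0). reflexivity. }
  assert (Hpos : forall a b : R, (Rabs (a - 2) < 1)%R -> (Rabs (b - 2) < 1)%R -> D a b = 0).
  { intros a0 b0 Ha Hb. apply Rabs_def2 in Ha. apply Rabs_def2 in Hb.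
    unfold D, x, r. rewrite product_formula_pos by (assumption || lra). ring. }
  assert (H1 : forall (b : R) a, (Rabs (b - 2) < 1)%R -> D a b = 0).
  { intros b0 a0 Hb. apply (entire_zero (fun a => D a b0) 2 1); [lra|apply HD|].
    intros t Ht. apply Hpos; assumption. }
  assert (H2 : forall a b, D a b = 0).
  { intros a0 b0. rewrite Hsym.
    apply (entire_zero (fun b => D b a0) 2 1); [lra|apply HD|].
    intros t Ht. rewrite Hsym. apply H1, Ht. }
  apply Cminus_eq_0. rewrite <- (H2 a b). unfold D. ring.
Qed.

(** * Euler's transformation *)

(** The sum [S] of the series satisfies [(1 - t) S' = s S], so [S (1 - t)^s] is
    constant. *)
Lemma binomial_pos (s t : R) :
  (0 < s)%R -> (Rabs t < 1)%R ->
  is_lim_seq (Rsum (fun j => rpoch s j / INR (fact j) * t ^ j)%R) (exp (- s * ln (1 - t))).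
Proof.
  intros Hs Ht. set (a := fun j => (rpoch s j / INR (fact j))%R).
  destruct (nat_above s) as [A HA].
  assert (Ha : forall j, (0 <= a j <= INR (S j) ^ A)%R).
  { intros j. pose proof (rpoch_pos s j Hs) as Hp. pose proof (INR_fact_lt_0 j) as Hf.
    split; [apply Rdiv_le_0_compat; lra|]. apply Rle_div_l; [exact Hf|].
    pose proof (poch_bound A j s) as HB.
    rewrite RtoC_poch, !Cmod_R, !Rabs_pos_eq in HB by lra. rewrite Rmult_comm. apply HB, HA. }
  assert (Hcv : forall u, (Rabs u < 1)%R -> Rbar_lt (Rabs u) (CV_radius a)).
  { intros u Hu. pose proof (Rabs_pos u) as Hu0.
    set (v := ((Rabs u + 1) / 2)%R). assert (Hv : (0 <= v < 1)%R) by (unfold v; lra).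
    apply Rbar_lt_le_trans with v; [simpl; unfold v; lra|].
    apply (proj1 (CV_radius_bounded a)).
    destruct (poly_geom A v Hv) as [M [q [Hq [HM [_ HG]]]]]. exists M. intros n.
    rewrite Rabs_mult, <- RPow_abs, !Rabs_pos_eq by (lra || apply Ha).
    eapply Rle_trans; [apply Rmult_le_compat_r; [apply pow_le; lra|apply Ha]|].
    eapply Rle_trans; [apply HG|].
    assert (q ^ n <= 1)%R by (rewrite <- (pow1 n); apply pow_incr; lra). nra. }
  assert (Hode : forall u, (Rabs u < 1)%R ->
            ((1 - u) * PSeries (PS_derive a) u = s * PSeries a u)%R).
  { intros u Hu.
    assert (E : PSeries (PS_derive a) u
                = (s * PSeries a u + u * PSeries (PS_derive a) u)%R).
    { rewrite <- PSeries_scal, <- PSeries_incr_1, <- PSeries_plus.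
      - apply PSeries_ext. intros n.
        assert (Ed : forall m, PS_derive a m = ((s + INR m) * a m)%R).
        { intros m. unfold PS_derive, a. rewrite rpoch_S, fact_simpl, mult_INR. field.
          split; [apply INR_fact_neq_0|apply not_0_INR; lia]. }
        unfold PS_plus, PS_scal, PS_incr_1.
        change (PS_derive a n = s * a n + match n with O => 0 | S m => PS_derive a m end)%R.
        destruct n as [|m]; rewrite Ed; [simpl; ring|].
        unfold PS_derive. ring.
      - apply ex_pseries_scal; [intros; apply Rmult_comm|].
        apply CV_radius_inside, Hcv, Hu.
      - apply ex_pseries_incr_1, CV_radius_inside. rewrite CV_radius_derive.
        apply Hcv, Hu. }
    lra. }
  set (psi := fun u => (PSeries a u * exp (s * ln (1 - u)))%R).
  assert (Hpsi : forall u, (Rabs u < 1)%R -> is_derive psi u 0%R).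
  { intros u Hu. apply Rabs_def2 in Hu as Hu'. unfold psi. evar_last.
    - apply (is_derive_mult (PSeries a) (fun u => exp (s * ln (1 - u)))%R u).
      + apply is_derive_PSeries, Hcv, Hu.
      + auto_derive; [lra|reflexivity].
      + intros; apply Rmult_comm.
    - unfold plus, mult; simpl. pose proof (Hode u Hu) as HO.
      apply (Rmult_eq_reg_l (1 - u)); [|lra].
      transitivity (exp (s * ln (1 - u)) * ((1 - u) * PSeries (PS_derive a) u
                      - s * PSeries a u))%R.
      + unfold Rminus. field. lra.
      + rewrite HO. ring. }
  assert (Hconst : psi t = 1%R).
  { assert (E0 : psi 0%R = 1%R).
    { unfold psi. rewrite PSeries_0, Rminus_0_r, ln_1, Rmult_0_r, exp_0. unfold a. simpl. field. }
    rewrite <- E0. destruct (Rle_lt_dec 0 t) as [h|h].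
    - rewrite Rabs_pos_eq in Ht by exact h.
      apply Rle_antisym.
      + apply Ropp_le_cancel.
        apply (derive_nonneg_le (fun u => - psi u)%R (fun _ => 0%R)); [exact h| |intros; lra].
        intros u Hu. rewrite <- Ropp_0. apply (is_derive_opp psi), Hpsi. rewrite Rabs_pos_eq; lra.
      + apply (derive_nonneg_le psi (fun _ => 0%R)); [exact h| |intros; lra].
        intros u Hu. apply Hpsi. rewrite Rabs_pos_eq; lra.
    - rewrite Rabs_left in Ht by exact h.
      apply Rle_antisym.
      + apply (derive_nonneg_le psi (fun _ => 0%R)); [lra| |intros; lra].
        intros u Hu. apply Hpsi. apply Rabs_def1; lra.
      + apply Ropp_le_cancel.
        apply (derive_nonneg_le (fun u => - psi u)%R (fun _ => 0%R)); [lra| |intros; lra].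
        intros u Hu. rewrite <- Ropp_0. apply (is_derive_opp psi), Hpsi. apply Rabs_def1; lra. }
  assert (Hval : PSeries a t = exp (- s * ln (1 - t))).
  { unfold psi in Hconst. replace (- s * ln (1 - t))%R with (- (s * ln (1 - t)))%R by ring.
    rewrite exp_Ropp. pose proof (exp_pos (s * ln (1 - t))).
    apply (Rmult_eq_reg_r (exp (s * ln (1 - t)))); [|lra]. rewrite Hconst. field. lra. }
  rewrite <- Hval.
  pose proof (PSeries_correct a t (CV_radius_inside a t (Hcv t Ht))) as HP.
  apply is_pseries_R in HP. exact HP.
Qed.

Definition binom_term (s t : C) (j : nat) : C := poch s j / INR (fact j) * t ^ j.

Lemma binom_dominated A r :
  (0 <= r < 1)%R ->
  exists M q, (0 <= q < 1)%R /\ forall s t, (Cmod s <= INR A)%R -> (Cmod t <= r)%R ->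
    forall j, (Cmod (binom_term s t j) <= M * q ^ j)%R.
Proof.
  intros Hr. destruct (poly_dominated 1 A r Rle_0_1 Hr) as [M [q [Hq HM]]].
  exists M, q. split; [exact Hq|]. intros s t Hs Ht. apply HM. intros j.
  unfold binom_term. rewrite Cmod_mult, Cmod_div, Cmod_pow, Cmod_INR, Rmult_1_l
    by apply INR_fact_neq.
  pose proof (INR_fact_lt_0 j) as Hf.
  apply Rmult_le_compat; [apply Rdiv_le_0_compat; [apply Cmod_ge_0|exact Hf]
    |apply pow_le, Cmod_ge_0| |apply pow_incr; split; [apply Cmod_ge_0|exact Ht]].
  apply Rle_div_l; [exact Hf|]. rewrite Rmult_comm. apply poch_bound, Hs.
Qed.

(** The binomial series with complex exponent, by the identity theorem in the
    exponent. *)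
Lemma binomial_series (s : C) (t : R) :
  (Rabs t < 1)%R -> is_series (binom_term s t) (Cexp (- ln (1 - t)%R * s)).
Proof.
  intros Ht. assert (Ht1 : (Cmod t < 1)%R) by (rewrite Cmod_R; exact Ht).
  assert (HS : forall s, is_series (binom_term s t) (CSeries (binom_term s t))).
  { intros s0. destruct (nat_above (Cmod s0)) as [A HA].
    destruct (binom_dominated A (Cmod t) (conj (Cmod_ge_0 t) Ht1)) as [M [q [Hq HM]]].
    apply (dominated_CSeries _ M q Hq), HM; [exact HA|lra]. }
  set (D := fun s => CSeries (binom_term s t) + - (1) * Cexp (- ln (1 - t)%R * s)).
  assert (HD : entire D).
  { apply entire_plus.
    - apply (entire_series (fun j s => binom_term s t j)); [| |].
      + intros j. unfold binom_term, Cdiv.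
        apply (entire_mult (fun s => poch s j * / INR (fact j)) (fun _ => t ^ j));
          [|apply entire_const].
        apply (entire_mult (fun s => poch s j) (fun _ => / INR (fact j)));
          [apply entire_poch|apply entire_const].
      + exact HS.
      + intros R0. destruct (nat_above (Rabs R0)) as [A HA].
        destruct (binom_dominated A (Cmod t) (conj (Cmod_ge_0 t) Ht1)) as [M [q [Hq HM]]].
        exists M, q. split; [exact Hq|]. intros n z Hz. apply HM; [|lra].
        pose proof (Rle_abs R0). lra.
    - apply entire_mult; [apply entire_const|].
      apply (entire_affine2 Cexp (- ln (1 - t)%R) 0); [apply entire_Cexp|intros; ring]. }
  assert (H0 : D s = 0).
  { apply (entire_zero D 2 1); [lra|exact HD|]. intros u Hu. apply Rabs_def2 in Hu.
    pose proof (is_series_RtoC _ _ (binomial_pos u t ltac:(lra) Ht)) as HB.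
    unfold D. rewrite (CSeries_eq (binom_term u t) (RtoC (exp (- u * ln (1 - t))))).
    - replace (- ln (1 - t)%R * u) with (RtoC (- u * ln (1 - t)))
        by (rewrite RtoC_mult, RtoC_opp; ring).
      rewrite Cexp_R. ring.
    - eapply is_series_C_ext; [|exact HB]. intros n. simpl. unfold binom_term.
      rewrite RtoC_poch, RtoC_mult, RtoC_div, RtoC_pow by apply INR_fact_neq_0. reflexivity. }
  replace (Cexp (- ln (1 - t)%R * s)) with (CSeries (binom_term s t)); [apply HS|].
  apply Cminus_eq_0. rewrite <- H0. unfold D. ring.
Qed.

(** Saalschuetz's sum. With [F_k] and [B_j] the coefficients of the two factors,
    [(n+1)(c+n) F_k B_(n+1-k) - (c-a+n)(c-b+n) F_k B_(n-k)] is the difference of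
    [- k (c+k-1) F_k B_(n+1-k)] at [k+1] and [k], so the sums over [k] satisfy a
    first-order recurrence in [n]. *)
Lemma saalschutz (a b c : C) n :
  (forall k, poch c k <> 0) ->
  Csum (fun k => poch a k * poch b k / (poch c k * INR (fact k))
                 * (poch (c - a - b) (n - k) / INR (fact (n - k)))) n
  = poch (c - a) n * poch (c - b) n / (poch c n * INR (fact n)).
Proof.
  intros Hc. set (s := c - a - b).
  set (F := fun k => poch a k * poch b k / (poch c k * INR (fact k))).
  set (B := fun j => poch s j / INR (fact j)).
  set (y := fun n => Csum (fun k => F k * B (n - k)%nat) n).
  change (y n = poch (c - a) n * poch (c - b) n / (poch c n * INR (fact n))).
  assert (Hcn : forall n, c + INR n <> 0).
  { intros m h. apply (Hc (S m)). rewrite poch_S, h. ring. }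
  assert (HF : forall k, (INR k + 1) * (c + INR k) * F (S k) = (a + INR k) * (b + INR k) * F k).
  { intros k. unfold F. rewrite !poch_S, fact_simpl, mult_INR, RtoC_mult, INR_S_C. field.
    repeat split; try apply Hcn; try apply Hc; try apply INR_fact_neq.
    rewrite <- INR_S_C. apply INR_S_neq. }
  assert (HB : forall j, (INR j + 1) * B (S j) = (s + INR j) * B j).
  { intros j. unfold B. rewrite !poch_S, fact_simpl, mult_INR, RtoC_mult, INR_S_C. field.
    split; [apply INR_fact_neq|]. rewrite <- INR_S_C. apply INR_S_neq. }
  set (G := fun n k => - (INR k * (c + INR k - 1) * F k * B (S n - k)%nat)).
  assert (Hstep : forall n k, (k <= n)%nat ->
    (INR n + 1) * (c + INR n) * (F k * B (S n - k)%nat)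
    - (c - a + INR n) * (c - b + INR n) * (F k * B (n - k)%nat)
    = G n (S k) - G n k).
  { intros m k Hk. unfold G.
    destruct (Nat.le_exists_sub k m Hk) as [j [-> _]].
    replace (S (j + k) - k)%nat with (S j) by lia.
    replace (j + k - k)%nat with j by lia.
    replace (S (j + k) - S k)%nat with j by lia.
    rewrite (INR_S_C k), plus_INR, RtoC_plus.
    replace ((INR k + 1) * (c + (INR k + 1) - 1) * F (S k) * B j)
      with ((INR k + 1) * (c + INR k) * F (S k) * B j) by ring.
    rewrite HF.
    assert (Hj : INR j + 1 <> 0) by (rewrite <- INR_S_C; apply INR_S_neq).
    apply (Cmult_cancel_l (INR j + 1)); [exact Hj|].
    assert (E : B (S j) = (s + INR j) * B j / (INR j + 1)).
    { rewrite <- HB. field. exact Hj. }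
    rewrite E. unfold s. field. exact Hj. }
  assert (Htel : forall n m, (m <= n)%nat ->
    Csum (fun k => (INR n + 1) * (c + INR n) * (F k * B (S n - k)%nat)
      - (c - a + INR n) * (c - b + INR n) * (F k * B (n - k)%nat)) m
    = G n (S m)).
  { intros p m. induction m as [|m IH]; intros Hm.
    - rewrite Csum_0, Hstep by lia. unfold G at 2. simpl (INR 0). ring.
    - rewrite Csum_S, IH, Hstep by lia. ring. }
  assert (Hrec : forall n, (INR n + 1) * (c + INR n) * y (S n)
                   = (c - a + INR n) * (c - b + INR n) * y n).
  { intros m. pose proof (Htel m m (Nat.le_refl m)) as HT.
    rewrite Csum_minus, !Csum_scal in HT. unfold y at 1. rewrite Csum_S.
    fold (y m) in HT.
    rewrite Cmult_plus_distr_l.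
    replace ((INR m + 1) * (c + INR m) * (F (S m) * B (S m - S m)%nat)) with (- G m (S m)).
    2:{ unfold G. rewrite INR_S_C. ring. }
    rewrite <- HT. ring. }
  induction n as [|n IH].
  - unfold y. rewrite Csum_0. unfold F, B. simpl. field.
  - assert (Hn1 : INR n + 1 <> 0) by (rewrite <- INR_S_C; apply INR_S_neq).
    apply (Cmult_cancel_l ((INR n + 1) * (c + INR n))).
    { apply Cmult_neq_0; [exact Hn1|apply Hcn]. }
    rewrite Hrec, IH, !poch_S, fact_simpl, mult_INR, RtoC_mult, INR_S_C. field.
    repeat split; try apply Hcn; try apply Hc; try apply INR_fact_neq; exact Hn1.
Qed.

(** The Cauchy product of the binomial series with the Gauss series, evaluated by
    Saalschuetz's sum. *)
Lemma euler_pos (a b : C) (c t : R) :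
  (0 < c)%R -> (Rabs t < 1)%R ->
  hyp (c - a) (c - b) c t = Cexp (- ln (1 - t)%R * (c - a - b)) * hyp a b c t.
Proof.
  intros Hc Ht. assert (Ht1 : (Cmod t < 1)%R) by (rewrite Cmod_R; exact Ht).
  assert (Hpc : forall k, poch c k <> 0).
  { intros k. rewrite RtoC_poch. apply RtoC_neq, Rgt_not_eq, rpoch_pos, Hc. }
  set (s := c - a - b).
  destruct (nat_above (Cmod a + Cmod b + Cmod c + Cmod s)) as [A HA].
  pose proof (Cmod_ge_0 a). pose proof (Cmod_ge_0 b). pose proof (Cmod_ge_0 c).
  pose proof (Cmod_ge_0 s).
  destruct (binom_dominated A (Cmod t) (conj (Cmod_ge_0 t) Ht1)) as [M1 [q1 [Hq1 HM1]]].
  specialize (HM1 s t ltac:(lra) ltac:(lra)).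
  destruct (hyp_term_bound A) as [K [B [HK HB]]].
  destruct (poly_dominated K B (Cmod t) HK (conj (Cmod_ge_0 t) Ht1)) as [M2 [q2 [Hq2 HM2]]].
  specialize (HM2 (hyp_term a b c t)).
  assert (HM2' : forall n, (Cmod (hyp_term a b c t n) <= M2 * q2 ^ n)%R).
  { apply HM2. intros p. apply HB; lra. }
  assert (HP : forall M q (f : nat -> C), (forall n, Cmod (f n) <= M * q ^ n)%R -> (0 <= M)%R).
  { intros M q f Hf. pose proof (Hf O) as h. pose proof (Cmod_ge_0 (f O)). simpl in h. lra. }
  pose proof (HP _ _ _ HM1) as HM1p. pose proof (HP _ _ _ HM2') as HM2p.
  set (q := Rmax q1 q2).
  assert (Hq : (0 <= q < 1)%R).
  { unfold q. split; [apply Rle_trans with q1; [lra|apply Rmax_l]|apply Rmax_lub_lt; lra]. }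
  assert (HT : forall n k, (Cmod (binom_term s t n * hyp_term a b c t k)%C
                   <= M1 * M2 * q ^ (n + 1 * k))%R).
  { intros n k. rewrite Cmod_mult, Nat.mul_1_l, pow_add.
    replace (M1 * M2 * (q ^ n * q ^ k))%R with (M1 * q ^ n * (M2 * q ^ k))%R by ring.
    apply Rmult_le_compat; try apply Cmod_ge_0.
    - eapply Rle_trans; [apply HM1|]. apply Rmult_le_compat_l; [exact HM1p|].
      apply pow_incr. split; [lra|apply Rmax_l].
    - eapply Rle_trans; [apply HM2'|]. apply Rmult_le_compat_l; [exact HM2p|].
      apply pow_incr. split; [lra|apply Rmax_r]. }
  pose proof (diagonal_series 1 (fun n k => binom_term s t n * hyp_term a b c t k)
    (fun n => binom_term s t n * hyp a b c t) (M1 * M2) q (Nat.le_refl 1) Hq HT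
    (fun n => is_series_Cmult _ _ _ (hyp_series a b c t Ht1))) as HD2.
  assert (HS : is_series (fun n => binom_term s t n * hyp a b c t)
                 (Cexp (- ln (1 - t)%R * s) * hyp a b c t)).
  { apply (is_series_C_ext (fun n => hyp a b c t * binom_term s t n)); [intros; ring|].
    rewrite Cmult_comm. apply is_series_Cmult, binomial_series, Ht. }
  apply HD2 in HS. 
  apply CSeries_eq. eapply is_series_C_ext; [|exact HS].
  intros n. unfold diagonal, hyp_term.
  pose proof (saalschutz a b c n Hpc) as HZ.
  replace (poch (c - a) n * poch (c - b) n * rGamma (c + INR n) * (t ^ n / INR (fact n)))
    with (rGamma c * t ^ n * (poch (c - a) n * poch (c - b) n / (poch c n * INR (fact n)))).
  2:{ rewrite (rGamma_poch c n). field. split; [apply INR_fact_neq|apply Hpc]. }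
  rewrite <- HZ, <- Csum_scal. apply Csum_ext. intros k Hk.
  rewrite Nat.mul_1_l. destruct (Nat.leb_spec k n); [|lia].
  rewrite (rGamma_poch c k). unfold binom_term. fold s.
  replace (t ^ n) with (t ^ (n - k) * t ^ k).
  2:{ rewrite <- Cpow_add_r. f_equal. lia. }
  field. repeat split; try apply INR_fact_neq; apply Hpc.
Qed.

(** For [c] in [{0, -1, -2, ...}] the quotient by [(c)_n] in [saalschutz] has no
    meaning; both sides here are entire in [c]. *)
Lemma euler_transformation (a b c : C) (t : R) :
  (Rabs t < 1)%R ->
  hyp (c - a) (c - b) c t = Cexp (- ln (1 - t)%R * (c - a - b)) * hyp a b c t.
Proof.
  intros Ht. assert (Ht1 : (Cmod t < 1)%R) by (rewrite Cmod_R; exact Ht).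
  set (D := fun c => hyp (c - a) (c - b) c t
              + - (1) * (Cexp (- ln (1 - t)%R * (c - a - b)) * hyp a b c t)).
  assert (H0 : D c = 0).
  { apply (entire_zero D 2 1); [lra| |].
    - apply entire_plus.
      + apply (entire_ext (fun z => hyp (1 * z + - a) (1 * z + - b) (1 * z + 0) t)).
        { intros z. f_equal; ring. }
        apply entire_hyp, Ht1.
      + apply entire_mult; [apply entire_const|]. apply entire_mult.
        * apply (entire_affine2 Cexp (- ln (1 - t)%R) (- ln (1 - t)%R * (- a - b)));
            [apply entire_Cexp|intros; ring].
        * apply (entire_ext (fun z => hyp (0 * z + a) (0 * z + b) (1 * z + 0) t)).
          { intros z. f_equal; ring. }
          apply entire_hyp, Ht1.
    - intros u Hu. apply Rabs_def2 in Hu. unfold D. rewrite euler_pos by (assumption || lra).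
      ring. }
  apply Cminus_eq_0. rewrite <- H0. unfold D. ring.
Qed.

(** * Regularised hypergeometric functions *)

Lemma filterlim_punctured (f : C -> C) (z w : C) :
  filterlim f (locally' z) (locally w) <->
  forall eps, (0 < eps)%R -> exists d, (0 < d)%R /\ forall u, u <> z ->
    (Cmod (u - z) < d)%R -> (Cmod (f u - w) < eps)%R.
Proof.
  split.
  - intros H eps He.
    assert (L : locally w (fun v : C => (Cmod (v - w) < eps)%R)).
    { apply locally_C. exists eps. split; auto. }
    specialize (H _ L). unfold filtermap, locally', within in H.
    apply locally_C in H. destruct H as [d [Hd H]]. exists d. split; [exact Hd|].
    intros u Hu Hd'. apply H; assumption.
  - intros H P HP. apply locally_C in HP. destruct HP as [e [He HP]].
    destruct (H e He) as [d [Hd Hdd]]. unfold filtermap, locally', within.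
    apply locally_C. exists d. split; [exact Hd|]. intros u Hu Hne. apply HP, Hdd; assumption.
Qed.

Lemma filterlim_punctured_unique (f : C -> C) (z v w : C) :
  filterlim f (locally' z) (locally v) -> filterlim f (locally' z) (locally w) -> v = w.
Proof.
  rewrite !filterlim_punctured. intros Hv Hw. apply Cmod_small_eq. intros eps He.
  destruct (Hv (eps / 2)%R ltac:(lra)) as [d1 [Hd1 H1]].
  destruct (Hw (eps / 2)%R ltac:(lra)) as [d2 [Hd2 H2]].
  set (h := (Rmin d1 d2 / 2)%R).
  pose proof (Rmin_l d1 d2). pose proof (Rmin_r d1 d2). pose proof (Rmin_pos d1 d2 Hd1 Hd2).
  assert (Hh : Cmod (z + h - z) = h).
  { replace (z + h - z) with (RtoC h) by ring. rewrite Cmod_R. apply Rabs_pos_eq.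
    unfold h. lra. }
  assert (Hne : z + h <> z).
  { intros E. rewrite E in Hh. unfold Cminus in Hh. rewrite Cplus_opp_r, Cmod_0 in Hh.
    unfold h in Hh. lra. }
  specialize (H1 (z + h) Hne ltac:(rewrite Hh; unfold h; lra)).
  specialize (H2 (z + h) Hne ltac:(rewrite Hh; unfold h; lra)).
  rewrite Cmod_minus_sym in H1.
  eapply Rle_trans; [apply (Cmod_triangle_3 _ (f (z + h)))|]. lra.
Qed.

(** Near a pole only the pole itself is exceptional, so limits and continuations
    there see the generic formula. *)
Lemma nonpos_int_isolated (z u : C) :
  nonpos_int z -> u <> z -> (Cmod (u - z) < 1)%R -> ~ nonpos_int u.
Proof.
  intros [k ->] Hne Hlt [j ->].
  replace (- INR j - - INR k) with (RtoC (INR k - INR j)) in Hlt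
    by (rewrite RtoC_minus; ring).
  rewrite Cmod_R in Hlt. apply Rabs_def2 in Hlt.
  assert (E : k = j).
  { destruct (Nat.lt_total k j) as [h|[h|h]]; [|exact h|];
      apply le_INR in h; rewrite S_INR in h; lra. }
  apply Hne. rewrite E. reflexivity.
Qed.

Lemma poch_not_nonpos c p : ~ nonpos_int c -> poch c p <> 0.
Proof. intros H. apply poch_neq_0. intros k _ E. apply H. exists k. exact E. Qed.

Lemma hyp2F1_hyp (a b c t : C) :
  ~ nonpos_int c -> (Cmod t < 1)%R -> / Gamma c * hyp2F1 a b c t = hyp a b c t.
Proof.
  intros Hc Ht. unfold hyp2F1. destruct (Rlt_dec (Cmod t) 1) as [_|h]; [|contradiction].
  rewrite Gamma_rGamma by exact Hc. pose proof (rGamma_neq_0 c Hc) as H0.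
  unfold pFq. rewrite (CSeries_eq _ (/ rGamma c * hyp a b c t)).
  - field. exact H0.
  - eapply is_series_C_ext; [|apply is_series_Cmult, (hyp_series a b c t Ht)].
    intros p. unfold hyp_term. rewrite (rGamma_poch c p) in H0 |- *. simpl.
    pose proof (poch_not_nonpos c p Hc).
    assert (rGamma (c + INR p) <> 0) by (intros E; apply H0; rewrite E; ring).
    field. repeat split; try assumption. apply INR_fact_neq.
Qed.

Lemma reg2F1_hyp (a b c t : C) : (Cmod t < 1)%R -> reg2F1 a b c t = hyp a b c t.
Proof.
  intros Ht. unfold reg2F1. destruct (excluded_middle_informative (nonpos_int c)) as [Hc|Hc].
  2:{ apply hyp2F1_hyp; assumption. }
  assert (HL : filterlim (fun c' => / Gamma c' * hyp2F1 a b c' t) (locally' c)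
                 (locally (hyp a b c t))).
  { apply filterlim_punctured. intros eps He.
    assert (HE : entire (fun z => hyp a b z t)).
    { apply (entire_ext (fun z => hyp (0 * z + a) (0 * z + b) (1 * z + 0) t)).
      - intros z. f_equal; ring.
      - apply entire_hyp, Ht. }
    destruct (entire_continuous _ c eps HE He) as [d [Hd H]].
    exists (Rmin d 1). split; [apply Rmin_pos; lra|]. intros u Hu Hlt.
    pose proof (Rmin_l d 1). pose proof (Rmin_r d 1).
    rewrite hyp2F1_hyp; [apply H; lra| |exact Ht].
    apply (nonpos_int_isolated c); [exact Hc|exact Hu|lra]. }
  apply Ciota_eq; [exact HL|]. intros v Hv.
  exact (filterlim_punctured_unique _ _ _ _ Hv HL).
Qed.

(** * The left-hand side *)

Lemma RtoC_half (x : R) : RtoC (x / 2) = x / 2.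
Proof. rewrite RtoC_div by lra. reflexivity. Qed.

(** With [X = (1 - R - r)/2] and [Y = (1 - R + r)/2] the three powers combine to
    [(r/2)^(mu-1/2) ((1-X)(1-Y))^(1/2-mu)], and Euler's transformation absorbs the
    second factor. *)
Lemma lhs_gegenbauer_sum lambda mu nu (r x : R) :
  (-1 / 2 < nu)%R -> nu <> 0%R -> (0 < r < 1)%R -> (-1 < x < 1)%R ->
  lhs lambda mu r x
  = Cpower (r / 2) (mu - 1 / 2) / nu * gegenbauer_sum nu (- lambda) (2 * mu + lambda) x r.
Proof.
  intros Hnu Hnu0 Hr Hx.
  set (rt := sqrt (1 + r ^ 2 - 2 * r * x)).
  assert (Hrad : (0 <= 1 + r ^ 2 - 2 * r * x)%R) by nra.
  assert (Hrt2 : (rt * rt = 1 + r ^ 2 - 2 * r * x)%R) by (apply sqrt_sqrt; exact Hrad).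
  assert (Hrt0 : (0 <= rt)%R) by apply sqrt_pos.
  assert (Hlow : (1 - r < rt)%R) by nra.
  assert (Hup : (rt < 1 + r)%R) by nra.
  set (s := ((rt + r - 1) / 2)%R). set (Y := ((1 - rt + r) / 2)%R).
  assert (Hs : (0 < s)%R) by (unfold s; lra). assert (HY : (0 < Y)%R) by (unfold Y; lra).
  assert (HYs : (Y + s = r)%R) by (unfold Y, s; field).
  pose proof (product_formula nu (- lambda) (2 * mu + lambda) Y s Hnu Hnu0
    ltac:(lra) ltac:(lra) ltac:(lra)) as HP.
  assert (Hv : (ray_v Y s - ray_u Y s = r)%R) by (unfold ray_u, ray_v; rewrite <- HYs; ring).
  assert (Hu : (ray_u Y s + ray_v Y s = r * x)%R).
  { unfold ray_u, ray_v, Y, s. nra. }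
  rewrite Hu, Hv in HP. replace (r * x / r)%R with x in HP by (field; lra).
  rewrite HP.
  replace ((- lambda + (2 * mu + lambda) + 1) / 2) with (mu + 1 / 2) by field.
  unfold lhs. fold rt. unfold LegendreP, FerrersP.
  set (L := lambda + mu - 1 / 2).
  replace (1 - (1 / 2 - mu)) with (mu + 1 / 2) by field.
  replace ((1 / 2 - mu) / 2) with (1 / 4 - mu / 2) by field.
  assert (EX : (1 - (rt + r)%R) / 2 = RtoC (- s)).
  { unfold s. rewrite RtoC_opp, RtoC_half, RtoC_minus, RtoC_plus. field. }
  assert (EY : (1 - (rt - r)%R) / 2 = RtoC Y).
  { unfold Y. rewrite RtoC_half, RtoC_plus, !RtoC_minus. field. }
  rewrite EX, EY.
  assert (HsA : (Rabs (- s) < 1)%R) by (rewrite Rabs_Ropp, Rabs_pos_eq; lra).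
  assert (HYA : (Rabs Y < 1)%R) by (rewrite Rabs_pos_eq; lra).
  rewrite !reg2F1_hyp by (rewrite Cmod_R; assumption).
  assert (HE : forall t : R, (Rabs t < 1)%R ->
    hyp (- lambda) (2 * mu + lambda) (mu + 1 / 2) t
    = Cexp (- ln (1 - t)%R * (mu - 1 / 2)) * hyp (- L) (L + 1) (mu + 1 / 2) t).
  { intros t Ht. pose proof (euler_transformation (- L) (L + 1) (mu + 1 / 2) t Ht) as E.
    replace (mu + 1 / 2 - - L) with (2 * mu + lambda) in E by (unfold L; field).
    replace (mu + 1 / 2 - (L + 1)) with (- lambda) in E by (unfold L; field).
    rewrite hyp_sym, E. f_equal. f_equal. unfold L. field. }
  rewrite (HE _ HsA), (HE _ HYA).
  (* the powers, all of positive reals *)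
  assert (E1 : 1 - RtoC x ^ 2 = RtoC (1 - x ^ 2)) by (rewrite RtoC_minus, RtoC_pow; reflexivity).
  assert (E2 : ((rt + r)%R + 1) / ((rt + r)%R - 1) = RtoC ((rt + r + 1) / (rt + r - 1))).
  { rewrite RtoC_div, (RtoC_plus _ 1), (RtoC_minus _ 1) by lra. reflexivity. }
  assert (E3 : (1 + (rt - r)%R) / (1 - (rt - r)%R) = RtoC ((1 + (rt - r)) / (1 - (rt - r)))).
  { rewrite RtoC_div, (RtoC_plus 1), (RtoC_minus 1) by lra. reflexivity. }
  rewrite E1, E2, E3, <- (RtoC_half r).
  assert (P1 : (0 < 1 - x ^ 2)%R) by nra.
  assert (P2 : (0 < (rt + r + 1) / (rt + r - 1))%R) by (apply Rdiv_lt_0_compat; lra).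
  assert (P3 : (0 < (1 + (rt - r)) / (1 - (rt - r)))%R) by (apply Rdiv_lt_0_compat; lra).
  rewrite !Cpower_pos by lra.
  assert (Hln : (ln (1 - x ^ 2) + ln ((rt + r + 1) / (rt + r - 1))
                 + ln ((1 + (rt - r)) / (1 - (rt - r)))
                 = 2 * (ln (1 - - s) + ln (1 - Y) - ln (r / 2)))%R).
  { assert (P12 := Rmult_lt_0_compat _ _ P1 P2).
    assert (PXY : (0 < (1 - - s) * (1 - Y))%R) by (apply Rmult_lt_0_compat; lra).
    rewrite <- (ln_mult (1 - x ^ 2)) by assumption. rewrite <- ln_mult by assumption.
    rewrite <- ln_mult by lra. rewrite <- ln_div by lra.
    set (w := ((1 - - s) * (1 - Y) / (r / 2))%R).
    assert (Hw : (0 < w)%R).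
    { unfold w. apply Rdiv_lt_0_compat; [apply Rmult_lt_0_compat|]; lra. }
    replace (2 * ln w)%R with (ln w + ln w)%R by ring. rewrite <- ln_mult by exact Hw.
    f_equal. unfold w, s, Y.
    assert (Hq : (4 * r ^ 2 * (1 - x ^ 2)
                   = ((rt + r + 1) * (rt + r - 1)) * ((1 + (rt - r)) * (1 - (rt - r))))%R).
    { replace (((rt + r + 1) * (rt + r - 1)) * ((1 + (rt - r)) * (1 - (rt - r))))%R
        with ((rt * rt + 2 * rt * r + r ^ 2 - 1) * (1 - rt * rt + 2 * rt * r - r ^ 2))%R by ring.
      rewrite Hrt2.
      replace ((1 + r ^ 2 - 2 * r * x + 2 * rt * r + r ^ 2 - 1)
         * (1 - (1 + r ^ 2 - 2 * r * x) + 2 * rt * r - r ^ 2))%R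
        with (4 * r ^ 2 * (rt * rt - (r - x) ^ 2))%R by ring.
      rewrite Hrt2. ring. }
    apply (Rmult_eq_reg_l (4 * r ^ 2)); [|nra].
    transitivity (4 * r ^ 2 * (1 - x ^ 2) * ((rt + r + 1) / (rt + r - 1))
                    * ((1 + (rt - r)) / (1 - (rt - r))))%R; [ring|].
    rewrite Hq. field. lra. }
  assert (HC : Cexp (ln (1 - x ^ 2) * (1 / 4 - mu / 2))
      * Cexp (ln ((rt + r + 1) / (rt + r - 1)) * (1 / 4 - mu / 2))
      * Cexp (ln ((1 + (rt - r)) / (1 - (rt - r))) * (1 / 4 - mu / 2))
    = Cexp (ln (r / 2) * (mu - 1 / 2)) * Cexp (- ln (1 - - s)%R * (mu - 1 / 2))
        * Cexp (- ln (1 - Y)%R * (mu - 1 / 2))).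
  { rewrite <- !Cexp_plus. f_equal.
    transitivity (RtoC (ln (1 - x ^ 2) + ln ((rt + r + 1) / (rt + r - 1))
                 + ln ((1 + (rt - r)) / (1 - (rt - r)))) * (1 / 4 - mu / 2)).
    - rewrite !RtoC_plus. ring.
    - rewrite Hln, RtoC_mult, RtoC_minus, RtoC_plus. field. }
  match goal with |- ?A * (?B * ?h1) * (?D * ?h2) = _ =>
    transitivity (A * B * D * (h1 * h2)); [ring|] end.
  rewrite HC. field. apply RtoC_neq, Hnu0.
Qed.

(** * Continuity up to [x = 1] and [x = -1] *)

Definition contC (f : R -> C) (x : R) : Prop :=
  forall eps, (0 < eps)%R -> exists d, (0 < d)%R /\
    forall y, (Rabs (y - x) < d)%R -> (Cmod (f y - f x)%C < eps)%R.

Lemma contC_const c x : contC (fun _ => c) x.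
Proof.
  intros eps He. exists 1%R. split; [lra|]. intros y _. unfold Cminus.
  rewrite Cplus_opp_r, Cmod_0. exact He.
Qed.

Lemma contC_id x : contC RtoC x.
Proof.
  intros eps He. exists eps. split; [exact He|]. intros y Hy.
  rewrite <- RtoC_minus, Cmod_R. exact Hy.
Qed.

Lemma contC_plus f g x : contC f x -> contC g x -> contC (fun y => f y + g y) x.
Proof.
  intros Hf Hg eps He.
  destruct (Hf (eps / 2)%R ltac:(lra)) as [d1 [Hd1 H1]].
  destruct (Hg (eps / 2)%R ltac:(lra)) as [d2 [Hd2 H2]].
  exists (Rmin d1 d2). split; [apply Rmin_pos; assumption|]. intros y Hy.
  pose proof (Rmin_l d1 d2). pose proof (Rmin_r d1 d2).
  specialize (H1 y ltac:(lra)). specialize (H2 y ltac:(lra)).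
  replace (f y + g y - (f x + g x)) with ((f y - f x) + (g y - g x)) by ring.
  eapply Rle_lt_trans; [apply Cmod_triangle|]. lra.
Qed.

Lemma contC_mult f g x : contC f x -> contC g x -> contC (fun y => f y * g y) x.
Proof.
  intros Hf Hg eps He.
  set (P := (Cmod (f x) + Cmod (g x) + 1)%R).
  pose proof (Cmod_ge_0 (f x)). pose proof (Cmod_ge_0 (g x)).
  assert (HP : (1 <= P)%R) by (unfold P; lra).
  assert (He1 : (0 < Rmin 1 (eps / (3 * P)))%R).
  { apply Rmin_pos; [lra|]. apply Rdiv_lt_0_compat; lra. }
  pose proof (Rmin_l 1 (eps / (3 * P))) as R1. pose proof (Rmin_r 1 (eps / (3 * P))) as R2.
  destruct (Hf _ He1) as [d1 [Hd1 H1]]. destruct (Hg _ He1) as [d2 [Hd2 H2]].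
  exists (Rmin d1 d2). split; [apply Rmin_pos; assumption|]. intros y Hy.
  pose proof (Rmin_l d1 d2). pose proof (Rmin_r d1 d2).
  specialize (H1 y ltac:(lra)). specialize (H2 y ltac:(lra)).
  replace (f y * g y - f x * g x)
    with ((f y - f x) * (g y - g x) + (f y - f x) * g x + f x * (g y - g x)) by ring.
  eapply Rle_lt_trans; [apply Cmod_triangle|].
  eapply Rle_lt_trans; [apply Rplus_le_compat_r, Cmod_triangle|].
  rewrite !Cmod_mult.
  set (e := Rmin 1 (eps / (3 * P))) in *.
  pose proof (Cmod_ge_0 (f y - f x)). pose proof (Cmod_ge_0 (g y - g x)).
  assert (HeP : (e * P <= eps / 3)%R).
  { apply Rle_trans with (eps / (3 * P) * P)%R; [apply Rmult_le_compat_r; lra|].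
    apply Req_le. field. lra. }
  assert (T1 : (Cmod (f y - f x) * Cmod (g y - g x) <= e * 1)%R)
    by (apply Rmult_le_compat; lra).
  assert (T2 : (Cmod (f y - f x) * Cmod (g x) <= e * Cmod (g x))%R)
    by (apply Rmult_le_compat_r; lra).
  assert (T3 : (Cmod (f x) * Cmod (g y - g x) <= Cmod (f x) * e)%R)
    by (apply Rmult_le_compat_l; lra).
  assert (HS : (e * 1 + e * Cmod (g x) + Cmod (f x) * e = e * P)%R) by (unfold P; ring).
  lra.
Qed.

Lemma contC_ext f g x : (forall y, f y = g y) -> contC f x -> contC g x.
Proof.
  intros H Hf eps He. destruct (Hf eps He) as [d [Hd Hd']]. exists d. split; [exact Hd|].
  intros y Hy. rewrite <- !H. apply Hd', Hy.
Qed.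

Lemma contC_Csum (f : nat -> R -> C) n x :
  (forall k, contC (f k) x) -> contC (fun y => Csum (fun k => f k y) n) x.
Proof.
  intros H. induction n as [|n IH].
  - apply (contC_ext (f O)); [intros; rewrite Csum_0; reflexivity|apply H].
  - apply (contC_ext (fun y => Csum (fun k => f k y) n + f (S n) y)).
    + intros. rewrite Csum_S. reflexivity.
    + apply contC_plus; [exact IH|apply H].
Qed.

Lemma contC_geg nu n x : contC (fun y => RtoC (geg nu y n)) x.
Proof.
  assert (H : contC (fun y => RtoC (geg nu y n)) x /\ contC (fun y => RtoC (geg nu y (S n))) x).
  { induction n as [|n [IH1 IH2]].
    - split; [exact (contC_const 1 x)|].
      apply (contC_ext (fun y => 2 * nu * y)).
      { intros y. rewrite geg_1, !RtoC_mult. reflexivity. }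
      apply contC_mult; [apply contC_const|apply contC_id].
    - split; [exact IH2|].
      apply (contC_ext (fun y => (RtoC (2 * (INR n + 1 + nu) / (INR n + 2)) * y) * geg nu y (S n)
               + RtoC (- (INR n + 2 * nu) / (INR n + 2)) * geg nu y n)).
      + intros y. rewrite <- !RtoC_mult, <- RtoC_plus. f_equal.
        pose proof (pos_INR n). apply (Rmult_eq_reg_l (INR n + 2)); [|lra].
        rewrite geg_SS. field. lra.
      + apply contC_plus; apply contC_mult; try assumption; try apply contC_const.
        apply contC_mult; [apply contC_const|apply contC_id]. }
  apply H.
Qed.

Lemma gegenbauer_sum_continuous nu a b (rho : C) x eps :
  (-1 / 2 < nu)%R -> (Cmod rho < 1)%R -> (-1 <= x <= 1)%R -> (0 < eps)%R ->
  exists d, (0 < d)%R /\ forall y, (-1 <= y <= 1)%R -> (Rabs (y - x) < d)%R ->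
    (Cmod (gegenbauer_sum nu a b y rho - gegenbauer_sum nu a b x rho) < eps)%R.
Proof.
  intros Hnu Hrho Hx He. destruct (nat_above (Cmod a + Cmod b)) as [A HA].
  pose proof (Cmod_ge_0 a). pose proof (Cmod_ge_0 b).
  destruct (gegenbauer_sum_dominated nu A (Cmod rho) Hnu (conj (Cmod_ge_0 _) Hrho)) as [M [q [Hq HM]]].
  destruct (geom_tail_lim M q (eps / 4) Hq ltac:(lra)) as [K HK].
  specialize (HK K (Nat.le_refl K)).
  assert (Htail : forall y, (-1 <= y <= 1)%R ->
    (Cmod (Csum (fun N => rho_coef nu a b y N * rho ^ N)%C K - gegenbauer_sum nu a b y rho) < eps / 4)%R).
  { intros y Hy.
    destruct (geom_series (fun N => rho_coef nu a b y N * rho ^ N) M q Hq) as [s [Hs Ht]].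
    { apply HM; lra || assumption. }
    rewrite (is_series_C_unique _ _ _ (gegenbauer_sum_series nu a b y rho Hnu Hy Hrho) Hs).
    eapply Rle_lt_trans; [apply Ht|exact HK]. }
  assert (HC : contC (fun y => Csum (fun N => rho_coef nu a b y N * rho ^ N) K) x).
  { apply (contC_Csum (fun N y => rho_coef nu a b y N * rho ^ N)). intros N.
    apply contC_mult; [|apply contC_const]. unfold rho_coef, diagonal.
    apply (contC_Csum (fun k y => if Nat.leb (2 * k) N then
             dcoef nu a b (N - 2 * k) k * geg nu y (N - 2 * k) else 0)).
    intros k. destruct (Nat.leb (2 * k) N); [|apply contC_const].
    apply contC_mult; [apply contC_const|apply contC_geg]. }
  destruct (HC (eps / 4)%R ltac:(lra)) as [d [Hd HCd]]. exists d. split; [exact Hd|].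
  intros y Hy Hyx. specialize (HCd y Hyx).
  pose proof (Htail y Hy) as T1. pose proof (Htail x Hx) as T2.
  set (Sy := Csum (fun N => rho_coef nu a b y N * rho ^ N) K) in *.
  set (Sx := Csum (fun N => rho_coef nu a b x N * rho ^ N) K) in *.
  eapply Rle_lt_trans; [apply (Cmod_triangle_3 _ Sy)|].
  rewrite (Cmod_minus_sym _ Sy).
  eapply Rle_lt_trans; [apply Rplus_le_compat_l, (Cmod_triangle_3 _ Sx)|]. lra.
Qed.

(** At the end points the limit of the left-hand side is read off from the series,
    which converges uniformly in [x]. *)
Lemma is_lhs_gegenbauer_sum lambda mu nu (r x : R) :
  (-1 / 2 < nu)%R -> nu <> 0%R -> (0 < r < 1)%R -> (-1 <= x <= 1)%R ->
  is_lhs lambda mu r x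
    (Cpower (r / 2) (mu - 1 / 2) / nu * gegenbauer_sum nu (- lambda) (2 * mu + lambda) x r).
Proof.
  intros Hnu Hnu0 Hr Hx.
  assert (Hrc : (Cmod r < 1)%R) by (rewrite Cmod_R, Rabs_pos_eq; lra).
  destruct (Rlt_dec (-1) x) as [h1|h1]; [destruct (Rlt_dec x 1) as [h2|h2]|].
  1: { left. split; [lra|]. apply lhs_gegenbauer_sum; assumption || lra. }
  all: right; split; [lra|].
  all: set (P := Cpower (r / 2) (mu - 1 / 2) / nu).
  all: intros Q HQ; apply locally_C in HQ; destruct HQ as [e [He HQ]].
  all: assert (HP : (0 < e / (Cmod P + 1))%R)
         by (apply Rdiv_lt_0_compat; [exact He|pose proof (Cmod_ge_0 P); lra]).
  all: destruct (gegenbauer_sum_continuous nu (- lambda) (2 * mu + lambda) r x _ Hnu Hrc Hx HP)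
         as [d [Hd HC]].
  all: exists (mkposreal d Hd); intros y Hy Hy1; apply HQ.
  all: rewrite (lhs_gegenbauer_sum lambda mu nu) by assumption; fold P.
  all: rewrite <- Cmult_minus_distr, Cmod_mult.
  all: assert (Hyx : (Rabs (y - x) < d)%R) by exact Hy.
  all: specialize (HC y ltac:(lra) Hyx).
  all: apply Rlt_div_r in HC; [|pose proof (Cmod_ge_0 P); lra].
  all: pose proof (Cmod_ge_0 P); eapply Rle_lt_trans; [|exact HC].
  all: match goal with |- (_ * ?g <= _)%R => pose proof (Cmod_ge_0 P);
         assert (0 <= g)%R by apply Cmod_ge_0; nra end.
Qed.

(** The sum by powers of [rho] is holomorphic in the disc, so it is the analytic
    continuation of its values on [(0, 1)]. *)
Lemma gegenbauer_sum_quotient lambda mu nu (x : R) :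
  (-1 / 2 < nu)%R -> nu <> 0%R -> (-1 <= x <= 1)%R ->
  is_lhs_quotient lambda mu x (fun z => gegenbauer_sum nu (- lambda) (2 * mu + lambda) x z / nu).
Proof.
  intros Hnu Hnu0 Hx. split.
  - intros z Hz. set (r := ((1 - Cmod z) / 2)%R). assert (Hr : (0 < r)%R) by (unfold r; lra).
    set (a := - lambda). set (b := 2 * mu + lambda).
    pose proof (Cmod_ge_0 z) as Hz0.
    assert (Hrho : (0 <= Cmod z + r < 1)%R) by (unfold r; lra).
    assert (Hball : forall w, (Cmod (w - z) <= r)%R -> (Cmod w <= Cmod z + r)%R).
    { intros w Hw. replace w with (z + (w - z)) by ring.
      eapply Rle_trans; [apply Cmod_triangle|]. lra. }
    apply (approx_ex_derive z r); [exact Hr|].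
    apply (approx_mult z r (fun z => gegenbauer_sum nu a b x z) (fun _ => / nu)).
    2:{ apply entire_const. }
    destruct (nat_above (Cmod a + Cmod b)) as [A HA].
    pose proof (Cmod_ge_0 a). pose proof (Cmod_ge_0 b).
    destruct (gegenbauer_sum_dominated nu A _ Hnu Hrho) as [M [q [Hq HM]]].
    apply (approx_series z r (fun N w => rho_coef nu a b x N * w ^ N) _ M q Hq).
    + intros N. apply approx_mult; [apply entire_const|].
      induction N as [|N IH].
      * apply (approx_ext z r (fun _ => 1)); [reflexivity|apply entire_const].
      * apply (approx_ext z r (fun w => w * w ^ N)); [reflexivity|].
        apply approx_mult; [apply entire_id|exact IH].
    + intros w Hw. apply gegenbauer_sum_series; try assumption. specialize (Hball w Hw). lra.
    + intros n w Hw. apply HM; try lra; try assumption. apply Hball, Hw.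
  - intros r Hr. exists (Cpower (r / 2) (mu - 1 / 2) / nu * gegenbauer_sum nu (- lambda) (2 * mu + lambda) x r).
    split; [apply is_lhs_gegenbauer_sum; assumption|].
    assert (HP : Cpower (r / 2) (mu - 1 / 2) <> 0).
    { unfold Cpower. apply Cexp_neq_0. }
    field. split; [apply RtoC_neq, Hnu0|exact HP].
Qed.

(** * The right-hand side *)

Definition row_term (nu : R) (a b : C) (rho : C) (x : R) (n k : nat) : C :=
  dcoef nu a b n k * geg nu x n * rho ^ (n + 2 * k).

Lemma row_dominated nu A rho :
  (-1 / 2 < nu)%R -> (Cmod rho < 1)%R ->
  exists M q, (0 <= M)%R /\ (0 <= q < 1)%R /\ forall a b x n k,
    (Cmod a <= INR A)%R -> (Cmod b <= INR A)%R -> (-1 <= x <= 1)%R ->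
    (Cmod (row_term nu a b rho x n k) <= M * q ^ (n + 2 * k))%R.
Proof.
  intros Hnu Hrho. destruct (dcoef_geg_bound nu A Hnu) as [K [B [HK HB]]].
  destruct (poly_geom B (Cmod rho) (conj (Cmod_ge_0 rho) Hrho)) as [M [q [Hq [HM [_ HG]]]]].
  exists (K * M)%R, q. split; [apply Rmult_le_pos; lra|]. split; [exact Hq|].
  intros a b x n k Ha Hb Hx. unfold row_term. rewrite Cmod_mult, Cmod_pow.
  apply Rle_trans with (K * INR (S (n + 2 * k)) ^ B * Cmod rho ^ (n + 2 * k))%R.
  - apply Rmult_le_compat_r; [apply pow_le, Cmod_ge_0|apply HB; assumption].
  - rewrite !Rmult_assoc. apply Rmult_le_compat_l; [exact HK|apply HG].
Qed.

Definition row_sum (nu : R) (a b : C) (rho : C) (x : R) (n : nat) : C :=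
  CSeries (row_term nu a b rho x n).

Lemma row_term_geom nu A rho :
  (-1 / 2 < nu)%R -> (Cmod rho < 1)%R ->
  exists M q, (0 <= q < 1)%R /\ forall a b x n,
    (Cmod a <= INR A)%R -> (Cmod b <= INR A)%R -> (-1 <= x <= 1)%R ->
    forall k, (Cmod (row_term nu a b rho x n k) <= M * q ^ k)%R.
Proof.
  intros Hnu Hrho. destruct (row_dominated nu A rho Hnu Hrho) as [M [q [HM [Hq HB]]]].
  exists M, q. split; [exact Hq|]. intros a b x n Ha Hb Hx k.
  eapply Rle_trans; [apply HB; assumption|]. apply Rmult_le_compat_l; [exact HM|].
  replace (n + 2 * k)%nat with (k + (n + k))%nat by lia. rewrite pow_add.
  pose proof (pow_le q k ltac:(lra)).
  assert (q ^ (n + k) <= 1)%R by (rewrite <- (pow1 (n + k)); apply pow_incr; lra). nra.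
Qed.

Lemma row_series nu a b rho x n :
  (-1 / 2 < nu)%R -> (Cmod rho < 1)%R -> (-1 <= x <= 1)%R ->
  is_series (row_term nu a b rho x n) (row_sum nu a b rho x n).
Proof.
  intros Hnu Hrho Hx. destruct (nat_above (Cmod a + Cmod b)) as [A HA].
  pose proof (Cmod_ge_0 a). pose proof (Cmod_ge_0 b).
  destruct (row_term_geom nu A rho Hnu Hrho) as [M [q [Hq HM]]].
  apply (dominated_CSeries _ M q Hq), HM; lra || assumption.
Qed.

(** Absolute convergence lets the double series be summed by [n] first or by
    [n + 2k] first. *)
Lemma row_sum_series nu a b rho x :
  (-1 / 2 < nu)%R -> (Cmod rho < 1)%R -> (-1 <= x <= 1)%R ->
  is_series (row_sum nu a b rho x) (gegenbauer_sum nu a b x rho).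
Proof.
  intros Hnu Hrho Hx. destruct (nat_above (Cmod a + Cmod b)) as [A HA].
  pose proof (Cmod_ge_0 a). pose proof (Cmod_ge_0 b).
  destruct (row_dominated nu A rho Hnu Hrho) as [M [q [HM [Hq HB]]]].
  apply (diagonal_series 2 (row_term nu a b rho x) (row_sum nu a b rho x) M q).
  - lia.
  - exact Hq.
  - intros n k. apply HB; lra || assumption.
  - intros n. apply row_series; assumption.
  - eapply is_series_C_ext; [|apply gegenbauer_sum_series; eassumption].
    intros N. unfold rho_coef, diagonal. rewrite Cmult_comm, <- Csum_scal.
    apply Csum_ext. intros k _. destruct (Nat.leb_spec (2 * k) N) as [h|h]; [|ring].
    unfold row_term. replace (N - 2 * k + 2 * k)%nat with N by lia. ring.
Qed.

Lemma poch_halves z k :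
  poch (z / 2) k * poch ((z + 1) / 2) k = poch z (2 * k) / 2 ^ (2 * k).
Proof.
  pose proof (poch_double (z / 2) k) as H.
  replace (2 * (z / 2)) with z in H by field.
  replace (z / 2 + 1 / 2) with ((z + 1) / 2) in H by field.
  replace (2 * k)%nat with (k + k)%nat by lia. rewrite H. field. apply two_pow_neq.
Qed.

(** In the [6F5] the halved parameters pair up, [(z/2)_k ((z+1)/2)_k = (z)_(2k)/4^k],
    and the powers of [4] cancel. When the prefactor vanishes, so does every term of
    the row. *)
Lemma rhs_generic_row lambda (nu : R) rho (x : R) n mu :
  (-1 / 2 < nu)%R -> (Cmod rho < 1)%R -> (-1 <= x <= 1)%R -> ~ nonpos_int (2 * mu) ->
  rhs_term_generic lambda nu rho x n mu
  = row_sum nu (- lambda) (2 * mu + lambda) rho x n.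
Proof.
  intros Hnu Hrho Hx Hmu.
  set (a := - lambda). set (b := 2 * mu + lambda).
  assert (Hc : ~ nonpos_int (mu + 1 / 2)).
  { intros [k Hk]. apply Hmu. exists (S (k + k)).
    replace mu with (mu + 1 / 2 - 1 / 2) by ring. rewrite Hk, INR_S_C, plus_INR, RtoC_plus. field. }
  assert (P2 : forall j, poch (2 * mu) j <> 0) by (intros; apply poch_not_nonpos, Hmu).
  assert (Pc : forall j, poch (mu + 1 / 2) j <> 0) by (intros; apply poch_not_nonpos, Hc).
  unfold rhs_term_generic. rewrite Gegenbauer_geg by exact Hnu.
  set (pre := (nu + INR n) * poch (- lambda) n * poch (2 * mu + lambda) n * poch mu n
     / (poch (2 * mu) n * poch (mu + 1 / 2) n * poch (nu + 1) n)).
  assert (HG : / Gamma (mu + 1 / 2) ^ 2 = rGamma (mu + 1 / 2) ^ 2).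
  { pose proof (Gamma_rGamma _ Hc) as E. pose proof (rGamma_neq_0 _ Hc) as N.
    assert (NG : Gamma (mu + 1 / 2) <> 0).
    { intros h. apply N. rewrite <- E, h. unfold Cinv. apply injective_projections; simpl;
      unfold Rdiv; ring. }
    rewrite <- E. field. exact NG. }
  rewrite HG.
  set (t := fun k => Cprod (map (fun u => poch u k)
      [(- lambda + INR n) / 2; (- lambda + INR n + 1) / 2; (2 * mu + lambda + INR n) / 2;
       (2 * mu + lambda + INR n + 1) / 2; mu + INR n; mu - nu])
    / Cprod (map (fun u => poch u k)
      [(2 * mu + INR n) / 2; (2 * mu + INR n + 1) / 2; (mu + INR n + 1 / 2) / 2;
       (mu + INR n + 3 / 2) / 2; nu + 1 + INR n])
    * ((rho ^ 2) ^ k / INR (fact k))).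
  assert (Ht : forall k, row_term nu a b rho x n k
             = rGamma (mu + 1 / 2) ^ 2 * pre * rho ^ n * geg nu x n * t k).
  { intros k. unfold row_term. rewrite (dcoef_generic nu a b n k Hnu).
    - assert (E1 : a + b = 2 * mu) by (unfold a, b; ring).
      assert (E2 : (a + b + 1) / 2 = mu + 1 / 2) by (unfold a, b; field).
      assert (E3 : (a + b) / 2 = mu) by (unfold a, b; field).
      rewrite E2, E3, E1. unfold t, pre. fold a b. simpl map. unfold Cprod. simpl fold_right.
      pose proof (poch_halves (a + INR n) k) as A1. pose proof (poch_halves (b + INR n) k) as A2.
      pose proof (poch_halves (2 * mu + INR n) k) as A3.
      pose proof (poch_halves (mu + 1 / 2 + INR n) k) as A4.
      replace (mu + INR n + 1 / 2) with (mu + 1 / 2 + INR n) by ring.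
      replace (mu + INR n + 3 / 2) with (mu + 1 / 2 + INR n + 1) by field.
      replace (nu + 1 + INR n) with (nu + 1 + INR n) by ring.
      rewrite !poch_add, Cpow_add_r, <- (Cpow_mult_r rho 2 k).
      set (W := 2 ^ (2 * k)) in *. assert (HW : W <> 0) by apply two_pow_neq.
      assert (D3 : poch (2 * mu + INR n) (2 * k) <> 0).
      { intros h. apply (P2 (n + 2 * k)%nat). rewrite poch_add, h. ring. }
      assert (D4 : poch (mu + 1 / 2 + INR n) (2 * k) <> 0).
      { intros h. apply (Pc (n + 2 * k)%nat). rewrite poch_add, h. ring. }
      assert (D5 : poch (nu + 1 + INR n) k <> 0).
      { intros h. apply (nu1_poch_neq nu (n + k) Hnu). rewrite poch_add, h. ring. }
      assert (D6 := nu1_poch_neq nu n Hnu). assert (D7 := P2 n). assert (D8 := Pc n).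
      assert (D9 := INR_fact_neq k).
      set (p1 := poch ((a + INR n) / 2) k) in *.
      set (p2 := poch ((a + INR n + 1) / 2) k) in *.
      set (p3 := poch ((b + INR n) / 2) k) in *.
      set (p4 := poch ((b + INR n + 1) / 2) k) in *.
      set (q1 := poch ((2 * mu + INR n) / 2) k) in *.
      set (q2 := poch ((2 * mu + INR n + 1) / 2) k) in *.
      set (q3 := poch ((mu + 1 / 2 + INR n) / 2) k) in *.
      set (q4 := poch ((mu + 1 / 2 + INR n + 1) / 2) k) in *.
      set (m := poch (mu + INR n) k). set (v := poch (mu - nu) k).
      set (w := poch (nu + 1 + INR n) k) in *.
      assert (NUM : p1 * (p2 * (p3 * (p4 * (m * (v * 1)))))
                = poch (a + INR n) (2 * k) / W * (poch (b + INR n) (2 * k) / W) * m * v).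
      { rewrite <- A1, <- A2. ring. }
      assert (DEN : q1 * (q2 * (q3 * (q4 * (w * 1))))
                = poch (2 * mu + INR n) (2 * k) / W
                  * (poch (mu + 1 / 2 + INR n) (2 * k) / W) * w).
      { rewrite <- A3, <- A4. ring. }
      rewrite NUM, DEN. field. repeat split; assumption.
    - replace (a + b) with (2 * mu) by (unfold a, b; ring). apply P2.
    - replace ((a + b + 1) / 2) with (mu + 1 / 2) by (unfold a, b; field). apply Pc. }
  set (kappa := rGamma (mu + 1 / 2) ^ 2 * pre * rho ^ n * geg nu x n) in *.
  unfold pFq. fold t.
  transitivity (kappa * CSeries t); [unfold kappa; ring|].
  pose proof (row_series nu a b rho x n Hnu Hrho Hx) as HS.
  destruct (Ceq_dec kappa 0) as [Hk|Hk].
  - rewrite Hk, Cmult_0_l. apply (is_series_C_unique (row_term nu a b rho x n)); [|exact HS].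
    apply (is_series_C_ext (fun _ => RtoC 0)).
    + intros k. rewrite Ht, Hk. ring.
    + pose proof (is_series_finite (fun _ => RtoC 0) O) as HZ.
      rewrite Csum_0 in HZ. apply HZ. reflexivity.
  - rewrite (CSeries_eq t (/ kappa * row_sum nu a b rho x n)); [field; exact Hk|].
    eapply is_series_C_ext; [|apply is_series_Cmult, HS].
    intros k. simpl. rewrite Ht. field. exact Hk.
Qed.

(** This function is the analytic continuation in [mu] of the terms of the series. *)
Lemma entire_row_sum lambda nu rho x n :
  (-1 / 2 < nu)%R -> (Cmod rho < 1)%R -> (-1 <= x <= 1)%R ->
  entire (fun mu => row_sum nu (- lambda) (2 * mu + lambda) rho x n).
Proof.
  intros Hnu Hrho Hx.
  apply (entire_series (fun k mu => row_term nu (- lambda) (2 * mu + lambda) rho x n k)).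
  - intros k. unfold row_term.
    apply (entire_mult (fun mu => dcoef nu (- lambda) (2 * mu + lambda) n k * geg nu x n)
             (fun _ => rho ^ (n + 2 * k))); [|apply entire_const].
    apply (entire_mult (fun mu => dcoef nu (- lambda) (2 * mu + lambda) n k)
             (fun _ => geg nu x n)); [|apply entire_const].
    apply (entire_ext (fun mu => dcoef nu (2 * mu + lambda) (- lambda) n k)).
    { intros z. apply dcoef_sym. }
    exact (entire_affine (fun a => dcoef nu a (- lambda) n k) 2 lambda (entire_dcoef nu (- lambda) n k)).
  - intros mu. apply row_series; assumption.
  - intros R0. destruct (nat_above (2 * Rabs R0 + Cmod lambda)) as [A HA].
    destruct (row_term_geom nu A rho Hnu Hrho) as [M [q [Hq HM]]].
    exists M, q. split; [exact Hq|]. intros k z Hz.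
    pose proof (Rle_abs R0). pose proof (Rabs_pos R0). pose proof (Cmod_ge_0 lambda).
    apply HM; [rewrite Cmod_opp; lra| |exact Hx].
    eapply Rle_trans; [apply Cmod_triangle|]. rewrite Cmod_mult, Cmod_R, Rabs_pos_eq by lra. lra.
Qed.

Lemma continuation_unique (g : C -> C) (z v w : C) :
  is_continuation_at g z v -> is_continuation_at g z w -> v = w.
Proof.
  assert (H : forall v, is_continuation_at g z v -> filterlim g (locally' z) (locally v)).
  { intros v0 [f [Hd [Hg <-]]]. apply filterlim_punctured. intros eps He.
    apply locally_C in Hd. destruct Hd as [d0 [Hd0 Hd]].
    assert (Hz : ex_derive f z).
    { apply Hd. unfold Cminus. rewrite Cplus_opp_r, Cmod_0. exact Hd0. }
    pose proof (ex_derive_continuous f z Hz) as HC.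
    assert (L : locally (f z) (fun u : C => (Cmod (u - f z) < eps)%R)).
    { apply locally_C. exists eps. split; auto. }
    destruct (HC _ L) as [d1 Hd1].
    unfold locally', within in Hg. apply locally_C in Hg. destruct Hg as [d2 [Hd2 Hg]].
    exists (Rmin d1 d2). split; [apply Rmin_pos; [apply cond_pos|exact Hd2]|].
    intros u Hu Hlt. pose proof (Rmin_l d1 d2). pose proof (Rmin_r d1 d2).
    rewrite <- Hg; [|lra|exact Hu]. apply Hd1.
    change (Cmod (u - z) < d1)%R. lra. }
  intros Hv Hw. exact (filterlim_punctured_unique g z v w (H v Hv) (H w Hw)).
Qed.

Lemma rhs_row lambda (nu : R) rho (x : R) n mu :
  (-1 / 2 < nu)%R -> (Cmod rho < 1)%R -> (-1 <= x <= 1)%R ->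
  rhs_term lambda mu nu rho x n = row_sum nu (- lambda) (2 * mu + lambda) rho x n.
Proof.
  intros Hnu Hrho Hx. unfold rhs_term.
  destruct (excluded_middle_informative (nonpos_int (2 * mu))) as [Hmu|Hmu].
  2:{ apply rhs_generic_row; assumption. }
  assert (HC : is_continuation_at (rhs_term_generic lambda nu rho x n) mu
                 (row_sum nu (- lambda) (2 * mu + lambda) rho x n)).
  { exists (fun m => row_sum nu (- lambda) (2 * m + lambda) rho x n).
    split; [|split; [|reflexivity]].
    - apply locally_C. exists 1%R. split; [lra|]. intros u _.
      apply entire_ex_derive, entire_row_sum; assumption.
    - unfold locally', within. apply locally_C. exists (1 / 2)%R. split; [lra|].
      intros u Hu Hne. symmetry. apply rhs_generic_row; try assumption.
      apply (nonpos_int_isolated (2 * mu)); [exact Hmu| |].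
      + intros E. apply Hne. apply (Cmult_cancel_l 2); [apply RtoC_neq; lra|exact E].
      + replace (2 * u - 2 * mu) with (2 * (u - mu)) by ring.
        rewrite Cmod_mult, Cmod_R, Rabs_pos_eq by lra. lra. }
  apply Ciota_eq; [exact HC|]. intros v Hv. exact (continuation_unique _ _ _ _ Hv HC).
Qed.

Theorem theorem6 (lambda mu : C) (nu : R) (rho : C) (x : R)
    (hnu : (-1 / 2 < nu)%R) (hnu0 : nu <> 0%R)
    (hrho : (Cmod rho < 1)%R) (hx : (-1 <= x <= 1)%R) :
  exists s : C,
    is_series (rhs_term lambda mu nu rho x) s /\
    (forall r : R, (0 < r < 1)%R -> rho = RtoC r ->
       is_lhs lambda mu r x (Cpower (rho / 2) (mu - 1 / 2) / nu * s)) /\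
    (exists Q : C -> C, is_lhs_quotient lambda mu x Q /\ Q rho = s / nu).
Proof.
  exists (gegenbauer_sum nu (- lambda) (2 * mu + lambda) x rho). split; [|split].
  - apply (is_series_C_ext (row_sum nu (- lambda) (2 * mu + lambda) rho x)).
    + intros n. symmetry. apply rhs_row; assumption.
    + apply row_sum_series; assumption.
  - intros r Hr ->. apply is_lhs_gegenbauer_sum; assumption.
  - exists (fun z => gegenbauer_sum nu (- lambda) (2 * mu + lambda) x z / nu).
    split; [apply gegenbauer_sum_quotient; assumption|reflexivity].
Qed.
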